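(* Let $S_2$ be the closed orientable surface of genus $2$, and let $\alpha_1,\beta_1,\alpha_2,\beta_2$ be the simple closed curves in $S_2$ described in the context. Define $a := T_{\alpha_1}^{-1}\circ T_{\alpha_2}$ and $b := T_{\beta_1}^{-1}\circ T_{\beta_2}$ in $\mathrm{Mod}(S_2)$, and let $\mathcal{T} := \langle a,b\rangle \leq \mathrm{Mod}(S_2)$. Then $\mathcal{T}\cong \mathrm{SL}_2(\mathbb{Z})$.
   Context: $\mathrm{Mod}(S)$ denotes the mapping class group of an oriented surface $S$: orientation-preserving homeomorphisms of $S$ (fixing the boundary pointwise) modulo isotopy. For a simple closed curve $\gamma$ in $S$, $T_\gamma\in\mathrm{Mod}(S)$ is the left Dehn twist about $\gamma$ and $T_\gamma^{-1}$ is the right Dehn twist. The curves: let $\varepsilon$ be a separating simple closed curve in $S_2$ cutting $S_2$ into two genus-one subsurfaces $M_1,M_2$, each with one boundary component. For $j\in\{1,2\}$, $\alpha_j$ and $\beta_j$ are simple closed curves in the interior of $M_j$ meeting transversally in exactly one point (a meridian and a longitude of the $j$-th handle). In particular the curves in $M_1$ are disjoint from those in $M_2$. (The group $\mathcal{T}$ is the group denoted $\Theta_2^1$ elsewhere in the paper.) *)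

(* Defs.v *)
From HB Require Import structures.
From mathcomp Require Import all_boot all_order all_algebra.
From mathcomp Require Import all_classical all_reals all_analysis.
Import Order.TTheory GRing.Theory Num.Theory.
Import numFieldNormedType.Exports.

Set Implicit Arguments.
Unset Strict Implicit.
Unset Printing Implicit Defensive.

Local Open Scope quotient_scope.
Local Open Scope classical_set_scope.
Local Open Scope ring_scope.

Section Surfaces.
Variables (R : realType) (S : topologicalType).

Definition open_embedding (phi : R * R -> S) : Prop :=
  [/\ continuous phi, injective phi &
      forall U : set (R * R), open U -> open (phi @` U)].

Definition circle_pt (p : R * R) (r s : R) : R * R :=
  (p.1 + r * cos s, p.2 + r * sin s).

(* Read in the coordinates [psi], the [phi]-image of every small positively
   oriented circle about [p] winds once, positively, around [q]: [rho] and
   [theta] are polar coordinates of the loop, centred at [q].  For topological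
   (not differentiable) transition maps this is the condition of having local
   degree 1 at [p]. *)
Definition co_oriented_at (phi psi : R * R -> S) (p q : R * R) : Prop :=
  \forall r \near (0 : R)^'+, exists rho theta : R -> R,
    [/\ continuous rho /\ continuous theta,
        forall s, 0 < rho s,
        forall s, theta (s + 2 * pi) = theta s + 2 * pi &
        forall s, phi (circle_pt p r s) =
                  psi (circle_pt q (rho s) (theta s))].

Definition co_oriented (phi psi : R * R -> S) : Prop :=
  forall p q, phi p = psi q -> co_oriented_at phi psi p q.

(* An orientation is a maximal coherently oriented atlas, whose elements are
   the inverses [R * R -> S] of the charts; its existence also expresses that
   [S] is locally Euclidean of dimension 2 (without boundary). *)
Definition orientation (O : set (R * R -> S)) : Prop :=
  [/\ forall phi, O phi -> open_embedding phi,
      forall x : S, exists2 phi, O phi & range phi x,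
      forall phi psi, O phi -> O psi -> co_oriented phi psi &
      forall phi, open_embedding phi ->
        (forall psi, O psi -> co_oriented phi psi) -> O phi].

Definition oriented_closed_surface (O : set (R * R -> S)) : Prop :=
  [/\ compact [set: S], hausdorff_space S, connected [set: S] &
      orientation O].

Definition homeomorphism (f : S -> S) : Prop :=
  continuous f /\
  exists g : S -> S, [/\ continuous g, cancel f g & cancel g f].

(* By maximality of [O], a homeomorphism has local degree 1 everywhere exactly
   when it carries the oriented atlas onto itself. *)
Definition orientation_preserving (O : set (R * R -> S)) (f : S -> S) : Prop :=
  forall phi, O (f \o phi) <-> O phi.

Definition isotopic (f g : S -> S) : Prop :=
  exists F : R * S -> S,
    [/\ {within `[0, 1] `*` [set: S], continuous F},
        forall t, 0 <= t <= 1 -> homeomorphism (fun x => F (t, x)),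
        forall x, F (0, x) = f x &
        forall x, F (1, x) = g x].

Definition simple_closed_curve (C : set S) : Prop :=
  exists c : R -> S,
    [/\ continuous c, forall s t, c s = c t <-> s - t \is a Num.int &
        C = range c].

(* Topological transversality: in suitable local coordinates the two curves are
   the two coordinate axes. *)
Definition transversal_at (C D : set S) (x : S) : Prop :=
  exists phi : R * R -> S,
    [/\ open_embedding phi, phi (0, 0) = x,
        C `&` range phi = phi @` [set p | p.2 = 0] &
        D `&` range phi = phi @` [set p | p.1 = 0]].

Definition meet_once_transversally (C D : set S) : Prop :=
  exists x, C `&` D = [set x] /\ transversal_at C D x.

(* The torus is R^2/Z^2; the hole is the image of the open disc of radius 1/4
   centred at (1/2, 1/2). *)
Definition dist2_hole (p : R * R) (m n : int) : R :=
  (p.1 - 2^-1 - m%:~R) ^+ 2 + (p.2 - 2^-1 - n%:~R) ^+ 2.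

Definition holed_plane : set (R * R) :=
  [set p | forall m n : int, 4^-1 ^+ 2 <= dist2_hole p m n].

Definition hole_boundary : set (R * R) :=
  [set p | exists m n : int, dist2_hole p m n = 4^-1 ^+ 2].

(* [h] induces a homeomorphism from the torus minus an open disc onto [M] that
   carries the boundary circle onto [E].  The conditions say that [h] descends
   to a continuous injection of this compact quotient into [S]; in a Hausdorff
   [S] that is an embedding. *)
Definition handle_map (h : R * R -> S) (M E : set S) : Prop :=
  [/\ {within holed_plane, continuous h},
      forall p q, holed_plane p -> holed_plane q ->
        (h p = h q <->
         p.1 - q.1 \is a Num.int /\ p.2 - q.2 \is a Num.int),
      M = h @` holed_plane & E = h @` hole_boundary].

Definition one_holed_torus (M E : set S) : Prop :=
  exists h, handle_map h M E.

Definition meridian_longitude (M E A B : set S) : Prop :=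
  exists h, [/\ handle_map h M E,
    A = h @` [set p | p.2 = 0] & B = h @` [set p | p.1 = 0]].

Definition separates_into_handles (E M1 M2 : set S) : Prop :=
  [/\ simple_closed_curve E /\ ~ connected (~` E),
      M1 `|` M2 = [set: S], M1 `&` M2 = E,
      one_holed_torus M1 E & one_holed_torus M2 E].

(* genus 2: the connected sum of two tori *)
Definition genus_two : Prop :=
  exists E M1 M2, separates_into_handles E M1 M2.

(* [A] and [B] lie in the interior of the handle [M] bounded by [E]. *)
Definition handle_curves (M E A B : set S) : Prop :=
  [/\ simple_closed_curve A /\ simple_closed_curve B,
      A `<=` M `\` E /\ B `<=` M `\` E,
      meet_once_transversally A B &
      meridian_longitude M E A B].

(* The annulus [0, 1] x R/Z, with coordinates (x, y), oriented by dx dy: x is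
   the transverse and y the circular coordinate. *)
Definition strip : set (R * R) := [set p | 0 <= p.1 <= 1].

Definition oriented_annulus (O : set (R * R -> S)) (A : R * R -> S) : Prop :=
  [/\ {within strip, continuous A},
      forall p q, strip p -> strip q ->
        (A p = A q <-> p.1 = q.1 /\ p.2 - q.2 \is a Num.int) &
      forall psi, O psi -> forall p q, 0 < p.1 < 1 -> A p = psi q ->
        co_oriented_at A psi p q].

(* With the orientation above, an arc crossing the annulus in the direction of
   increasing x turns towards increasing y, that is, to the left. *)
Definition left_twist_along (A : R * R -> S) (f : S -> S) : Prop :=
  (forall x y, 0 <= x <= 1 -> f (A (x, y)) = A (x, y + x)) /\
  (forall z, ~ (A @` strip) z -> f z = z).

End Surfaces.

Section MappingClassGroup.
Variables (R : realType) (S : topologicalType) (O : set (R * R -> S)).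

Lemma homeomorphism_comp (f g : S -> S) :
  homeomorphism f -> homeomorphism g -> homeomorphism (f \o g).
Proof.
move=> [cf [f' [cf' ff' f'f]]] [cg [g' [cg' gg' g'g]]]; split.
  by move=> x; apply: continuous_comp; [exact: cg|exact: cf].
exists (g' \o f'); split.
- by move=> x; apply: continuous_comp; [exact: cf'|exact: cg'].
- by move=> x /=; rewrite ff' gg'.
- by move=> x /=; rewrite g'g f'f.
Qed.

Record homeo := Homeo {
  homeo_fun :> S -> S;
  homeo_inv : S -> S;
  homeo_cont : continuous homeo_fun;
  homeo_inv_cont : continuous homeo_inv;
  homeoK : cancel homeo_fun homeo_inv;
  homeo_invK : cancel homeo_inv homeo_fun;
  homeo_op : orientation_preserving O homeo_fun }.

HB.instance Definition _ := gen_eqMixin homeo.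
HB.instance Definition _ := gen_choiceMixin homeo.

Lemma homeoP (f : homeo) : homeomorphism f.
Proof.
split; first exact: homeo_cont.
exists (homeo_inv f); split;
  [exact: homeo_inv_cont|exact: homeoK|exact: homeo_invK].
Qed.

Lemma homeo_ext (f g : homeo) : (f : S -> S) =1 g -> f = g.
Proof.
case: f g => [f f' cf cf' ff' f'f of_] [g g' cg cg' gg' g'g og] /= fg.
have {fg}efg : f = g by apply/funext.
case: _ / efg in cg gg' g'g og *.
have e' : f' = g' by apply/funext => x; rewrite -[in LHS](g'g x) ff'.
case: _ / e' in cg' gg' g'g *.
by congr Homeo; exact: Prop_irrelevance.
Qed.

Fact homeo1_op : orientation_preserving O id.
Proof. by []. Qed.

Fact homeo1_cont : continuous (@id S).
Proof. by move=> x; exact: cvg_id. Qed.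

Definition homeo1 : homeo :=
  Homeo homeo1_cont homeo1_cont (fun=> erefl) (fun=> erefl) homeo1_op.

Fact homeoM_cont (f g : S -> S) :
  continuous f -> continuous g -> continuous (f \o g).
Proof.
by move=> cf cg x; apply: continuous_comp; [exact: cg|exact: cf].
Qed.

Fact homeoM_op (f g : homeo) : orientation_preserving O (f \o g).
Proof.
by move=> phi; exact: iff_trans (homeo_op f (g \o phi)) (homeo_op g phi).
Qed.

Definition homeoM (f g : homeo) : homeo :=
  Homeo (homeoM_cont (@homeo_cont f) (@homeo_cont g))
    (homeoM_cont (@homeo_inv_cont g) (@homeo_inv_cont f))
    (can_comp (@homeoK f) (@homeoK g))
    (can_comp (@homeo_invK g) (@homeo_invK f)) (homeoM_op f g).

Fact homeoV_op (f : homeo) : orientation_preserving O (homeo_inv f).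
Proof.
move=> phi; have := homeo_op f (homeo_inv f \o phi).
have -> : f \o (homeo_inv f \o phi) = phi; last exact: iff_sym.
by apply/funext => x /=; rewrite homeo_invK.
Qed.

Definition homeoV (f : homeo) : homeo :=
  Homeo (@homeo_inv_cont f) (@homeo_cont f) (@homeo_invK f) (@homeoK f)
    (homeoV_op f).

Lemma within_comp (T U V : topologicalType) (D : set T) (E : set U)
    (k : T -> U) (F : U -> V) :
  {within D, continuous k} -> (forall x, D x -> E (k x)) ->
  {within E, continuous F} -> {within D, continuous (F \o k)}.
Proof.
move=> /subspace_continuousP ck kE /subspace_continuousP cF.
apply/subspace_continuousP => x Dx.
have cFx := cF _ (kE _ Dx).
have ckx := ck _ Dx.
apply: (@cvg_comp _ _ _ k F _ (within E (nbhs (k x)))) => //.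
move=> B EB; have := ckx _ EB; rewrite /= /nbhs /= /within /= => H.
by near=> y => Dy; apply: (near H y) => //; exact: kE.
Unshelve. all: by end_near. Qed.

Lemma isotopic_refl (f : homeo) : isotopic R f f.
Proof.
exists (f \o snd); split => // [|t _]; last exact: homeoP.
apply: continuous_subspaceT => x; apply: continuous_comp; first exact: cvg_snd.
exact: homeo_cont.
Qed.

Lemma isotopic_compl (f g g' : S -> S) : homeomorphism f ->
  isotopic R g g' -> isotopic R (f \o g) (f \o g').
Proof.
move=> hf [F [cF hF F0 F1]]; exists (f \o F); split => [|t t01|x|x] /=.
- apply: (within_comp (E := setT)) cF _ _ => //.
  by apply: continuous_subspaceT; case: hf.
- exact: (homeomorphism_comp hf (hF t t01)).
- by rewrite F0.
- by rewrite F1.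
Qed.

Lemma isotopic_compr (f g g' : S -> S) : homeomorphism f ->
  isotopic R g g' -> isotopic R (g \o f) (g' \o f).
Proof.
move=> hf [F [cF hF F0 F1]].
exists (F \o (fun p : R * S => (p.1, f p.2))); split => [|t t01|x|x] //=.
- apply: within_comp cF; last by move=> [t x] [].
  apply: continuous_subspaceT => p.
  apply: (@cvg_pair _ _ _ _ (nbhs p.1) (nbhs (f p.2))); first exact: cvg_fst.
  by apply: cvg_comp; [exact: cvg_snd|case: hf => cf _; exact: cf].
- exact: (homeomorphism_comp (hF t t01) hf).
Qed.

(* the isotopies [F] from [f] to [g] and [G] from [g] to [h] are combined as
   [F_t \o g^-1 \o G_t], which avoids pasting *)
Lemma isotopic_trans (f h : S -> S) (g : homeo) :
  isotopic R f g -> isotopic R g h -> isotopic R f h.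
Proof.
move=> [F [cF hF F0 F1]] [G [cG hG G0 G1]].
exists (F \o (fun p => (p.1, homeo_inv g (G p)))); split => [|t t01|x|x] /=.
- apply: within_comp cF; last by move=> [t x] [].
  apply/subspace_continuousP => p Dp.
  apply: (@cvg_pair _ _ _ _ (nbhs p.1) (nbhs (homeo_inv g (G p)))).
    by apply: cvg_within_filter; exact: cvg_fst.
  apply: cvg_comp; last exact: homeo_inv_cont.
  by move/subspace_continuousP: cG; apply.
- apply: (homeomorphism_comp (hF t t01)).
  by apply: homeomorphism_comp (hG t t01); exact: (homeoP (homeoV g)).
- by rewrite G0 homeoK F0.
- by rewrite G1 F1 homeo_invK.
Qed.

Lemma isotopic_sym (f g : S -> S) :
  isotopic R f g -> isotopic R g f.
Proof.
move=> [F [cF hF F0 F1]].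
exists (F \o (fun p : R * S => (1 - p.1, p.2))); split => [|t /andP[t0 t1]|x|x] /=.
- apply: within_comp cF; last first.
    move=> [t x] [] /itvP t01 _; split => //=.
    by rewrite in_itv /= subr_ge0 gerBl !t01.
  apply: continuous_subspaceT => p.
  apply: (@cvg_pair _ _ _ _ (nbhs (1 - p.1)) (nbhs p.2)); last exact: cvg_snd.
  by apply: cvgB; [exact: cvg_cst|exact: cvg_fst].
- by apply: hF; rewrite subr_ge0 t1 gerBl t0.
- by rewrite subr0 F1.
- by rewrite subrr F0.
Qed.

Definition isotopicb (f g : homeo) : bool := `[< isotopic R f g >].

Fact isotopicb_refl : reflexive isotopicb.
Proof. by move=> f; apply/asboolP; exact: isotopic_refl. Qed.

Fact isotopicb_sym : symmetric isotopicb.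
Proof. by move=> f g; apply/asboolP/asboolP; exact: isotopic_sym. Qed.

Fact isotopicb_trans : transitive isotopicb.
Proof.
by move=> g f h /asboolP fg /asboolP gh; apply/asboolP; exact: isotopic_trans gh.
Qed.

Canonical isotopy_rel :=
  EquivRel isotopicb isotopicb_refl isotopicb_sym isotopicb_trans.

Definition Mod : Type := {eq_quot isotopy_rel}.

HB.instance Definition _ := Choice.on Mod.
HB.instance Definition _ := EqQuotient.on Mod.

Definition isotopy_class (f : homeo) : Mod := \pi_Mod f.

Lemma isotopy_classP (f g : homeo) :
  isotopy_class f = isotopy_class g <-> isotopic R f g.
Proof.
split; first by move=> /eqmodP /asboolP.
by move=> fg; apply/eqmodP; apply/asboolP.
Qed.

Lemma isotopy_class_repr (x : Mod) : isotopy_class (repr x) = x.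
Proof. exact: reprK. Qed.

Definition Mod_one : Mod := isotopy_class homeo1.
Definition Mod_mul (x y : Mod) : Mod := isotopy_class (homeoM (repr x) (repr y)).
Definition Mod_inv (x : Mod) : Mod := isotopy_class (homeoV (repr x)).

Lemma isotopic_repr (f : homeo) : isotopic R (repr (isotopy_class f)) f.
Proof. by apply/isotopy_classP; rewrite isotopy_class_repr. Qed.

Lemma Mod_mulE (f g : homeo) :
  Mod_mul (isotopy_class f) (isotopy_class g) = isotopy_class (homeoM f g).
Proof.
apply/isotopy_classP; set f' := repr _; set g' := repr _.
apply: (@isotopic_trans _ _ (homeoM f' g)).
  by apply: isotopic_compl; [exact: homeoP|exact: isotopic_repr].
by apply: isotopic_compr; [exact: homeoP|exact: isotopic_repr].
Qed.

Lemma Mod_invE (f : homeo) :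
  Mod_inv (isotopy_class f) = isotopy_class (homeoV f).
Proof.
apply/isotopy_classP; set f' := repr _; apply: isotopic_sym.
have := isotopic_compl (homeoP (homeoV f))
  (isotopic_compr (homeoP (homeoV f')) (isotopic_repr f)).
rewrite -/f'.
have -> : homeoV f \o (f' \o homeoV f') = homeoV f :> (S -> S).
  by apply/funext => x /=; rewrite homeo_invK.
have -> // : homeoV f \o (f \o homeoV f') = homeoV f' :> (S -> S).
by apply/funext => x /=; rewrite homeoK.
Qed.

Fact Mod_mulA : associative Mod_mul.
Proof.
move=> x y z; rewrite -[x]isotopy_class_repr -[y]isotopy_class_repr.
rewrite -[z]isotopy_class_repr !Mod_mulE.
by congr isotopy_class; exact: homeo_ext.
Qed.

Fact Mod_mul1 : left_id Mod_one Mod_mul.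
Proof.
move=> x; rewrite -[x]isotopy_class_repr Mod_mulE.
by congr isotopy_class; exact: homeo_ext.
Qed.

Fact Mod_mulr1 : right_id Mod_one Mod_mul.
Proof.
move=> x; rewrite -[x]isotopy_class_repr Mod_mulE.
by congr isotopy_class; exact: homeo_ext.
Qed.

Fact Mod_mulV : left_inverse Mod_one Mod_inv Mod_mul.
Proof.
move=> x; rewrite -[x]isotopy_class_repr Mod_invE Mod_mulE.
by congr isotopy_class; apply: homeo_ext => y /=; exact: homeoK.
Qed.

Fact Mod_mulrV : right_inverse Mod_one Mod_inv Mod_mul.
Proof.
move=> x; rewrite -[x]isotopy_class_repr Mod_invE Mod_mulE.
by congr isotopy_class; apply: homeo_ext => y /=; exact: homeo_invK.
Qed.

HB.instance Definition _ := isGroup.Build Mod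
  Mod_mulA Mod_mul1 Mod_mulr1 Mod_mulV Mod_mulrV.

(* [t] is the left Dehn twist about [C].  As a relation, this does not presuppose
   that its isotopy class is independent of the annulus. *)
Definition left_dehn_twist (C : set S) (t : Mod) : Prop :=
  exists (A : R * R -> S) (f : homeo),
    [/\ oriented_annulus O A, C = A @` [set p | p.1 = 2^-1],
        left_twist_along A f & t = isotopy_class f].

End MappingClassGroup.

Section SL2Z.

Record SL2Z := MkSL2Z {
  SL2Z_mx :> 'M[int]_2;
  SL2Z_det : \det SL2Z_mx == 1 }.

HB.instance Definition _ := [isSub for SL2Z_mx].
HB.instance Definition _ := [Choice of SL2Z by <:].

Fact SL2Z_det1 : \det (1%:M : 'M[int]_2) == 1.
Proof. by rewrite det1. Qed.

Fact SL2Z_detM (A B : SL2Z) : \det (A *m B) == 1.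
Proof. by rewrite det_mulmx (eqP (SL2Z_det A)) (eqP (SL2Z_det B)) mulr1. Qed.

Fact SL2Z_unit (A : SL2Z) : (A : 'M[int]_2) \in unitmx.
Proof. by rewrite unitmxE (eqP (SL2Z_det A)) unitr1. Qed.

Fact SL2Z_detV (A : SL2Z) : \det (invmx A) == 1.
Proof. by rewrite det_inv (eqP (SL2Z_det A)) invr1. Qed.

Definition SL2Z_one : SL2Z := MkSL2Z SL2Z_det1.
Definition SL2Z_mul (A B : SL2Z) : SL2Z := MkSL2Z (SL2Z_detM A B).
Definition SL2Z_inv (A : SL2Z) : SL2Z := MkSL2Z (SL2Z_detV A).

Fact SL2Z_mulA : associative SL2Z_mul.
Proof. by move=> A B C; apply/val_inj; exact: mulmxA. Qed.

Fact SL2Z_mul1 : left_id SL2Z_one SL2Z_mul.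
Proof. by move=> A; apply/val_inj; exact: mul1mx. Qed.

Fact SL2Z_mulr1 : right_id SL2Z_one SL2Z_mul.
Proof. by move=> A; apply/val_inj; exact: mulmx1. Qed.

Fact SL2Z_mulV : left_inverse SL2Z_one SL2Z_inv SL2Z_mul.
Proof. by move=> A; apply/val_inj; exact: (mulVmx (SL2Z_unit A)). Qed.

Fact SL2Z_mulrV : right_inverse SL2Z_one SL2Z_inv SL2Z_mul.
Proof. by move=> A; apply/val_inj; exact: (mulmxV (SL2Z_unit A)). Qed.

HB.instance Definition _ := isGroup.Build SL2Z
  SL2Z_mulA SL2Z_mul1 SL2Z_mulr1 SL2Z_mulV SL2Z_mulrV.

End SL2Z.

Section Subgroups.
Variable G : groupType.

Definition is_subgroup (K : set G) : Prop :=
  [/\ K 1%g, forall x y, K x -> K y -> K (x * y)%g &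
      forall x, K x -> K x^-1%g].

Definition generated_subgroup (X : set G) : set G := smallest is_subgroup X.

Definition subgroup_isomorphic (K : set G) (H : groupType) : Prop :=
  exists phi : {multiplicative H -> G}, injective phi /\ range phi = K.

End Subgroups.

(* Main.v *)
(* Write S as the double of a torus with a hole.  The linear action of SL2(Z) on
   the torus fixes the centre of the hole; blowing this point up to a circle
   gives an honest action on the holed torus, which acts on the boundary circle
   through directions only.  Once the parametrisations of the two handles are
   matched along the common boundary (they then have opposite orientations),
   the same formula on both halves defines an action of SL2(Z) on S by
   homeomorphisms F_M with F_MN = F_M F_N.

   Straightening its slope on both halves at once deforms the blown-up shear with
   matrix [[1,1],[0,1]] into a shear supported near the two meridians.  As the
   halves have opposite orientations, this is an inverse Dehn twist on one half
   and a Dehn twist on the other, so it represents a.  Exchanging the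
   coordinates, the transposed shear represents the inverse of b.  These two
   matrices generate SL2(Z), so sending M to the class isotopic to F_M is a
   morphism onto <a, b>.

   It is injective: crushing the second half to a point and projecting the torus
   to a circle, the winding numbers of the images of the meridian and longitude
   under an isotopy from F_M to the identity give the entries of M.

   That the isotopy class of a Dehn twist depends only on its core curve is
   proved by gluing the left half of one annulus to the right half of the other;
   orientations enter through local degrees, that is, winding numbers of the
   images of small circles. *)

(* The argument uses neither invariance of domain, nor smoothing, nor homology, so openness is
   obtained by hand: the interior of a twist annulus is open because it is the set of points moved
   by the twist, and a saturated subset of a handle is open because the rest of the surface is a
   union of two compact images. The blow-up answers a genuine obstruction. With the boundary of a
   handle held fixed, its two twists generate the braid group on three strands, not SL2(Z): the
   sixth power of their product is the twist about the boundary. On S the halves contribute inverse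
   boundary twists, which cancel. Letting the boundary circle move through directions builds this
   cancellation in, and the relations of SL2(Z) become equalities of maps instead of isotopies.
   Constants: the hole has radius 1/4 and its unit cell half-width 1/2. Blow-up and collar changes
   stay within the midway radius 3/8, and the model twists along the axes within distance 1/8 = 1/2
   - 3/8 of them, so the two never interfere. *)
From HB Require Import structures.
From mathcomp Require Import all_boot all_order all_algebra ring lra zify.
From mathcomp Require Import all_classical all_reals all_analysis.
Require Import Defs.
Import Order.TTheory GRing.Theory Num.Theory.
Import numFieldNormedType.Exports.

Set Implicit Arguments.
Unset Strict Implicit.
Unset Printing Implicit Defensive.

Local Open Scope quotient_scope.
Local Open Scope classical_set_scope.
Local Open Scope ring_scope.

(** * Limits of real expressions *)

(* Keeps the function of a limit statement syntactically visible to [tnd]. *)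
Definition tends {T : Type} {U : topologicalType} (F : set_system T)
  (f : T -> U) (l : U) : Prop := f @ F --> l.

Section Tends.
Context {R : realType} {T : Type} {F : set_system T} {FF : Filter F}.
Implicit Types (f g : T -> R).

Lemma tends_cst {U : topologicalType} (l : U) : tends F (fun=> l) l.
Proof. exact: cvg_cst. Qed.

Lemma tendsD f g a b : tends F f a -> tends F g b ->
  tends F (fun x => f x + g x) (a + b).
Proof. exact: (@cvgD R R^o). Qed.

Lemma tendsN f a : tends F f a -> tends F (fun x => - f x) (- a).
Proof. exact: (@cvgN R R^o). Qed.

Lemma tendsB f g a b : tends F f a -> tends F g b ->
  tends F (fun x => f x - g x) (a - b).
Proof. exact: (@cvgB R R^o). Qed.

Lemma tendsM f g a b : tends F f a -> tends F g b ->
  tends F (fun x => f x * g x) (a * b).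
Proof. exact: cvgM. Qed.

Lemma tendsV f a : tends F f a -> a != 0 -> tends F (fun x => (f x)^-1) a^-1.
Proof. by move=> fa a0; exact: cvgV. Qed.

Lemma tendsX f a n : tends F f a -> tends F (fun x => f x ^+ n) (a ^+ n).
Proof.
move=> fa; elim: n => [|n IH]; first exact: tends_cst.
by rewrite exprS (_ : (fun x => _) = fun x => f x * f x ^+ n);
  [exact: tendsM|apply/funext => x; rewrite exprS].
Qed.

Lemma tends_at {U V : topologicalType} (h : U -> V) (f : T -> U) (a : U) :
  tends F f a -> {for a, continuous h} -> tends F (fun x => h (f x)) (h a).
Proof. by move=> fa ha; exact: (continuous_cvg _ ha fa). Qed.

Lemma tends_pair {U V : topologicalType} (f : T -> U) (g : T -> V) a b :
  tends F f a -> tends F g b -> tends F (fun x => (f x, g x)) (a, b).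
Proof. exact: cvg_pair. Qed.

Lemma tends_fst {U V : topologicalType} (f : T -> U * V) a :
  tends F f a -> tends F (fun x => (f x).1) a.1.
Proof. by move=> fa; apply: tends_at fa _; exact: cvg_fst. Qed.

Lemma tends_snd {U V : topologicalType} (f : T -> U * V) a :
  tends F f a -> tends F (fun x => (f x).2) a.2.
Proof. by move=> fa; apply: tends_at fa _; exact: cvg_snd. Qed.

Lemma tends_fstp {U V : topologicalType} (f : T -> U * V) a b :
  tends F f (a, b) -> tends F (fun x => (f x).1) a.
Proof. exact: tends_fst. Qed.

Lemma tends_sndp {U V : topologicalType} (f : T -> U * V) a b :
  tends F f (a, b) -> tends F (fun x => (f x).2) b.
Proof. exact: tends_snd. Qed.

Lemma tendsD2 (f g : T -> R * R) a b : tends F f a -> tends F g b ->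
  tends F (fun x => f x + g x) (a + b).
Proof.
move=> fa ga; apply: (tends_pair (f := fun x => (f x).1 + (g x).1) (g := fun x =>
  (f x).2 + (g x).2)).
  by apply: tendsD; exact: tends_fst.
by apply: tendsD; exact: tends_snd.
Qed.

Lemma tendsB2 (f g : T -> R * R) a b : tends F f a -> tends F g b ->
  tends F (fun x => f x - g x) (a - b).
Proof.
move=> fa ga; apply: (tends_pair (f := fun x => (f x).1 - (g x).1) (g := fun x =>
  (f x).2 - (g x).2)).
  by apply: tendsB; exact: tends_fst.
by apply: tendsB; exact: tends_snd.
Qed.

Lemma tends_sqrt f a : tends F f a -> tends F (fun x => Num.sqrt (f x)) (Num.sqrt a).
Proof. by move=> fa; apply: tends_at fa _; exact: sqrt_continuous. Qed.

Lemma tends_cos f a : tends F f a -> tends F (fun x => cos (f x)) (cos a).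
Proof. by move=> fa; apply: tends_at fa _; exact: continuous_cos. Qed.

Lemma tends_sin f a : tends F f a -> tends F (fun x => sin (f x)) (sin a).
Proof. by move=> fa; apply: tends_at fa _; exact: continuous_sin. Qed.

Lemma tends_atan f a : tends F f a -> tends F (fun x => atan (f x)) (atan a).
Proof. by move=> fa; apply: tends_at fa _; exact: continuous_atan. Qed.

Lemma tends_norm f a : tends F f a -> tends F (fun x => `|f x|) `|a|.
Proof. exact: (@cvg_norm R R^o). Qed.

Lemma tends_min f g a b : tends F f a -> tends F g b ->
  tends F (fun x => Num.min (f x) (g x)) (Num.min a b).
Proof.
move=> fa gb; have := tends_pair fa gb => /tends_at.
by move=> /(_ _ _ (@min_continuous _ R (a, b))).
Qed.

Lemma tends_max f g a b : tends F f a -> tends F g b ->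
  tends F (fun x => Num.max (f x) (g x)) (Num.max a b).
Proof.
move=> fa gb; have := tends_pair fa gb => /tends_at.
by move=> /(_ _ _ (@max_continuous _ R (a, b))).
Qed.

Lemma tends_lt f a c : tends F f a -> a < c -> \forall x \near F, f x < c.
Proof. by move=> fa; exact: cvgr_lt. Qed.

Lemma tends_gt f a c : tends F f a -> c < a -> \forall x \near F, c < f x.
Proof. by move=> fa; exact: cvgr_gt. Qed.

Lemma tends_near_eq {U : topologicalType} (f g : T -> U) (l : U) :
  (\forall x \near F, g x = f x) -> tends F g l -> tends F f l.
Proof.
by move=> fg; apply: cvg_trans; apply: near_eq_cvg; apply: filterS fg => x ->.
Qed.
End Tends.

Lemma tends_nbhs {T U : topologicalType} (f : T -> U) x :
  {for x, continuous f} -> tends (nbhs x) f (f x).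
Proof. by []. Qed.

Lemma tends_idn {T : topologicalType} (x : T) : tends (nbhs x) (fun y => y) x.
Proof. exact: cvg_id. Qed.

Lemma tends_idw {T : topologicalType} (x : T) D : tends (within D (nbhs x)) (fun y => y) x.
Proof. exact: cvg_within. Qed.

Lemma tends_cts {T U : topologicalType} (f : T -> U) (x : T) :
  tends (nbhs x) f (f x) -> {for x, continuous f}.
Proof. by []. Qed.

(** Differences are matched before sums because [x - y] is a sum with an opposite, and opposites of
    pairs have no rule of their own. The last patterns catch eta-contracted functions. *)
Ltac tnd1 := lazymatch goal with
  | |- tends _ (fun x => x) _ => first [exact: tends_idn | exact: tends_idw | eassumption]
  | |- tends _ (fun x => @?f x - @?g x) _ => first [apply: tendsB | apply: tendsB2]
  | |- tends _ (fun x => @?f x + @?g x) _ => first [apply: tendsD | apply: tendsD2]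
  | |- tends _ (fun x => - @?f x) _ => apply: tendsN
  | |- tends _ (fun x => @?f x * @?g x) _ => apply: tendsM
  | |- tends _ (fun x => (@?f x) ^-1) _ => apply: tendsV
  | |- tends _ (fun x => (@?f x) ^+ ?n) _ => apply: tendsX
  | |- tends _ (fun x => (@?f x, @?g x)) _ => apply: tends_pair
  | |- tends _ (fun x => (@?f x).1) _ => first [apply: tends_fst | apply: tends_fstp]
  | |- tends _ (fun x => (@?f x).2) _ => first [apply: tends_snd | apply: tends_sndp]
  | |- tends _ (fun x => Num.sqrt (@?f x)) _ => apply: tends_sqrt
  | |- tends _ (fun x => cos (@?f x)) _ => apply: tends_cos
  | |- tends _ (fun x => sin (@?f x)) _ => apply: tends_sin
  | |- tends _ (fun x => atan (@?f x)) _ => apply: tends_atan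
  | |- tends _ (fun x => `|@?f x|) _ => apply: tends_norm
  | |- tends _ (fun x => Num.min (@?f x) (@?g x)) _ => apply: tends_min
  | |- tends _ (fun x => Num.max (@?f x) (@?g x)) _ => apply: tends_max
  | |- tends _ (fun x => ?h (@?f x)) _ =>
      first [exact: tends_cst | eassumption | apply: (tends_at (h := h))]
  | |- tends _ (GRing.mul _) _ => apply: tendsM
  | |- tends _ (GRing.add _) _ => first [apply: tendsD | apply: tendsD2]
  | |- tends _ GRing.opp _ => apply: tendsN
  | |- tends _ fst _ => first [apply: tends_fst | apply: tends_fstp]
  | |- tends _ snd _ => first [apply: tends_snd | apply: tends_sndp]
  | |- tends _ cos _ => apply: tends_cos
  | |- tends _ sin _ => apply: tends_sin
  | |- tends _ _ _ => first [exact: tends_cst | eassumption]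
  end.
Ltac tnd := repeat tnd1.
Ltac cts x := move=> x; apply: tends_cts; cbv beta; tnd.

Arguments tends_idn {T} x.
Arguments tends_idw {T} x D.

(** The tube lemma: a condition that holds near each point of the compact set [D] holds on [D] for
    all nearby parameters at once. *)
Lemma near_compact (X I : topologicalType) (t : I) (D : set X) (P : I -> X -> Prop) :
  compact D -> (forall x, D x -> \forall z \near (x, t), D z.1 -> P z.2 z.1) ->
  \forall i \near t, forall x, D x -> P i x.
Proof.
move=> /compact_near_coveringP /(_ I (nbhs t) (fun i x => D x -> P i x) _) cD H.
have : \forall i \near t, D `<=` (fun x => D x -> P i x).
  by apply: cD => x Dx; apply: filterS (H x Dx) => -[].
by apply: filterS => i Di x Dx; exact: Di.
Qed.

Section RealLemmas.
Variable R : realType.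
Implicit Types (s t x y : R) (n m : int).

(** Connectedness of the segment as a continuity method. It is applied to having a given winding
    number and to having a given sign, both of which are stable under small changes. *)
Lemma segment_locally_constant (P : R -> Prop) :
  (forall t, 0 <= t <= 1 ->
    \forall u \near t, 0 <= u <= 1 -> (P t <-> P u)) -> P 0 -> P 1.
Proof.
move=> loc P0.
pose A := `[0 : R, 1]%classic.
have A1 : A 1 by rewrite /A /= in_itv /= ler01 lexx.
(* The interior of [Q] relative to the segment. It agrees with [Q] there both for [P] and for its
   negation, which makes [P] clopen. *)
pose C (Q : R -> Prop) : set R := [set t : R | \forall u \near t, 0 <= u <= 1 -> Q u].
have oC Q : open (C Q).
  by rewrite openE => t /= /near_join.
have AE t : A t = (0 <= t <= 1) by rewrite /A /= in_itv.
have e1 : A `&` P = A `&` C P.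
  apply/seteqP; split=> t [] At; rewrite /C /=.
    move=> Pt; split => //; apply: filterS (loc t _) => [u + /[dup] /[swap]|]; last by rewrite -AE.
    by move=> + u01 => /(_ u01) <-.
  by move=> /nbhs_singleton Pt; split => //; apply: Pt; rewrite -AE.
have e2 : A `&` P = A `&` ~` C (fun t => ~ P t).
  apply/seteqP; split=> t [] At; rewrite /C /=.
    by move=> Pt; split => // /nbhs_singleton; apply; rewrite -?AE.
  move=> nC; split => //; apply: contrapT => nP; apply: nC.
  apply: filterS (loc t _) => [u + u01 Pu|]; last by rewrite -AE.
  by move=> /(_ u01) [_] /(_ Pu).
have: A `&` P = A.
  apply: (@segment_connected R 0 1).
  - by exists 0; split => //; rewrite /A /= in_itv /= ler01 lexx.
  - by exists (C P).
  - by exists (~` C (fun t => ~ P t)) => //; exact: open_closedC.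
by move/seteqP => [_] /(_ 1 A1) [].
Qed.

Lemma int_valued_constant (f : R -> R) : continuous f ->
  (forall s, exists n, f s = n%:~R) -> forall s t, f s = f t.
Proof.
move=> cf fZ; suff H s t : s <= t -> f s = f t.
  by move=> s t; case: (leP s t) => [/H //|/ltW /H].
move=> st; apply: contrapT => fst.
have [n fn] := fZ s; have [m fm] := fZ t.
(* A half-integer strictly between two distinct integer values; continuity would force [f] to take
   it. *)
pose v := (Num.min (f s) (f t)) + 2^-1.
have [||c _ fc] := @IVT R f s t v st.
- exact: continuous_subspaceT.
- rewrite /v lerDl invr_ge0 ler0n /=.
  have: n != m by apply/eqP => nm; apply: fst; rewrite fn fm nm.
  rewrite fn fm => nm; case: (leP n m) => nm'.
    rewrite (min_l _) ?ler_int// (max_r _) ?ler_int//.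
    have : (n + 1)%:~R <= m%:~R :> R by rewrite ler_int lezD1 lt_neqAle nm.
    by rewrite intrD; lra.
  rewrite (min_r _) ?ler_int ?(ltW nm')// (max_l _) ?ler_int ?(ltW nm')//.
  have : (m + 1)%:~R <= n%:~R :> R by rewrite ler_int lezD1.
  by rewrite intrD; lra.
have [k fk] := fZ c.
have : exists l : int, 2^-1 = l%:~R :> R.
  rewrite /v fk fn fm in fc.
  by case: (leP n m) fc => nm; [rewrite min_l ?ler_int//|rewrite min_r ?ler_int ?ltW//] => h;
   [exists (k - n)|exists (k - m)]; rewrite intrB h; lra.
move=> [l hl].
have : (0 : R) < l%:~R by rewrite -hl; lra.
have : l%:~R < (1 : R) by rewrite -hl; lra.
by rewrite ltr0z ltrz1; case: l {hl} => [[|l]|].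
Qed.

Lemma pi2_gt0 : 0 < 2 * pi :> R.
Proof. by rewrite mulr_gt0// pi_gt0. Qed.

Lemma cosD2pi_nat s (n : nat) : cos (s + n%:R * (2 * pi)) = cos s.
Proof.
have -> : n%:R * (2 * pi) = (pi *+ 2) *+ n :> R by rewrite -[in RHS]mulr_natl -[pi *+ 2]mulr_natl.
exact: (periodicn (@cosD2pi R)).
Qed.

Lemma sinD2pi_nat s (n : nat) : sin (s + n%:R * (2 * pi)) = sin s.
Proof.
have -> : n%:R * (2 * pi) = (pi *+ 2) *+ n :> R by rewrite -[in RHS]mulr_natl -[pi *+ 2]mulr_natl.
exact: (periodicn (@sinD2pi R)).
Qed.

Lemma cosD2pi_int s n : cos (s + n%:~R * (2 * pi)) = cos s.
Proof.
case: n => n; first exact: cosD2pi_nat.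
rewrite NegzE mulrNz; rewrite -[RHS](cosD2pi_nat _ n.+1).
rewrite -[in RHS](subrK (n.+1%:R * (2 * pi)) s) -[LHS](cosD2pi_nat _ n.+1).
by rewrite -[LHS](cosD2pi_nat _ n.+1) mulNr.
Qed.

Lemma sinD2pi_int s n : sin (s + n%:~R * (2 * pi)) = sin s.
Proof.
case: n => n; first exact: sinD2pi_nat.
rewrite NegzE mulrNz; rewrite -[RHS](sinD2pi_nat _ n.+1).
rewrite -[in RHS](subrK (n.+1%:R * (2 * pi)) s) -[LHS](sinD2pi_nat _ n.+1).
by rewrite -[LHS](sinD2pi_nat _ n.+1) mulNr.
Qed.

Lemma period_reduce c s : 0 < c -> exists t n, [/\ 0 <= t, t <= c & s = t + n%:~R * c].
Proof.
move=> c0; have /andP[h1 h2] := floor_itv (s / c).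
exists (s - (Num.floor (s / c))%:~R * c), (Num.floor (s / c)).
move: h1 h2; rewrite intrD ler_pdivlMr// ltr_pdivrMr// mulrDl mul1r => h1 h2.
by split; lra.
Qed.

Lemma cos_eq1 s : cos s = 1 -> exists n, s = n%:~R * (2 * pi).
Proof.
move=> cs; have [t [n [t0 t2 st]]] := period_reduce s pi2_gt0.
move: cs; rewrite st cosD2pi_int => ct.
(* By the half-angle formula; inside the period the half angle has positive sine, so only the two
   ends remain. *)
have st0 : sin (t / 2) = 0.
  have : cos t = 1 - 2 * sin (t / 2) ^+ 2.
    rewrite {1}(_ : t = t / 2 + t / 2); last by lra.
    by rewrite cosD; have := cos2Dsin2 (t / 2); nra.
  rewrite ct => /eqP; rewrite -subr_eq0 => /eqP h.
  by apply/eqP; rewrite -sqrf_eq0; apply/eqP; lra.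
have [t0'|t0'|<-] := ltgtP 0 t; last by exists n; rewrite add0r.
  have [t2'|t2'|->] := ltgtP t (2 * pi); last by exists (n + 1); rewrite intrD; ring.
    have : 0 < sin (t / 2) by apply: sin_gt0_pi; apply/andP; split; lra.
    by rewrite st0 ltxx.
  by move: t2; rewrite leNgt t2'.
by move: t0; rewrite leNgt t0'.
Qed.

Lemma cos_sin_eq s t : cos s = cos t -> sin s = sin t ->
  exists n, s = t + n%:~R * (2 * pi).
Proof.
move=> c e; have [|n h] := @cos_eq1 (s - t).
  by rewrite cosB c e -!expr2 cos2Dsin2.
by exists n; rewrite -h; lra.
Qed.

(** The continuous branch of the argument on the right half-plane. It serves to correct an angle
    that is already approximately known. *)
Lemma cos_sin_atan (d c : R) : 0 < d ->
  Num.sqrt (d ^+ 2 + c ^+ 2) * cos (atan (c / d)) = d /\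
  Num.sqrt (d ^+ 2 + c ^+ 2) * sin (atan (c / d)) = c.
Proof.
move=> d0.
have h0 : 0 < d ^+ 2 + c ^+ 2 by rewrite ltr_wpDr ?sqr_ge0// exprn_gt0.
have e : Num.sqrt (d ^+ 2 + c ^+ 2) = d * Num.sqrt (1 + (c / d) ^+ 2).
  rewrite -{2}(ger0_norm (ltW d0)) -sqrtr_sqr -sqrtrM ?sqr_ge0//.
  by congr Num.sqrt; rewrite mulrDr mulr1 -exprMn mulrC divfK// gt_eqF.
have s0 : Num.sqrt (1 + (c / d) ^+ 2) != 0.
  by rewrite gt_eqF// sqrtr_gt0 ltr_wpDr ?sqr_ge0.
have cE : Num.sqrt (d ^+ 2 + c ^+ 2) * cos (atan (c / d)) = d.
  by rewrite e cos_atan mulfK.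
split => //.
have c0 : cos (atan (c / d)) != 0 by rewrite cos_atan invr_neq0.
have -> : sin (atan (c / d)) = tan (atan (c / d)) * cos (atan (c / d)).
  by rewrite /tan divfK.
by rewrite atanK mulrCA cE divfK// gt_eqF.
Qed.

Lemma polar (v : R * R) : v != 0 ->
  exists th, v = (Num.sqrt (v.1 ^+ 2 + v.2 ^+ 2) * cos th,
                  Num.sqrt (v.1 ^+ 2 + v.2 ^+ 2) * sin th).
Proof.
case: v => a b v0 /=; set r := Num.sqrt _.
have r0 : 0 < a ^+ 2 + b ^+ 2.
  rewrite lt_neqAle addr_ge0 ?sqr_ge0// andbT eq_sym paddr_eq0 ?sqr_ge0// !sqrf_eq0.
  by apply: contra v0 => /andP[/eqP -> /eqP ->].
have r0' : 0 < r by rewrite sqrtr_gt0.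
have rr : r ^+ 2 = a ^+ 2 + b ^+ 2 by rewrite sqr_sqrtr ?ltW.
have a1 : -1 <= a / r <= 1.
  rewrite ler_pdivlMr// ler_pdivrMr// mul1r mulN1r -ler_norml.
  by rewrite -sqrtr_sqr ler_wsqrtr// lerDl sqr_ge0.
clearbody r.
have ca : r * cos (acos (a / r)) = a by rewrite acosK// mulrC divfK// gt_eqF.
have sa : r * sin (acos (a / r)) = `|b|.
  rewrite sin_acos// -sqrtr_sqr -[LHS]ger0_norm ?mulr_ge0 ?sqrtr_ge0 ?ltW//.
  have e : r ^+ 2 * (1 - (a / r) ^+ 2) = r ^+ 2 - a ^+ 2 by field; rewrite gt_eqF.
  have e' : 0 <= 1 - (a / r) ^+ 2.
    by rewrite -(pmulr_rge0 _ (exprn_gt0 2 r0')) e rr addrC addKr sqr_ge0.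
  rewrite -sqrtr_sqr exprMn sqr_sqrtr// e rr; congr Num.sqrt; ring.
case: (leP 0 b) => b0.
  by exists (acos (a / r)); rewrite ca sa ger0_norm.
by exists (- acos (a / r)); rewrite cosN sinN mulrN ca sa ltr0_norm// opprK.
Qed.

(** The periodic extension of [chi] from the unit segment. At an integer two shifted copies of [chi]
    compete, and [chi 0 = chi 1] makes them agree there. *)
Lemma frac_continuous {T : topologicalType} (chi : R -> T) : continuous chi -> chi 0 = chi 1 ->
  continuous (fun y => chi (y - (Num.floor y)%:~R)).
Proof.
move=> cchi e01 y.
have /andP[h1 h2] := floor_itv y; set j := Num.floor y in h1 h2 *.
rewrite intrD in h2.
have cj (i : int) : tends (nbhs y) (fun z => chi (z - i%:~R)) (chi (y - i%:~R)).
  by tnd; exact: cchi.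
case: (eqVneq y j%:~R) => [yj|yj]; last first.
  apply: (tends_near_eq _ (cj j)).
  have h1' : j%:~R < y by rewrite lt_neqAle eq_sym yj.
  have l := tends_lt (tends_idn y) h2.
  have r := tends_gt (tends_idn y) h1'.
  near=> z.
  have zl : z < j%:~R + 1 by near: z; exact: l.
  have zr : j%:~R < z by near: z; exact: r.
  suff -> : Num.floor z = j by [].
  by apply: floor_def; rewrite intrD zl ltW.
move=> U nU; have near0 := cj j U nU.
have near1 : \forall z \near y, U (chi (z - (j - 1)%:~R)).
  apply: cj; move: nU; rewrite -/j yj subrr intrB opprB [_ + (_ - _)]addrC subrK.
  by rewrite e01.
have l : \forall z \near y, z < j%:~R + 1 by exact: (tends_lt (tends_idn y)).
have r : \forall z \near y, j%:~R - 1 < z by apply: (tends_gt (tends_idn y)); rewrite yj; lra.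
suff : \forall z \near y, U (chi (z - (Num.floor z)%:~R)) by [].
near=> z.
have z0 : U (chi (z - j%:~R)) by near: z; exact: near0.
have z1 : U (chi (z - (j - 1)%:~R)) by near: z; exact: near1.
have lz : z < j%:~R + 1 by near: z.
have rz : j%:~R - 1 < z by near: z.
case: (leP j%:~R z) => jz.
  rewrite (_ : Num.floor z = j)//; apply: floor_def; rewrite intrD.
  by apply/andP; split.
rewrite (_ : Num.floor z = j - 1); first by [].
by apply: floor_def; rewrite subrK intrB; apply/andP; split => //; exact: ltW.
Unshelve. all: by end_near. Qed.
End RealLemmas.

(** * Winding numbers *)

Section Winding.
Variable R : realType.
Implicit Types (p q : R * R) (s t : R) (n m : int) (g : R -> R * R).

Lemma circle_pt_period p r s n : circle_pt p r (s + n%:~R * (2 * pi)) = circle_pt p r s.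
Proof. by rewrite /circle_pt cosD2pi_int sinD2pi_int. Qed.

Lemma circle_pt_period1 p r s : circle_pt p r (s + 2 * pi) = circle_pt p r s.
Proof. by rewrite -[2 * pi]mul1r (circle_pt_period p r s 1). Qed.

Lemma circle_pt_eq0 p (r s : R) : circle_pt p r s = p -> r = 0.
Proof.
case: p => a b [] /=.
move=> /eqP; rewrite -subr_eq0 [a + _]addrC addrK => /eqP h1.
move=> /eqP; rewrite -subr_eq0 [b + _]addrC addrK => /eqP h2.
apply/eqP; rewrite -sqrf_eq0; apply/eqP.
by rewrite -[LHS]mulr1 -(cos2Dsin2 s) mulrDr -!exprMn h1 h2 expr0n addr0.
Qed.

(** Winding number through global polar coordinates of the loop. Their existence already contains
    the continuity of [g], its period and the fact that it misses [q]. *)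
Definition winds q g n := exists rho theta : R -> R,
  [/\ continuous rho /\ continuous theta,
      forall s, 0 < rho s,
      forall s, rho (s + 2 * pi) = rho s /\
        theta (s + 2 * pi) = theta s + n%:~R * (2 * pi) &
      forall s, g s = circle_pt q (rho s) (theta s)].

Lemma periodic_int (T : Type) (f : R -> T) (c : R) : (forall s, f (s + c) = f s) ->
  forall s n, f (s + n%:~R * c) = f s.
Proof.
move=> fc; have N (k : nat) s : f (s + k%:R * c) = f s.
  elim: k s => [|k IH] s; first by rewrite mul0r addr0.
  by rewrite -natr1 mulrDl mul1r addrA fc IH.
move=> s [k|k]; first exact: N.
by rewrite NegzE mulrNz mulNr -[LHS](N k.+1) subrK.
Qed.

Lemma circle_pt_inj q r1 r2 t1 t2 : 0 < r1 -> 0 < r2 ->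
  circle_pt q r1 t1 = circle_pt q r2 t2 ->
  r1 = r2 /\ exists k : int, t1 = t2 + k%:~R * (2 * pi).
Proof.
move=> r10 r20 [/addrI ec /addrI es].
have er : r1 = r2.
  apply/eqP; rewrite -(@eqrXn2 _ 2)// ?ltW//; apply/eqP.
  rewrite -[LHS]mulr1 -(cos2Dsin2 t1) mulrDr -!exprMn ec es !exprMn -mulrDr.
  by rewrite cos2Dsin2 mulr1.
split => //; move: ec es; rewrite er => /mulfI ec /mulfI es.
have r2n : r2 != 0 by rewrite gt_eqF.
exact: (cos_sin_eq (ec r2n) (es r2n)).
Qed.

(** Two angle functions of one loop differ by an integer number of turns, which is constant by
    continuity, so both grow equally over a period. *)
Lemma winds_uniq q g n m : winds q g n -> winds q g m -> n = m.
Proof.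
move=> [r1 [t1 [[_ ct1] r10 p1 g1]]] [r2 [t2 [[_ ct2] r20 p2 g2]]].
have H s : exists k : int, (t1 s - t2 s) / (2 * pi) = k%:~R.
  have : circle_pt q (r1 s) (t1 s) = circle_pt q (r2 s) (t2 s) by rewrite -g1 -g2.
  move=> /circle_pt_inj [||_ [k ->]] //.
  by exists k; rewrite addrAC subrr add0r mulfK// gt_eqF// pi2_gt0.
have cd : continuous (fun s => (t1 s - t2 s) / (2 * pi)).
  by cts s; by [exact: ct1|exact: ct2|rewrite gt_eqF// pi2_gt0].
have := int_valued_constant cd H 0 (0 + 2 * pi).
rewrite (p1 0).2 (p2 0).2 => /(congr1 (fun x => x * (2 * pi)));
  rewrite !divfK ?gt_eqF ?pi2_gt0// => h.
have : n%:~R * (2 * pi) = m%:~R * (2 * pi) :> R.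
  set x := n%:~R * (2 * pi) in h *; set y := m%:~R * (2 * pi) in h *; lra.
by move/mulIf; rewrite gt_eqF ?pi2_gt0// => /(_ isT) /intr_inj.
Qed.

Lemma winds_shift q q' g n : winds q g n ->
  winds q' (fun s => g s - q + q') n.
Proof.
move=> [rho [th [c r0 thE gE]]]; exists rho, th; split => // s.
by rewrite gE /circle_pt; congr pair => /=; ring.
Qed.

Lemma winds_eq q g g' n : winds q g n -> g =1 g' -> winds q g' n.
Proof. by move=> w /funext <-. Qed.

(** The dog-on-a-leash principle: if the two radius vectors always form an acute angle, that angle
    is an arctangent, hence continuous and periodic, and adding it to the old angle changes no
    winding. *)
Lemma winds_pert q0 g0 q1 g1 n : winds q0 g0 n -> continuous g1 ->
  (forall s, g1 (s + 2 * pi) = g1 s) ->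
  (forall s, 0 < (g1 s - q1).1 * (g0 s - q0).1 + (g1 s - q1).2 * (g0 s - q0).2) ->
  winds q1 g1 n.
Proof.
move=> [rho [th [[cr ct] r0 thE gE]]] cg1 g1p dot.
(* [d] and [c] are the coordinates of the new radius vector in the frame whose first axis has the
   old direction [th s]; the hypothesis says that [d] is positive. *)
pose d s := (g1 s - q1).1 * cos (th s) + (g1 s - q1).2 * sin (th s).
pose c s := (g1 s - q1).2 * cos (th s) - (g1 s - q1).1 * sin (th s).
have d0 s : 0 < d s.
  have := dot s; rewrite gE /circle_pt /=.
  rewrite [_ + _ - q0.1]addrAC subrr add0r [_ + _ - q0.2]addrAC subrr add0r.
  by rewrite mulrCA [X in _ + X]mulrCA -mulrDr pmulr_rgt0.
have cd : continuous d by rewrite /d; cts s; by [exact: cg1|exact: ct].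
have cc : continuous c by rewrite /c; cts s; by [exact: cg1|exact: ct].
exists (fun s => Num.sqrt (d s ^+ 2 + c s ^+ 2)), (fun s => th s + atan (c s / d s)).
split.
- split; cts s; by [exact: cd|exact: cc|exact: ct|rewrite gt_eqF].
- by move=> s; rewrite sqrtr_gt0 ltr_wpDr ?sqr_ge0// exprn_gt0.
- have dp s : d (s + 2 * pi) = d s by rewrite /d (thE s).2 cosD2pi_int sinD2pi_int g1p.
  have cp s : c (s + 2 * pi) = c s by rewrite /c (thE s).2 cosD2pi_int sinD2pi_int g1p.
  by move=> s; rewrite dp cp (thE s).2 addrAC.
- move=> s; rewrite /circle_pt cosD sinD.
  have [eC eS] := cos_sin_atan (c s) (d0 s).
  have cs := cos2Dsin2 (th s).
  rewrite [g1 s]surjective_pairing; congr pair; set h := Num.sqrt _ in eC eS *.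
    have -> : q1.1 + h * (cos (th s) * cos (atan (c s / d s)) - sin (th s) * sin (atan (c s / d s)))
      = q1.1 + cos (th s) * (h * cos (atan (c s / d s))) - sin (th s) * (h * sin (atan (c s / d
        s))) by ring.
    rewrite eC eS /d /c.
    have -> : forall a b x y z : R,
      z + a * (x * a + y * b) - b * (y * a - x * b) = z + x * (a ^+ 2 + b ^+ 2).
      by move=> *; ring.
    by rewrite cs /=; ring.
  have -> : q1.2 + h * (sin (th s) * cos (atan (c s / d s)) + cos (th s) * sin (atan (c s / d s)))
    = q1.2 + sin (th s) * (h * cos (atan (c s / d s))) + cos (th s) * (h * sin (atan (c s / d
      s))) by ring.
  rewrite eC eS /d /c.
  have -> : forall a b x y z : R,
    z + b * (x * a + y * b) + a * (y * a - x * b) = z + y * (a ^+ 2 + b ^+ 2).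
    by move=> *; ring.
  by rewrite cs /=; ring.
Qed.

Definition clamp (t : R) : R := Num.min (Num.max t 0) 1.

Lemma clamp_continuous : continuous clamp.
Proof. by rewrite /clamp; cts t. Qed.

Lemma clamp01 t : 0 <= clamp t <= 1.
Proof.
rewrite /clamp; case: (leP t 0) => h.
  by rewrite min_l ?lexx ?ler01.
by rewrite ge_min lexx orbT le_min ler01 andbT ltW.
Qed.

Lemma clampid t : 0 <= t <= 1 -> clamp t = t.
Proof. by move=> /andP[h1 h2]; rewrite /clamp max_l// min_l. Qed.

(** For close times the radius vectors are nearly equal, uniformly over a period by compactness, so
    [winds_pert] makes the winding number locally constant in time. *)
Lemma winds_homotopy q (G : R -> R -> R * R) n :
  {within [set p : R * R | 0 <= p.1 <= 1], continuous (fun p => G p.1 p.2)} ->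
  (forall t s, 0 <= t <= 1 -> G t (s + 2 * pi) = G t s) ->
  (forall t s, 0 <= t <= 1 -> G t s != q) ->
  winds q (G 0) n -> winds q (G 1) n.
Proof.
move=> cG Gp Gq.
(* Clamping the time extends the homotopy to the whole plane, which turns continuity within the
   strip into plain continuity. *)
pose K t s := G (clamp t) s.
have cK : continuous (fun p : R * R => K p.1 p.2).
  apply/continuous_subspace_setT.
  apply: (@within_comp _ _ _ setT _ (fun p : R * R => (clamp p.1, p.2)) _ _ _ cG).
    apply: continuous_subspaceT; cts p; exact: clamp_continuous.
  by move=> p _ /=; exact: clamp01.
have K0 : K 0 = G 0 by rewrite /K clampid// lexx ler01.
have K1 : K 1 = G 1 by rewrite /K clampid// lexx ler01.
rewrite -K0 -K1.
have Kp t s : K t (s + 2 * pi) = K t s by rewrite /K Gp// clamp01.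
have cKt t : continuous (K t).
  move=> s; apply: tends_cts; apply: (tends_at (h := fun p : R * R => K p.1 p.2) (f := fun s =>
    (t, s)) (a := (t, s))).
    by tnd.
  exact: cK.
apply: (@segment_locally_constant _ (fun t => winds q (K t) n)) => t t01.
have : \forall u \near t, forall s, `[0, 2 * pi]%classic s ->
    0 < (K u s - q).1 * (K t s - q).1 + (K u s - q).2 * (K t s - q).2.
  apply: near_compact; first exact: segment_compact.
  move=> s _.
  have H : tends (nbhs (s, t)) (fun z : R * R =>
    (K z.2 z.1 - q).1 * (K t z.1 - q).1 + (K z.2 z.1 - q).2 * (K t z.1 - q).2)
    ((K t s - q).1 * (K t s - q).1 + (K t s - q).2 * (K t s - q).2).
    have c1 : tends (nbhs (s, t)) (fun z : R * R => K z.2 z.1) (K t s).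
      apply: (tends_at (h := fun p : R * R => K p.1 p.2) (f := fun z => (z.2, z.1)) (a := (t, s))).
        by tnd.
      exact: cK.
    have c2 : tends (nbhs (s, t)) (fun z : R * R => K t z.1) (K t s).
      apply: (tends_at (h := K t) (f := fun z => z.1) (a := s)); last exact: cKt.
      by tnd.
    by tnd.
  apply: (filterS (P := [set z : R * R | 0 < (K z.2 z.1 - q).1 * (K t z.1 - q).1 + (K z.2 z.1 -
    q).2 * (K t z.1 - q).2])) => //.
  apply: (tends_gt H).
  rewrite -!expr2 lt_neqAle addr_ge0 ?sqr_ge0// andbT eq_sym paddr_eq0 ?sqr_ge0// !sqrf_eq0.
  apply/negP => /andP[/eqP h1 /eqP h2].
  have := Gq _ s (clamp01 t); rewrite -/(K t s) -subr_eq0 => /eqP; apply.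
  by rewrite [LHS]surjective_pairing h1 h2.
apply: filterS => u dot _.
have dotT s : 0 < (K u s - q).1 * (K t s - q).1 + (K u s - q).2 * (K t s - q).2.
  have [s' [k [s0 s1 ->]]] := period_reduce s (pi2_gt0 R).
  rewrite !(periodic_int (Kp _)); apply: dot.
  by rewrite /= in_itv /= s0.
split => w; apply: (winds_pert w) => // s.
by rewrite mulrC [X in _ + X]mulrC.
Qed.

Lemma winds_cst q p : p != q -> winds q (fun=> p) 0.
Proof.
move=> pq; have : p - q != 0 by rewrite subr_eq0.
move=> /[dup] pq0 /polar; set r := Num.sqrt _ => -[th pE].
exists (fun=> r), (fun=> th); split => [||s|s].
- by split => s; exact: cvg_cst.
- move=> _; rewrite sqrtr_gt0 lt_neqAle addr_ge0 ?sqr_ge0// andbT eq_sym paddr_eq0 ?sqr_ge0//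
  !sqrf_eq0.
  apply/negP => /andP[/eqP h1 /eqP h2]; move/eqP: pq0; apply.
  by rewrite [LHS]surjective_pairing h1 h2.
- by split=> //; rewrite mul0r addr0.
- by rewrite -[p](subrK q) pE /circle_pt /= addrC.
Qed.
End Winding.

Section Winding2.
Variable R : realType.
Implicit Types (p q : R * R) (s t : R) (n m d e : int) (g : R -> R * R).

Lemma floorD1 s : Num.floor (s + 1) = Num.floor s + 1.
Proof. by rewrite floorDrz ?floor1// rpred1. Qed.

Lemma frac_itv s : 0 <= s - (Num.floor s)%:~R < 1.
Proof. by have := floor_itv s; rewrite intrD => /andP[h1 h2]; apply/andP; split; lra. Qed.

(** No path lifting is needed: the loop run forth and then back contracts to a constant, so it has
    polar coordinates by [winds_homotopy]. Their restriction to the way forth lifts [g] over one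
    period. *)
Lemma winds_exists q g : continuous g -> (forall s, g (s + 2 * pi) = g s) ->
  (forall s, g s != q) -> exists n, winds q g n.
Proof.
move=> cg gp gq.
pose chi s : R := Num.min (2 * s) (2 - 2 * s).
have cchi : continuous chi by rewrite /chi; cts s.
have p2 := pi2_gt0 R; have p2n : 2 * pi != 0 :> R by rewrite gt_eqF.
pose fr s := s / (2 * pi) - (Num.floor (s / (2 * pi)))%:~R.
have frp s : fr (s + 2 * pi) = fr s.
  by rewrite /fr mulrDl divff// floorD1 intrD; ring.
have frI s : 0 <= fr s < 1 by exact: frac_itv.
have frc (T : topologicalType) (f : R -> T) : continuous f -> f 0 = f 1 -> continuous (fun s =>
  f (fr s)).
  move=> cf f01 s; apply: tends_cts.
  have H : tends (nbhs s) (fun s => s / (2 * pi)) (s / (2 * pi)) by tnd.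
  exact: (tends_at H (@frac_continuous _ _ f cf f01 _)).
(* A tent function of period 2 pi that rises from 0 to 1 on the first half of the period, then
   returns. *)
have [tri [ctri trip triE]] : exists tri : R -> R, [/\ continuous tri,
    forall s, tri (s + 2 * pi) = tri s & forall u, 0 <= u <= 1 -> tri (pi * u) = u].
  exists (fun s => chi (fr s)); split => [|s|u /andP[u0 u1]].
  - by apply: frc => //; rewrite /chi !mulr0 subr0 mulr1 subrr min_l ?min_r.
  - by rewrite frp.
  - have pu : pi * u / (2 * pi) = u / 2 :> R.
      by rewrite [2 * pi]mulrC -mulf_div divff ?mul1r// gt_eqF// pi_gt0.
    rewrite /fr pu (_ : Num.floor (u / 2) = 0); last first.
      by apply: floor_def; apply/andP; split; lra.
    by rewrite subr0 /chi mulrC divfK// min_l; lra.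
pose G t s := g (2 * pi * (t * tri s)).
have : winds q (G 1) 0.
  apply: (@winds_homotopy _ q G).
  - by apply: continuous_subspaceT; rewrite /G; cts p; [exact: ctri|exact: cg].
  - by move=> t s _; rewrite /G trip.
  - by move=> t s _; exact: gq.
  - by apply: (winds_eq (winds_cst (gq 0))) => s; rewrite /G mul0r mulr0.
move=> [rho [th [[cr ct] r0 _ gE]]].
have gu u : 0 <= u <= 1 -> g (2 * pi * u) = circle_pt q (rho (pi * u)) (th (pi * u)).
  by move=> u01; rewrite -gE /G mul1r triE.
have [rE [n thE]] : rho (pi * 1) = rho (pi * 0) /\ exists n,
  th (pi * 1) = th (pi * 0) + n%:~R * (2 * pi).
  apply: (@circle_pt_inj _ q) => //.
  by rewrite -!gu ?lexx ?ler01// mulr0 mulr1 -[RHS]gp add0r.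
(* Subtracting the linear growth makes the angle agree at both ends of the period, so that it
   extends periodically; the growth is then restored as [n%:~R * s]. *)
exists n, (fun s => rho (pi * fr s)), (fun s =>
  (th (pi * fr s) - n%:~R * (2 * pi) * fr s) + n%:~R * s); split.
- split.
    apply: (frc _ (fun u => rho (pi * u))); last by rewrite rE.
    by cts s; exact: cr.
  move=> s; apply: tends_cts; apply: tendsD; last by tnd.
  apply: tends_nbhs; apply: (frc _ (fun u => th (pi * u) - n%:~R * (2 * pi) * u)).
    by cts u; exact: ct.
  by rewrite thE; ring.
- by move=> s.
- by move=> s; rewrite frp; split=> //; ring.
- move=> s; rewrite -[g s](_ : g (2 * pi * fr s) = _).
    rewrite gu; last by have /andP[-> /ltW] := frI s.
    have -> : th (pi * fr s) - n%:~R * (2 * pi) * fr s + n%:~R * s =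
      th (pi * fr s) + (n * Num.floor (s / (2 * pi)))%:~R * (2 * pi).
      have sE : n%:~R * s = n%:~R * (2 * pi * (fr s + (Num.floor (s / (2 * pi)))%:~R)).
        by rewrite /fr subrK [2 * pi * _]mulrC divfK.
      by rewrite sE intrM; move: (fr s) => f; ring.
    by rewrite circle_pt_period.
  rewrite -[RHS](@periodic_int _ _ g (2 * pi) gp s (- Num.floor (s / (2 * pi)))).
  by congr g; rewrite /fr mulrBr mulrC divfK// mulrNz; ring.
Qed.

Definition disc p (r : R) : set (R * R) :=
  [set x | (x.1 - p.1) ^+ 2 + (x.2 - p.2) ^+ 2 < r ^+ 2].

Lemma disc_circle p r r' s : (disc p r (circle_pt p r' s)) = (r' ^+ 2 < r ^+ 2) :> Prop.
Proof.
rewrite /disc /circle_pt /= [p.1 + _]addrC addrK [p.2 + _]addrC addrK.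
by rewrite !exprMn -mulrDr cos2Dsin2 mulr1.
Qed.

Lemma disc_center p r : 0 < r -> disc p r p.
Proof. by move=> r0; rewrite /disc /= !subrr expr0n addr0 exprn_gt0. Qed.

Lemma disc_open p r : open (disc p r).
Proof.
rewrite openE => x dx.
have : tends (nbhs x) (fun x => (x.1 - p.1) ^+ 2 + (x.2 - p.2) ^+ 2) ((x.1 - p.1) ^+ 2 + (x.2 -
  p.2) ^+ 2) by tnd.
by move=> /tends_lt; apply.
Qed.

Lemma sqr_convex (a b t : R) : 0 <= t <= 1 ->
  ((1 - t) * a + t * b) ^+ 2 <= (1 - t) * a ^+ 2 + t * b ^+ 2.
Proof.
move=> /andP[t0 t1]; rewrite -subr_ge0.
have -> : (1 - t) * a ^+ 2 + t * b ^+ 2 - ((1 - t) * a + t * b) ^+ 2 = (1 - t) * t * (a - b) ^+ 2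
  by ring.
by rewrite mulr_ge0 ?sqr_ge0// mulr_ge0// subr_ge0.
Qed.

Definition cvxcomb (t : R) p q : R * R := ((1 - t) * p.1 + t * q.1, (1 - t) * p.2 + t * q.2).

Lemma disc_convex p r x y t : 0 <= t <= 1 -> disc p r x -> disc p r y ->
  disc p r (cvxcomb t x y).
Proof.
rewrite /disc /= => t01 dx dy.
have e a b c : (1 - t) * a + t * b - c = (1 - t) * (a - c) + t * (b - c) :> R by ring.
rewrite !e; have h1 := sqr_convex (x.1 - p.1) (y.1 - p.1) t01.
have h2 := sqr_convex (x.2 - p.2) (y.2 - p.2) t01.
apply: le_lt_trans (lerD h1 h2) _; move: t01 => /andP[t0 t1].
set a := (x.1 - p.1) ^+ 2 in dx *; set b := (x.2 - p.2) ^+ 2 in dx *.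
set c := (y.1 - p.1) ^+ 2 in dy *; set f := (y.2 - p.2) ^+ 2 in dy *.
have -> : (1 - t) * a + t * c + ((1 - t) * b + t * f) = (1 - t) * (a + b) + t * (c + f) by ring.
case: (eqVneq t 0) => [->|tn]; first by rewrite subr0 mul1r mul0r addr0.
have tp : 0 < t by rewrite lt_neqAle eq_sym tn.
by nra.
Qed.

Lemma theta_period_int n (th : R -> R) :
  (forall s, th (s + 2 * pi) = th s + n%:~R * (2 * pi)) ->
  forall s m, th (s + m%:~R * (2 * pi)) = th s + (m * n)%:~R * (2 * pi).
Proof.
move=> h s m.
have h' u : th (u + 2 * pi) - n%:~R * (u + 2 * pi) = th u - n%:~R * u by rewrite h; ring.
have /= e := @periodic_int _ _ (fun s => th s - n%:~R * s) (2 * pi) h' s m.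
by rewrite -[LHS](subrK (n%:~R * (s + m%:~R * (2 * pi)))) e intrM; ring.
Qed.

(** Interpolating the polar coordinates of [g] deforms it, inside the punctured disc, into the
    circle of radius [r] run [d] times. On that loop the image winds [d * e] times by direct
    computation. *)
Lemma winds_mult k p q r0 r d e g :
  (forall x, disc p r0 x -> {for x, continuous k}) ->
  (forall x, disc p r0 x -> x != p -> k x != q) -> 0 < r < r0 ->
  winds q (fun s => k (circle_pt p r s)) e ->
  winds p g d -> (forall s, disc p r0 (g s)) ->
  winds q (fun s => k (g s)) (d * e).
Proof.
move=> ck kq /andP[r_gt0 rr0] [rk [tk [[crk ctk] rk0 tkE kE]]] [rho [th [[cr ct] rho0 thE gE]]] dg.
pose pt t s := circle_pt p ((1 - t) * r + t * rho s) ((1 - t) * (d%:~R * s) + t * th s).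
have rad t s : 0 <= t <= 1 -> 0 < (1 - t) * r + t * rho s < r0.
  move=> /andP[t0 t1]; have h1 := rho0 s; have h2 : rho s < r0.
    have := dg s; rewrite gE disc_circle; rewrite ltr_pXn2r// nnegrE ltW//; lra.
  apply/andP; split; case: (eqVneq t 0) => [->|tn]; rewrite ?subr0 ?mul1r ?mul0r ?addr0//;
  have tp : 0 < t by rewrite lt_neqAle eq_sym tn.
    by nra.
  by nra.
have dpt t s : 0 <= t <= 1 -> disc p r0 (pt t s).
  move=> /(rad _ s)/andP[h1 h2]; rewrite disc_circle ltr_pXn2r// nnegrE ltW//; lra.
suff : winds q (fun s => k (pt 1 s)) (d * e).
  by move=> /winds_eq; apply=> s; rewrite /pt subrr !mul0r !mul1r !add0r gE.
apply: (@winds_homotopy _ q (fun t s => k (pt t s))).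
- apply: continuous_in_subspaceT => -[t s]; rewrite inE /= => t01.
  apply: tends_cts; apply: (tends_at (h := k)); last by apply: ck; exact: dpt.
  rewrite /pt /circle_pt; tnd; by [exact: cr|exact: ct].
- move=> t s t01; congr k; rewrite /pt (thE s).2.
  rewrite (thE s).1 -[RHS](circle_pt_period _ _ _ d); congr circle_pt; ring.
- move=> t s t01; apply: kq; first exact: dpt.
  by apply/eqP => /circle_pt_eq0 e0; have /andP[] := rad t s t01; rewrite e0 ltxx.
- exists (fun s => rk (d%:~R * s)), (fun s => tk (d%:~R * s)); split => //.
  + by split; cts s; by [exact: crk|exact: ctk].
  + move=> s; rewrite mulrDr (theta_period_int (fun s => (tkE s).2)).
    by rewrite (periodic_int (fun s => (tkE s).1)).
  + by move=> s; rewrite -kE /pt subr0 !mul1r !mul0r !addr0.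
Qed.

(** Centre and radius are moved linearly at the same time. The moving image of the centre is
    subtracted, so that the homotopy avoids one fixed point; injectivity of [k] keeps it away from
    there. *)
Lemma winds_disc k p0 R0 p p' r r' d :
  (forall x, disc p0 R0 x -> {for x, continuous k}) ->
  (forall x y, disc p0 R0 x -> disc p0 R0 y -> k x = k y -> x = y) ->
  0 < r -> 0 < r' -> disc p0 R0 p -> disc p0 R0 p' ->
  (forall s, disc p0 R0 (circle_pt p r s)) ->
  (forall s, disc p0 R0 (circle_pt p' r' s)) ->
  winds (k p) (fun s => k (circle_pt p r s)) d ->
  winds (k p') (fun s => k (circle_pt p' r' s)) d.
Proof.
move=> ck ik r0 r0' dp dp' dr dr' w.
pose pt t := cvxcomb t p p'.
pose ct t s := cvxcomb t (circle_pt p r s) (circle_pt p' r' s).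
have ctE t s : ct t s = circle_pt (pt t) ((1 - t) * r + t * r') s.
  by rewrite /ct /pt /cvxcomb /circle_pt /=; congr pair; ring.
pose G t s := k (ct t s) - k (pt t).
have dpt t : 0 <= t <= 1 -> disc p0 R0 (pt t) by move=> t01; exact: disc_convex.
have dct t s : 0 <= t <= 1 -> disc p0 R0 (ct t s) by move=> t01; exact: disc_convex.
suff w1 : winds 0 (G 1) d.
  apply: (winds_eq (winds_shift (k p') w1)) => s.
  by rewrite /G subr0 ctE /pt /cvxcomb subrr !mul0r !mul1r !add0r -surjective_pairing subrK.
apply: (@winds_homotopy _ 0 G).
- apply: continuous_in_subspaceT => -[t s]; rewrite inE /= => t01.
  apply: tends_cts; rewrite /G; apply: tendsB2.
    apply: (tends_at (h := k) (f := fun x : R * R => ct x.1 x.2)); last exact: ck (dct _ _ t01).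
    by rewrite /ct /cvxcomb /circle_pt /=; tnd.
  apply: (tends_at (h := k) (f := fun x : R * R => pt x.1)); last exact: ck (dpt _ t01).
  by rewrite /pt /cvxcomb /=; tnd.
- by move=> t s _; rewrite /G !ctE circle_pt_period1.
- move=> t s t01; apply/eqP => /subr0_eq /(ik _ _ (dct _ _ t01) (dpt _ t01)).
  rewrite ctE => /circle_pt_eq0; move/andP: t01 => [t0 t1].
  case: (eqVneq t 0) => [->|tn]; first by rewrite subr0 mul1r mul0r addr0; lra.
  have tp : 0 < t by rewrite lt_neqAle eq_sym tn.
  by nra.
- apply: (winds_eq (winds_shift 0 w)) => s.
  by rewrite /G ctE /pt /cvxcomb subr0 !mul0r !mul1r !addr0 -surjective_pairing.
Qed.

Lemma nbhs_disc p (U : set (R * R)) : nbhs p U ->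
  exists2 r, 0 < r & disc p r `<=` U.
Proof.
move=> /nbhs_ballP [e /= e0 eU]; exists e => // x; rewrite /disc /= => dx.
apply: eU; rewrite -ball_normE /ball_ /=.
have h (a b : R) : 0 <= b -> a ^+ 2 + b < e ^+ 2 -> `|a| < e.
  move=> b0 hh; rewrite -(@ltr_pXn2r _ 2)// ?nnegrE ?(ltW e0)// real_normK ?num_real//.
  by apply: le_lt_trans hh; rewrite lerDl.
rewrite /Num.norm /= gt_max; apply/andP; split; rewrite distrC.
  by apply: h dx; exact: sqr_ge0.
by move: dx; rewrite addrC; apply: h; exact: sqr_ge0.
Qed.

Lemma disc_sub p r r' : 0 <= r <= r' -> disc p r `<=` disc p r'.
Proof.
move=> /andP[r0 rr] x; rewrite /disc /= => /lt_le_trans; apply.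
by rewrite lerXn2r// nnegrE// (le_trans r0).
Qed.

Lemma disc_minl p r r' : 0 < r -> 0 < r' -> disc p (Num.min r r') `<=` disc p r.
Proof. by move=> r0 r'0; apply: disc_sub; rewrite le_min ge_min lexx (ltW r0) (ltW r'0). Qed.

Lemma disc_minr p r r' : 0 < r -> 0 < r' -> disc p (Num.min r r') `<=` disc p r'.
Proof. by move=> r0 r'0; apply: disc_sub; rewrite le_min ge_min lexx orbT (ltW r0) (ltW r'0). Qed.

Lemma disc_nbhs p r : 0 < r -> nbhs p (disc p r).
Proof. by move=> r0; apply: open_nbhs_nbhs; split; [exact: disc_open|exact: disc_center]. Qed.

Lemma near_right_lt (r : R) : 0 < r -> \forall x \near 0^'+, 0 < x < r.
Proof.
move=> r0; near=> x; apply/andP; split; near: x; first exact: nbhs_right_gt.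
exact: nbhs_right_lt.
Unshelve. all: by end_near. Qed.

Lemma winds_isometry p r (a : R) e : 0 < r ->
  winds p (fun s => circle_pt p r (e%:~R * s + a)) e.
Proof.
move=> r0; exists (fun=> r), (fun s => e%:~R * s + a); split => //.
- by split => [s|]; [exact: cvg_cst|cts s].
- by move=> s; split => //; ring.
Qed.

Lemma circle_in_subdisc p0 R0 p r : disc p0 (R0 / 2) p -> 0 < r < R0 / 2 ->
  forall s, disc p0 R0 (circle_pt p r s).
Proof.
move=> dp /andP[r0 rR] s; move: dp; rewrite /disc /circle_pt /= => dp.
have cs := cos2Dsin2 s.
set a := p.1 - p0.1 in dp *; set b := p.2 - p0.2 in dp *.
have -> : p.1 + r * cos s - p0.1 = a + r * cos s by rewrite /a; ring.
have -> : p.2 + r * sin s - p0.2 = b + r * sin s by rewrite /b; ring.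
have -> : (a + r * cos s) ^+ 2 + (b + r * sin s) ^+ 2 =
  2 * (a ^+ 2 + b ^+ 2) + 2 * r ^+ 2 * (cos s ^+ 2 + sin s ^+ 2)
   - ((a - r * cos s) ^+ 2 + (b - r * sin s) ^+ 2) by ring.
rewrite cs mulr1.
have h1 : 0 <= (a - r * cos s) ^+ 2 + (b - r * sin s) ^+ 2 by rewrite addr_ge0 ?sqr_ge0.
have h2 : r ^+ 2 < (R0 / 2) ^+ 2 by rewrite ltr_pXn2r// nnegrE ltW//; lra.
have h3 : R0 ^+ 2 = 4 * (R0 / 2) ^+ 2 by field.
by rewrite h3; lra.
Qed.
End Winding2.

(** * Local degree and orientation *)

Definition emb_disc (R : realType) (T : topologicalType) (K : R * R -> T) (p : R * R) (r : R) :=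
  (forall x, disc p r x -> {for x, continuous K}) /\
  (forall x y, disc p r x -> disc p r y -> K x = K y -> x = y).

Lemma emb_disc_sub (R : realType) (T : topologicalType) (K : R * R ->
  T) (p : R * R) (r r' : R) : 0 <= r <= r' -> emb_disc K p r' -> emb_disc K p r.
Proof.
move=> /disc_sub rr [c i]; split=> [x /rr|x y /rr dx /rr]; [exact: c|exact: i].
Qed.

Section Degree.
Variables (R : realType) (S : topologicalType).
Implicit Types (p q l : R * R) (s t r : R) (n m d e : int) (K L psi : R * R -> S).

(** The lift is the inverse of [L] after [K]. Openness of [L] on [W] gives its continuity and takes
    the place of invariance of domain. *)
Lemma local_lift L (W : set (R * R)) K (U : set (R * R)) :
  (forall y z, W y -> W z -> L y = L z -> y = z) ->
  (forall y V, W y -> nbhs y V -> nbhs (L y) (L @` (V `&` W))) ->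
  (forall x, U x -> {for x, continuous K}) ->
  (forall x, U x -> exists2 y, W y & L y = K x) ->
  exists k : R * R -> R * R, forall x, U x ->
    [/\ W (k x), K x = L (k x) & (nbhs x U -> {for x, continuous k})].
Proof.
move=> injL openL cK KW.
have [k kP] : exists k : R * R -> R * R, forall x, U x -> W (k x) /\ K x = L (k x).
  pose k x := if pselect (U x) is left Ux then sval (cid2 (KW x Ux)) else x.
  by exists k => x Ux; rewrite /k; case: pselect => // Ux'; case: cid2.
exists k => x Ux; have [Wk Kk] := kP _ Ux; split => // nU V nV.
have nK : \forall y \near x, (L @` (V `&` W)) (K y).
  by apply: (cK _ Ux); rewrite Kk; exact: openL.
suff : \forall y \near x, V (k y) by [].
near=> y.
have Uy : U y by near: y.
have [z [Vz Wz] Lz] : (L @` (V `&` W)) (K y) by near: y; exact: nK.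
have [Wky Kky] := kP _ Uy.
by rewrite -(injL z (k y)) // Lz.
Unshelve. all: by end_near. Qed.

Lemma open_embedding_emb psi p r : open_embedding psi -> emb_disc psi p r.
Proof. by move=> [c i _]; split=> [x _|x y _ _]; [exact: c|exact: i]. Qed.

Lemma chart_lift psi K p q R0 : open_embedding psi -> 0 < R0 ->
  emb_disc K p R0 -> psi q = K p ->
  exists R1 k, [/\ 0 < R1 <= R0, k p = q, emb_disc k p R1 &
    forall x, disc p R1 x -> K x = psi (k x)].
Proof.
move=> [cpsi ipsi opsi] R00 [cK iK] pq.
have : nbhs p (K @^-1` (range psi) `&` disc p R0).
  apply: filterI; last exact: disc_nbhs.
  apply: (cK p (disc_center _ R00)); apply: open_nbhs_nbhs; split; last by exists q.
  by apply: opsi; exact: openT.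
move=> /nbhs_disc [r r0 rU].
have [r1 [r10 r1r r1R]] : exists r1, [/\ 0 < r1, r1 <= r & r1 <= R0].
  by exists (Num.min r R0); split; rewrite ?lt_min ?r0 ?R00 ?ge_min ?lexx ?orbT.
have sub : disc p r1 `<=` disc p r by apply: disc_sub; rewrite ltW.
have [|||x /sub /rU [[y _ <-] _]|k kP] := @local_lift psi setT K (disc p r1).
- by move=> y z _ _; exact: ipsi.
- move=> y V _ nV; rewrite setIT.
  have h : psi @` V^° `<=` psi @` V.
    by move=> _ [x Vx <-]; exists x => //; exact: (@interior_subset _ V).
  apply: filterS h _.
  apply: open_nbhs_nbhs; split; first by apply: opsi; exact: open_interior.
  by exists y.
- by move=> x /sub /rU [_]; exact: cK.
- by exists y.
have kp : k p = q.
  by apply: ipsi; have [_ <- _] := kP _ (disc_center p r10).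
have sub' : disc p r1 `<=` disc p R0 by apply: disc_sub; rewrite ltW.
exists r1, k; split => //; first by rewrite r10.
  split=> [x dx|x y dx dy kxy].
    have [_ _] := kP x dx; apply; apply: open_nbhs_nbhs; split => //.
    exact: disc_open.
  apply: iK; [exact: sub'|exact: sub'|].
  by have [_ -> _] := kP _ dx; have [_ -> _] := kP _ dy; rewrite kxy.
by move=> x dx; have [] := kP _ dx.
Qed.

(** The smallness clause keeps the loop in a prescribed disc about [q]. Without it a further
    coordinate change, defined only near [q], could not be applied, and degrees would not
    compose. *)
Definition degree_at K L p q d := forall e : R, 0 < e -> \forall r \near 0^'+,
  exists g, [/\ winds q g d, forall s, K (circle_pt p r s) = L (g s) &
    forall s, disc q e (g s)].

(** Through a local lift the germ condition becomes a statement about any single circle in the disc,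
    since [winds_disc] identifies the winding numbers of all of them. *)
Lemma degree_at_lift psi K p R1 k d : injective psi -> 0 < R1 -> emb_disc k p R1 ->
  (forall x, disc p R1 x -> K x = psi (k x)) ->
  degree_at K psi p (k p) d <->
  forall r, 0 < r < R1 -> winds (k p) (fun s => k (circle_pt p r s)) d.
Proof.
move=> ipsi R10 [ck ik] Kk; split.
  move=> /(_ 1 ltr01) dK r /andP[r0 rR].
  have [r' [/andP[r'0 r'R] [g [wg Kg _]]]] : exists r', 0 < r' < R1 /\
      exists g, [/\ winds (k p) g d, forall s, K (circle_pt p r' s) = psi (g s) &
      forall s, disc (k p) 1 (g s)].
    by apply/(@filter_ex _ (0^'+)); apply: filterI dK; exact: near_right_lt.
  have dc r'' s : 0 < r'' -> r'' < R1 -> disc p R1 (circle_pt p r'' s).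
    by move=> r''0 h; rewrite disc_circle ltr_pXn2r// nnegrE ltW.
  apply: (winds_disc ck ik r'0) => //; try exact: disc_center.
  - by move=> s; exact: dc.
  - by move=> s; exact: dc.
  apply: (winds_eq wg) => s; apply: ipsi; rewrite -Kg Kk//; exact: dc.
move=> H e e0.
have : nbhs p (k @^-1` (disc (k p) e)).
  by apply: (ck p (disc_center _ R10)); exact: disc_nbhs.
move=> /nbhs_disc [r2 r20 r2U].
near=> r; have /andP[r0 rR1] : 0 < r < R1 by near: r; exact: near_right_lt.
have /andP[_ rr2] : 0 < r < r2 by near: r; exact: near_right_lt.
exists (fun s => k (circle_pt p r s)); split => [|s|s].
- by apply: H; rewrite r0.
- by apply: Kk; rewrite disc_circle ltr_pXn2r// nnegrE ltW.
- by apply: r2U; rewrite disc_circle ltr_pXn2r// nnegrE ltW.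
Unshelve. all: by end_near. Qed.

Lemma degree_at_exists psi K p q R0 : open_embedding psi -> 0 < R0 ->
  emb_disc K p R0 -> psi q = K p -> exists d, degree_at K psi p q d.
Proof.
move=> opsi R00 eK pq.
have [R1 [k [/andP[R10 R1R0] kp [ck ik] Kk]]] := chart_lift opsi R00 eK pq.
have dc s r : 0 < r -> r < R1 -> disc p R1 (circle_pt p r s).
  by move=> r0 h; rewrite disc_circle ltr_pXn2r// nnegrE ltW.
have h2 : 0 < R1 / 2 < R1 by apply/andP; split; lra.
have h2' := andP h2.
have [|||d wd] := @winds_exists _ (k p) (fun s => k (circle_pt p (R1 / 2) s)).
- move=> s; apply: tends_cts; apply: (tends_at (h := k) (f := circle_pt p (R1 / 2))).
    by rewrite /circle_pt; tnd.
  by apply: ck; apply: dc; case: h2'.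
- by move=> s; rewrite circle_pt_period1.
- move=> s; apply/eqP => /ik -/(_ (dc _ _ h2'.1 h2'.2) (disc_center _ R10)) /circle_pt_eq0.
  by case: h2' => + _ h; rewrite h ltxx.
exists d; rewrite -kp; apply/(degree_at_lift _ _ R10 _ Kk) => //; first by case: opsi.
move=> r /andP[r0 rR].
by apply: (winds_disc ck ik h2'.1 r0) wd; try exact: disc_center; move=> s; apply: dc => //;
  case: h2'.
Qed.

Lemma degree_at_uniq psi K p q d d' : injective psi ->
  degree_at K psi p q d -> degree_at K psi p q d' -> d = d'.
Proof.
move=> ipsi /(_ 1 ltr01) H1 /(_ 1 ltr01) H2.
have [r [[g [w1 K1 _]] [g' [w2 K2 _]]]] := @filter_ex _ (0^'+) _ _ (filterI H1 H2).
by apply: (winds_uniq w1 (winds_eq w2 _)) => s; apply: ipsi; rewrite -K1 -K2.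
Qed.

Lemma degree_at_comp psi K L p l q d e R2 : open_embedding psi -> 0 < R2 ->
  emb_disc L l R2 -> psi q = L l ->
  degree_at K L p l d -> degree_at L psi l q e -> degree_at K psi p q (d * e).
Proof.
move=> opsi R20 eL ql dK dL.
have [R1 [k [/andP[R10 R1R2] kl ek Lk]]] := chart_lift opsi R20 eL ql.
have ipsi : injective psi by case: opsi.
move: dL; rewrite -kl => /(degree_at_lift _ ipsi R10 ek Lk) wk.
move=> e' e'0; have [ck ik] := ek.
have : nbhs l (k @^-1` (disc (k l) e')).
  by apply: (ck l (disc_center _ R10)); exact: disc_nbhs.
move=> /nbhs_disc [r2 r20 r2U].
pose r3 := Num.min r2 R1.
have r30 : 0 < r3 by rewrite lt_min r20.
apply: filterS (dK r3 r30) => r [g [wg Kg dg]].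
have s1 : disc l r3 `<=` disc l R1 by apply: disc_sub; rewrite ge_min lexx orbT ltW.
have s2 : disc l r3 `<=` disc l r2 by apply: disc_sub; rewrite ge_min lexx ltW.
exists (fun s => k (g s)); split => [|s|s].
- have hR : 0 < R1 / 2 < R1 by apply/andP; split; lra.
  apply: (winds_mult ck _ hR (wk _ hR) wg) => [x dx xl|s]; last exact: s1.
  by apply: contra xl => /eqP /ik -> //; exact: disc_center.
- by rewrite Kg Lk//; exact: s1.
- by apply: r2U; exact: s2.
Qed.

Lemma degree_at_isometry K (f : R * R -> R * R) p (a : R) e :
  (forall r s, f (circle_pt p r s) = circle_pt (f p) r (e%:~R * s + a)) ->
  degree_at (K \o f) K p (f p) e.
Proof.
move=> fE e' e'0; near=> r.
have /andP[r0 re] : 0 < r < e' by near: r; exact: near_right_lt.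
exists (fun s => circle_pt (f p) r (e%:~R * s + a)); split => [|s|s].
- exact: winds_isometry.
- by rewrite /= fE.
- by rewrite disc_circle ltr_pXn2r// nnegrE ltW.
Unshelve. all: by end_near. Qed.

(** [co_oriented_at] asks neither for a periodic radius nor for a small loop. Injectivity of [psi]
    supplies the first, continuity of the local lift the second. *)
Lemma co_oriented_degree psi K p q R0 : open_embedding psi -> 0 < R0 ->
  emb_disc K p R0 -> psi q = K p -> co_oriented_at K psi p q ->
  degree_at K psi p q 1.
Proof.
move=> opsi R00 eK pq co.
have [R1 [k [/andP[R10 R1R0] kp ek Kk]]] := chart_lift opsi R00 eK pq.
have ipsi : injective psi by case: opsi.
have [ck ik] := ek.
move=> e e0.
have : nbhs p (k @^-1` (disc (k p) e)).
  by apply: (ck p (disc_center _ R10)); exact: disc_nbhs.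
move=> /nbhs_disc [r2 r20 r2U].
near=> r; have /andP[r0 rR1] : 0 < r < R1 by near: r; exact: near_right_lt.
have /andP[_ rr2] : 0 < r < r2 by near: r; exact: near_right_lt.
have [rho [theta [[cr ct] rho0 thE gE]]] : exists rho theta : R -> R,
    [/\ continuous rho /\ continuous theta, forall s, 0 < rho s,
        forall s, theta (s + 2 * pi) = theta s + 2 * pi &
        forall s, K (circle_pt p r s) = psi (circle_pt q (rho s) (theta s))].
  by near: r; exact: co.
exists (fun s => circle_pt q (rho s) (theta s)); split => [|s|s].
- exists rho, theta; split=> // s; rewrite thE mul1r; split => //.
  have : circle_pt q (rho (s + 2 * pi)) (theta (s + 2 * pi)) = circle_pt q (rho s) (theta s).
    by apply: ipsi; rewrite -!gE circle_pt_period1.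
  by move=> /circle_pt_inj[].
- exact: gE.
- have <- : k (circle_pt p r s) = circle_pt q (rho s) (theta s).
    by apply: ipsi; rewrite -gE Kk// disc_circle ltr_pXn2r// nnegrE ltW.
  by rewrite -kp; apply: r2U; rewrite disc_circle ltr_pXn2r// nnegrE ltW.
Unshelve. all: by end_near. Qed.

Variable O : set (R * R -> S).
Hypothesis orO : orientation O.

Definition has_sign K p d := forall psi q, O psi -> psi q = K p -> degree_at K psi p q d.

Lemma O_emb psi : O psi -> open_embedding psi.
Proof. by case: orO => h _ _ _; exact: h. Qed.

Lemma O_chart x : exists psi q, O psi /\ psi q = x.
Proof. by case: orO => _ /(_ x) [psi Opsi [q _ <-]] _ _; exists psi, q. Qed.

(** Transition maps of the oriented atlas have degree 1, so multiplicativity carries the degree from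
    one chart to all others. *)
Lemma has_sign_one_chart psi K p q d :
  O psi -> psi q = K p -> degree_at K psi p q d -> has_sign K p d.
Proof.
move=> Opsi pq dK psi' q' Opsi' pq'.
rewrite -[d]mulr1.
apply: (degree_at_comp (R2 := 1) (l := q) (L := psi)) => //; try exact: O_emb.
- exact: open_embedding_emb (O_emb Opsi).
- by rewrite pq pq'.
apply: (co_oriented_degree (R0 := 1)) => //; try exact: O_emb.
- exact: open_embedding_emb (O_emb Opsi).
- by rewrite pq pq'.
- by case: orO => _ _ /(_ psi psi' Opsi Opsi' q q') H _; apply: H; rewrite pq pq'.
Qed.

Lemma has_sign_exists K p R0 : 0 < R0 -> emb_disc K p R0 -> exists d, has_sign K p d.
Proof.
move=> R00 eK; have [psi [q [Opsi pq]]] := O_chart (K p).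
have [d dK] := degree_at_exists (O_emb Opsi) R00 eK pq.
by exists d; exact: has_sign_one_chart dK.
Qed.

Lemma has_sign_uniq K p d d' : has_sign K p d -> has_sign K p d' -> d = d'.
Proof.
move=> h h'; have [psi [q [Opsi pq]]] := O_chart (K p).
by apply: degree_at_uniq (h _ _ Opsi pq) (h' _ _ Opsi pq); case: (O_emb Opsi).
Qed.

Lemma has_sign_comp K L p l d e R2 : 0 < R2 -> emb_disc L l R2 -> K p = L l ->
  degree_at K L p l d -> has_sign L l e -> has_sign K p (d * e).
Proof.
move=> R20 eL KL dK sL psi q Opsi pq.
apply: (degree_at_comp (O_emb Opsi) R20 eL _ dK); first by rewrite pq KL.
by apply: sL => //; rewrite pq.
Qed.

Lemma has_sign_locally K p R0 d : 0 < R0 -> emb_disc K p R0 ->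
  exists2 R1, 0 < R1 & forall p' p'', disc p R1 p' -> disc p R1 p'' ->
    has_sign K p' d -> has_sign K p'' d.
Proof.
move=> R00 eK; have [psi [q [Opsi pq]]] := O_chart (K p).
have [R1 [k [/andP[R10 R1R0] kp [ck ik] Kk]]] := chart_lift (O_emb Opsi) R00 eK pq.
have ipsi : injective psi by case: (O_emb Opsi).
exists (R1 / 2); first by lra.
have sub : disc p (R1 / 2) `<=` disc p R1 by apply: disc_sub; apply/andP; split; lra.
have [r [r0 rR]] : exists r, 0 < r /\ r < R1 / 2 by exists (R1 / 4); split; lra.
have emb' z : disc p (R1 / 2) z -> exists rz, [/\ 0 < rz, rz < R1 / 2, emb_disc k z rz &
    forall x, disc z rz x -> disc p R1 x].
  move=> dz; have : nbhs z (disc p R1) by apply: open_nbhs_nbhs; split;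
    [exact: disc_open|exact: sub].
  move=> /nbhs_disc [r1 r10 r1U].
  exists (Num.min r1 r); split; rewrite ?lt_min ?r0 ?r10 ?gt_min ?rR ?orbT//.
    have s1 : disc z (Num.min r1 r) `<=` disc p R1.
      by apply: subset_trans r1U; exact: disc_minl.
    by split=> [x /s1|x y /s1 dx /s1]; [exact: ck|exact: ik].
  by move=> x dx; apply: r1U; exact: disc_minl dx.
move=> p' p'' dp' dp'' s'.
have [r' [r'0 r'R ek' sub']] := emb' _ dp'.
have [r'' [r''0 r''R ek'' sub'']] := emb' _ dp''.
apply: (has_sign_one_chart Opsi (q := k p'')); first by rewrite -Kk//; exact: sub.
apply/(degree_at_lift _ ipsi r''0 ek''); first by move=> x /sub'' /Kk.
move=> u /andP[u0 ur].
have h' : 0 < r' / 2 < r' by apply/andP; split; lra.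
have [h'1 h'2] := andP h'.
apply: (winds_disc ck ik h'1 u0 (sub _ dp') (sub _ dp'')).
- by apply: circle_in_subdisc => //; apply/andP; split => //; exact: lt_trans r'R.
- by apply: circle_in_subdisc => //; apply/andP; split => //; exact: lt_trans r''R.
have : degree_at K psi p' (k p') d by apply: s' => //; rewrite -Kk//; exact: sub.
by move=> /(degree_at_lift _ ipsi r'0 ek' (fun x dx => Kk x (sub' x dx))); apply.
Qed.

(** Signs thus need to be known at a single point only: they are transported along the axes of a
    handle and across the common boundary of the two handles. *)
Lemma has_sign_path K (gam : R -> R * R) d : continuous gam ->
  (forall t, 0 <= t <= 1 -> exists2 R0, 0 < R0 & emb_disc K (gam t) R0) ->
  has_sign K (gam 0) d -> has_sign K (gam 1) d.
Proof.
move=> cg eK; apply: (@segment_locally_constant _ (fun t => has_sign K (gam t) d)) => t t01.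
have [R0 R00 eR] := eK t t01; have [R1 R10 H] := has_sign_locally d R00 eR.
have : \forall u \near t, disc (gam t) R1 (gam u) by apply: (cg t); exact: disc_nbhs.
apply: filterS => u du _; have dt := disc_center (gam t) R10.
by split; exact: H.
Qed.
End Degree.

Lemma near_prodl {T U : topologicalType} (t : T) (u : U) (P : T -> Prop) :
  (\forall x \near t, P x) -> \forall z \near (t, u), P z.1.
Proof. by move=> nP; apply: (cvg_fst (F := nbhs t) (G := nbhs u)). Qed.

Lemma near_prodr {T U : topologicalType} (t : T) (u : U) (P : U -> Prop) :
  (\forall x \near u, P x) -> \forall z \near (t, u), P z.2.
Proof. by move=> nP; apply: (cvg_snd (F := nbhs t) (G := nbhs u)). Qed.

(** * Continuity on compact quotients *)

Section Descent.
Variables (X Y T : topologicalType).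

(** A map from a compact set to a Hausdorff space is closed: near [y] only points of [D] close to
    the fibre over [y] matter, since the other ones are separated from [y]. The parameter [t] lets
    the same lemma treat isotopies. *)
Lemma near_descend (D : set X) (pj : X -> Y) (t : T) (y : Y) (W : T -> Y -> Prop) :
  compact D -> hausdorff_space Y -> {within D, continuous pj} ->
  (forall x, D x -> pj x = y -> \forall z \near (x, t), D z.1 -> W z.2 (pj z.1)) ->
  \forall z \near (t, y), forall x, D x -> pj x = z.2 -> W z.1 z.2.
Proof.
move=> cD hY /subspace_continuousP cpj H.
apply: near_compact cD _ => x Dx.
have [e|e] := pselect (pj x = y).
  have nt : tends (nbhs (x, (t, y))) (fun w : X * (T * Y) => (w.1, w.2.1)) (x, t) by tnd.
  have nH : \forall w \near (x, (t, y)), D w.1 -> W w.2.1 (pj w.1) by exact: (nt _ (H x Dx e)).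
  by apply: filterS nH => -[x' [t' y']] /= h Dx' <-; exact: h.
move: hY; rewrite open_hausdorff => /(_ (pj x) y) [|[A B] /= [xA yB] [oA oB]].
  by apply/eqP.
move=> /eqP AB0; rewrite !inE in xA yB.
have nA : \forall z \near (x, (t, y)), D z.1 -> A (pj z.1).
  have := cpj _ Dx A (open_nbhs_nbhs (conj oA xA)).
  rewrite /= nbhs_simpl /within /= => nA.
  exact: (near_prodl (t, y) nA).
have nB : \forall z \near (x, (t, y)), B z.2.2.
  have nt : tends (nbhs (x, (t, y))) (fun w : X * (T * Y) => w.2.2) y by tnd.
  exact: nt _ (open_nbhs_nbhs (conj oB yB)).
apply: filterS2 nA nB => -[x' [t' y']] /= hA hB Dx' e'.
have : (A `&` B) y' by split => //; rewrite -e'; exact: hA.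
by rewrite AB0.
Qed.
End Descent.

(** It replaces quotient topologies: the surface is covered by two compact images, either two
    handles or an annulus and the complement of its interior, and continuity is tested on each after
    pulling back. *)
Lemma continuous_descend2 (X1 X2 Y1 T1 Z : topologicalType) (D1 : set X1) (D2 : set X2)
    (p1 : X1 -> Y1) (p2 : X2 -> Y1) (F : T1 * Y1 -> Z) :
  hausdorff_space Y1 -> compact D1 -> compact D2 ->
  {within D1, continuous p1} -> {within D2, continuous p2} ->
  p1 @` D1 `|` p2 @` D2 = setT ->
  (forall t x, D1 x -> tends (within (fun z => D1 z.1) (nbhs (x, t))) (fun z =>
    F (z.2, p1 z.1)) (F (t, p1 x))) ->
  (forall t x, D2 x -> tends (within (fun z => D2 z.1) (nbhs (x, t))) (fun z =>
    F (z.2, p2 z.1)) (F (t, p2 x))) ->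
  continuous F.
Proof.
move=> hY c1 c2 ct1 ct2 cov F1 F2 [t y] U nU.
have h1 : \forall z \near (t, y), forall x, D1 x -> p1 x = z.2 -> U (F (z.1, z.2)).
  apply: (@near_descend _ _ _ D1 p1 t y (fun t y => U (F (t, y)))) => // x Dx e.
  by have := F1 t x Dx; rewrite e => /(_ _ nU).
have h2 : \forall z \near (t, y), forall x, D2 x -> p2 x = z.2 -> U (F (z.1, z.2)).
  apply: (@near_descend _ _ _ D2 p2 t y (fun t y => U (F (t, y)))) => // x Dx e.
  by have := F2 t x Dx; rewrite e => /(_ _ nU).
have h3 : \forall z \near (t, y), U (F z).
  apply: filterS2 h1 h2 => -[t' y'] /= a b.
  have : setT y' by []. 
  by rewrite -cov => -[[x Dx e]|[x Dx e]]; [exact: (a x)|exact: (b x)].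
exact: h3.
Qed.

Section Homeo.
Variables (R : realType) (S : topologicalType).
Hypotheses (cS : compact [set: S]) (hS : hausdorff_space S).

Lemma homeomorphism_bij (f : S -> S) : continuous f -> injective f ->
  (forall y, exists x, f x = y) -> homeomorphism f.
Proof.
move=> cf injf surjf; split => //.
have [g gK] := choice surjf.
have fK : cancel f g by move=> x; apply: injf; rewrite gK.
exists g; split => //.
apply/continuous_closedP => C cC.
have -> : g @^-1` C = f @` C.
  apply/seteqP; split => y /=; first by move=> Cg; exists (g y).
  by move=> [x Cx <-]; rewrite fK.
apply: compact_closed => //; apply: continuous_compact.
  exact: continuous_subspaceT.
by apply: subclosed_compact cS _.
Qed.

Lemma isotopicI (F : R * S -> S) (f g : S -> S) : continuous F ->
  (forall t, 0 <= t <= 1 -> injective (fun x => F (t, x))) ->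
  (forall t, 0 <= t <= 1 -> forall y, exists x, F (t, x) = y) ->
  (forall x, F (0, x) = f x) -> (forall x, F (1, x) = g x) -> isotopic R f g.
Proof.
move=> cF iF sF F0 F1; exists F; split => //; first exact: continuous_subspaceT.
move=> t t01; apply: homeomorphism_bij; [|exact: iF|exact: sF].
move=> x; apply: tends_cts; apply: (tends_at (h := F) (f := fun x => (t, x))); last exact: cF.
by tnd.
Qed.

(** The combination is again [F_t] after the inverse of [g] after [G_t]. Here [g] is a bare
    homeomorphism, because the model twists and torus maps through which isotopies pass carry no
    proof that they preserve the orientation. *)
Lemma isotopic_trans_homeomorphism (f g h : S -> S) : homeomorphism g ->
  isotopic R f g -> isotopic R g h -> isotopic R f h.
Proof.
move=> [cg [g' [cg' gK g'K]]] [F [cF hF F0 F1]] [G [cG hG G0 G1]].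
exists (F \o (fun p => (p.1, g' (G p)))); split => [|t t01|x|x] /=.
- apply: within_comp cF; last by move=> [t x] [].
  apply/subspace_continuousP => p Dp.
  apply: (@cvg_pair _ _ _ _ (nbhs p.1) (nbhs (g' (G p)))).
    by apply: cvg_within_filter; exact: cvg_fst.
  apply: cvg_comp; last exact: cg'.
  by move/subspace_continuousP: cG; apply.
- apply: (homeomorphism_comp (hF t t01)).
  apply: homeomorphism_comp (hG t t01).
  by split => //; exists g; split.
- by rewrite G0 gK F0.
- by rewrite G1 F1 g'K.
Qed.

End Homeo.

(** * Annuli and twists *)

Lemma tends_within {T : Type} {F : set_system T} {FF : Filter F} {U V : topologicalType}
    (A : set U) (f : U -> V) (k : T -> U) (l : U) :
  {within A, continuous f} -> A l -> tends F k l -> (\forall x \near F, A (k x)) ->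
  tends F (fun x => f (k x)) (f l).
Proof.
move=> /subspace_continuousP cf Al kl nA B nB.
have h : \forall y \near l, A y -> B (f y).
  by have := cf l Al B nB; rewrite /= nbhs_simpl /within.
have h' : \forall x \near F, A (k x) -> B (f (k x)) by exact: (kl _ h).
have : \forall x \near F, B (f (k x)) by apply: filterS2 h' nA => x; apply.
by [].
Qed.

Lemma within_eq {T U : topologicalType} (D : set T) (f g : T -> U) :
  (forall x, D x -> f x = g x) -> {within D, continuous f} -> {within D, continuous g}.
Proof. by move=> e; apply: subspace_eq_continuous => x; rewrite inE; exact: e. Qed.

Lemma near_within_mem {T : topologicalType} (D : set T) (x : T) :
  \forall z \near within D (nbhs x), D z.
Proof. exact: withinT. Qed.

Section Annulus.
Variables (R : realType) (S : topologicalType).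
Hypotheses (cS : compact [set: S]) (hS : hausdorff_space S).
Implicit Types (B : R * R -> S) (c : R).

Definition band c : set (R * R) := [set p | - c <= p.1 <= c].
Definition open_band c : set (R * R) := [set p | - c < p.1 < c].

(** Symmetric about the core [x = 0], unlike the annuli of the theorem, so that left and right
    halves can be exchanged. The last clause makes openness of the interior part of the data. *)
Definition annulus c B :=
  [/\ 0 < c, {within band c, continuous B},
      forall p q, band c p -> band c q ->
        (B p = B q <-> p.1 = q.1 /\ p.2 - q.2 \is a Num.int) &
      open (B @` open_band c)].

Lemma open_band_sub c : open_band c `<=` band c.
Proof. by move=> p /andP[h1 h2]; rewrite /band /= !ltW. Qed.

Lemma open_band_open c : open (open_band c).
Proof.
rewrite openE => p /andP[h1 h2].
have h : tends (nbhs p) (fun p : R * R => p.1) p.1 by tnd.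
by apply: filterS2 (tends_gt h h1) (tends_lt h h2) => q a b; rewrite /open_band /= a b.
Qed.

Lemma annulus_int c B x y (n : int) : annulus c B -> - c <= x <= c ->
  B (x, y + n%:~R) = B (x, y).
Proof.
move=> [_ _ iB _] xc; apply/iB => //; split => //=.
by rewrite addrC addKr rpred_int.
Qed.

Lemma band_box_compact c : compact (`[- c, c] `*` `[0 : R, 1]).
Proof. by apply: compact_setX; exact: segment_compact. Qed.

Lemma band_reduce (p : R * R) : exists n : int, 0 <= p.2 + n%:~R <= 1.
Proof.
have /andP[h1 h2] := floor_itv p.2; exists (- Num.floor p.2); move: h2.
by rewrite intrD mulrNz => h2; apply/andP; split; lra.
Qed.

Lemma band_box_image c B : annulus c B -> B @` (`[- c, c] `*` `[0 : R, 1]) = B @` band c.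
Proof.
move=> aB; apply/seteqP; split => _ [[x y] /= h <-].
  by case: h => /=; rewrite !in_itv /= => xc _; exists (x, y).
have [n hn] := band_reduce (x, y).
by exists (x, y + n%:~R); [split; rewrite /= in_itv|exact: (annulus_int _ _ aB)].
Qed.

(** Two parameters of one point of the interior differ by an integer shift, so every point of the
    fibre has a neighbourhood carried into that image; compactness of one period does the rest. The
    parameter 0 is a dummy. *)
Lemma annulus_open c B p V : annulus c B -> open_band c p -> nbhs p V ->
  nbhs (B p) (B @` (V `&` open_band c)).
Proof.
move=> aB pc nV; have [c0 cB iB oB] := aB.
have h1 : \forall z \near B p, (B @` open_band c) z.
  by apply: open_nbhs_nbhs; split => //; exists p.
have h2 : \forall z \near (0 : R, B p), forall x, (`[- c, c] `*` `[0 : R, 1]) x ->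
   B x = z.2 -> (B @` (V `&` open_band c)) z.2.
  apply: (@near_descend _ _ _ _ B 0 (B p) (fun _ y => (B @` (V `&` open_band c)) y)) => //.
  - exact: band_box_compact.
  - apply: continuous_subspaceW cB => -[x y] [/=].
    by rewrite !in_itv.
  move=> [x y] [] /=; rewrite !in_itv /= => xc y01 Be.
  have [/= xp yp] := (iB _ _ (xc : band c (x, y)) (open_band_sub pc)).1 Be.
  move: yp => /intrP[n nE].
  have tt : tends (nbhs ((x, y), 0 : R)) (fun z : (R * R) * R => (z.1.1, z.1.2 - n%:~R)) p.
    rewrite [p]surjective_pairing; apply: tends_pair; first by rewrite -xp; tnd.
    by rewrite -[p.2](_ : y - n%:~R = _); [tnd|move/(congr1 (fun z => z + p.2)): nE;
      rewrite subrK => ->; ring].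
  have nV' : nbhs p (V `&` open_band c).
    by apply: filterI => //; apply: open_nbhs_nbhs; split => //; exact: open_band_open.
  have := tt _ nV'; rewrite /= nbhs_simpl /= => H.
  apply: filterS H => -[[x' y'] t'] /= [Vx ox] [] /=; rewrite !in_itv /= => x'c _.
  exists (x', y' - n%:~R); first by [].
  by rewrite -mulrNz; exact: (annulus_int _ _ aB).
have h3 := near_prodr (0 : R) h1.
have h4 : \forall z \near (0 : R, B p), (B @` (V `&` open_band c)) z.2.
  apply: filterS2 h2 h3 => -[t z] /= H [x xo xz].
  have : (B @` band c) z by exists x => //; exact: open_band_sub.
  by rewrite -band_box_image// => -[x' x'D x'z]; exact: H x'z.
have nt : tends (nbhs (B p)) (fun z => (0 : R, z)) (0 : R, B p) by tnd.
exact: nt _ h4.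
Qed.

(** Each [Psi x] lifts a homeomorphism of the circle. Such shapes form a convex set and are stable
    under conjugation by a lift of a circle homeomorphism, which shear-like shapes [y + f x] are
    not. *)
Definition profile c (Psi : R -> R -> R) :=
  [/\ continuous (fun p : R * R => Psi p.1 p.2),
      forall x y z, y < z -> Psi x y < Psi x z,
      forall x y, Psi x (y + 1) = Psi x y + 1,
      forall y, Psi (- c) y = y & forall y, Psi c y = y + 1].

Definition twist B c (Psi : R -> R -> R) (z : S) : S :=
  if pselect (exists p, band c p /\ B p = z) is left h
  then let p := sval (cid h) in B (p.1, Psi p.1 p.2) else z.

Lemma profile_int c Psi x y (n : int) : profile c Psi -> Psi x (y + n%:~R) = Psi x y + n%:~R.
Proof.
move=> [_ _ h _ _].
have h' u : Psi x (u + 1) - (u + 1) = Psi x u - u by rewrite h; ring.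
have := @periodic_int _ _ (fun u => Psi x u - u) 1 h' y n.
by rewrite mulr1 => e; rewrite -[LHS](subrK (y + n%:~R)) e; ring.
Qed.

Lemma twist_band B c Psi p :
  annulus c B -> (forall x y (n : int), Psi x (y + n%:~R) = Psi x y + n%:~R) -> band c p ->
  twist B c Psi (B p) = B (p.1, Psi p.1 p.2).
Proof.
move=> aB hP pc; rewrite /twist; case: pselect => [h|[]]; last by exists p.
case: (cid h) => q [qc qp] /=.
have [_ _ iB _] := aB.
have [e1 e2] := (iB _ _ qc pc).1 qp.
rewrite e1; move: e2 => /intrP[n nE].
have -> : q.2 = p.2 + n%:~R by rewrite -nE; ring.
by rewrite hP; exact: (annulus_int _ _ aB).
Qed.

Lemma twist_out B c Psi z : ~ (B @` band c) z -> twist B c Psi z = z.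
Proof.
move=> h; rewrite /twist; case: pselect => // -[p [pc pz]].
by exfalso; apply: h; exists p.
Qed.

Lemma twist_fix B c Psi z : annulus c B ->
  (forall x y (n : int), Psi x (y + n%:~R) = Psi x y + n%:~R) ->
  (forall y, Psi (- c) y = y) -> (forall y, Psi c y = y + 1) ->
  ~ (B @` open_band c) z -> twist B c Psi z = z.
Proof.
move=> aB hP h1 h2 nz; have [[p pc pz]|] := pselect ((B @` band c) z); last exact: twist_out.
rewrite -pz twist_band//; case: p pc pz => x y /= xc pz.
have := xc; rewrite /band /= => /andP[xc1 xc2].
have [xe|xe] := eqVneq x (- c); first by rewrite xe h1.
have [xe'|xe'] := eqVneq x c.
  by rewrite xe' h2; apply: (annulus_int y 1 aB); move: xc; rewrite /band /= xe'.
exfalso; apply: nz; exists (x, y) => //; rewrite /open_band /=.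
by rewrite !lt_neqAle xc1 xc2 xe' eq_sym xe.
Qed.

(** The second alternative leaves out monotonicity: interpolations of profiles are considered for
    all real times, and outside the unit interval they may fail to be increasing. *)
Lemma twist_family_continuous B c (Psi : R -> R -> R -> R) : annulus c B ->
  continuous (fun p : R * (R * R) => Psi p.1 p.2.1 p.2.2) ->
  (forall t, profile c (Psi t) \/ (forall x y (n : int), Psi t x (y + n%:~R) = Psi t x y + n%:~R) /\
    (forall y, Psi t (- c) y = y) /\ (forall y, Psi t c y = y + 1)) ->
  continuous (fun p : R * S => twist B c (Psi p.1) p.2).
Proof.
move=> aB cPsi hPsi0; have [c0 cB iB oB] := aB.
have hPsi t : (forall x y (n : int), Psi t x (y + n%:~R) = Psi t x y + n%:~R) /\
    (forall y, Psi t (- c) y = y) /\ (forall y, Psi t c y = y + 1).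
  case: (hPsi0 t) => // pr; split; first by move=> x y n; exact: profile_int pr.
  by case: pr.
apply: (@continuous_descend2 _ _ _ _ _ (`[- c, c] `*` `[0 : R,
  1]) (~` (B @` open_band c)) B id) => //.
- exact: band_box_compact.
- by apply: subclosed_compact cS _ => //; exact: open_closedC.
- apply: continuous_subspaceW cB => -[x y] [/=].
  by rewrite !in_itv.
- by apply: continuous_subspaceT => x; exact: cvg_id.
- apply/seteqP; split => // z _; rewrite band_box_image// image_id.
  by have [[p pc pz]|h] := pselect ((B @` open_band c) z); [left; exists p => //;
    exact: open_band_sub|right].
- move=> t [x y] [] /=; rewrite !in_itv /= => xc yc.
  have band1 : band c (x, Psi t x y) by [].
  rewrite twist_band//; [|exact: (hPsi t).1].
  apply: (tends_near_eq (g := fun z => B (z.1.1, Psi z.2 z.1.1 z.1.2))).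
    apply: filterS (near_within_mem _ _) => -[[x' y'] t'] [] /=; rewrite !in_itv /= => x'c _.
    by rewrite twist_band//; exact: (hPsi t').1.
  apply: (tends_within cB) => //.
    apply: tends_pair; first by tnd; exact: tends_idw.
    apply: (tends_at (h := fun p : R * (R * R) => Psi p.1 p.2.1 p.2.2) (f := fun z =>
      (z.2, z.1)) (a := (t, (x, y)))).
      by tnd; exact: tends_idw.
    exact: cPsi.
  by apply: filterS (near_within_mem _ _) => -[[x' y'] t'] [] /=; rewrite !in_itv.
- move=> t x Dx; have fix1 t' z : ~ (B @` open_band c) z -> twist B c (Psi t') z = z.
    by move=> nz; have [h1 [h2 h3]] := hPsi t'; exact: twist_fix.
  rewrite /= fix1//.
  apply: (tends_near_eq (g := fun z => z.1)).
    by apply: filterS (near_within_mem _ _) => -[z t'] /= nz; rewrite fix1.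
  by apply: tends_fstp; exact: tends_idw.
Qed.

Lemma profile_surj c Psi x v : profile c Psi -> exists y, Psi x y = v.
Proof.
move=> pr; have [cP mP _ _ _] := pr.
pose n := Num.floor (v - Psi x 0).
have /andP[h1 h2] := floor_itv (v - Psi x 0); rewrite -/n in h1 h2.
rewrite intrD in h2.
have e1 : Psi x n%:~R = Psi x 0 + n%:~R by rewrite -[n%:~R]add0r (profile_int _ _ _ pr) add0r.
have e2 : Psi x (n + 1)%:~R = Psi x 0 + n%:~R + 1.
  by case: (pr) => _ _ dP _ _; rewrite intrD -[1%:~R]/(1) dP e1.
have le : Psi x n%:~R <= Psi x (n + 1)%:~R by rewrite e1 e2 lerDl.
have [|||y _ <-] := @IVT R (Psi x) n%:~R (n + 1)%:~R v.
- by rewrite ler_int lerDl.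
- apply: continuous_subspaceT; cts y.
  apply: (tends_at (h := fun p : R * R => Psi p.1 p.2) (f := fun z => (x, z)) (a := (x, y))).
    by tnd.
  exact: cP.
- by rewrite min_l// max_r// e1 e2; apply/andP; split; lra.
by exists y.
Qed.

Lemma twist_inj B c Psi : annulus c B -> profile c Psi -> injective (twist B c Psi).
Proof.
move=> aB pr; have [c0 cB iB oB] := aB; have [cP mP _ _ _] := pr.
have hP x y n := profile_int x y n pr.
have tb p : band c p -> twist B c Psi (B p) = B (p.1, Psi p.1 p.2) by exact: twist_band.
have inj x y z : Psi x y = Psi x z -> y = z.
  by move=> e; case: (ltgtP y z) => // /(mP x); rewrite e ltxx.
move=> z z'.
have [[p pc <-]|nz] := pselect ((B @` band c) z);
have [[p' pc' <-]|nz'] := pselect ((B @` band c) z').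
- rewrite !tb// => /iB -/(_ pc pc') [/= e1] /intrP[n nE].
  apply/iB => //; split => //.
  have : Psi p'.1 p.2 = Psi p'.1 (p'.2 + n%:~R) by rewrite hP -nE e1; ring.
  by move=> /inj ->; rewrite addrC addKr rpred_int.
- rewrite tb// (twist_out _ nz') => e; exfalso; apply: nz'; rewrite -e.
  by exists (p.1, Psi p.1 p.2).
- rewrite tb// (twist_out _ nz) => e; exfalso; apply: nz; rewrite e.
  by exists (p'.1, Psi p'.1 p'.2).
- by rewrite !twist_out.
Qed.

Lemma twist_surj B c Psi z : annulus c B -> profile c Psi -> exists z', twist B c Psi z' = z.
Proof.
move=> aB pr.
have [[[x y] pc <-]|nz] := pselect ((B @` band c) z); last by exists z; exact: twist_out.
have [y' yE] := profile_surj x y pr.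
exists (B (x, y')); rewrite twist_band ?yE// => u v n; exact: profile_int pr.
Qed.

Lemma twist_continuous B c Psi : annulus c B -> profile c Psi -> continuous (twist B c Psi).
Proof.
move=> aB pr z; apply: tends_cts.
apply: (tends_at (h := fun p : R * S => twist B c Psi p.2) (f := fun z => (0, z)) (a := (0, z))).
  by tnd.
apply: (@twist_family_continuous B c (fun=> Psi)) => //.
  case: pr => cP _ _ _ _ p; apply: tends_cts.
  apply: (tends_at (h := fun p : R * R => Psi p.1 p.2) (f := fun p => p.2)); last exact: cP.
  by tnd.
by left.
Qed.

Lemma twist_homeomorphism B c Psi : annulus c B -> profile c Psi -> homeomorphism (twist B c Psi).
Proof.
move=> aB pr; apply: homeomorphism_bij => //; first exact: twist_continuous.
  exact: twist_inj.
by move=> y; exact: twist_surj.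
Qed.

(** Profiles form a convex set, so the straight-line interpolation is an isotopy of twists. *)
Lemma twist_isotopic B c Psi Psi' : annulus c B -> profile c Psi -> profile c Psi' ->
  isotopic R (twist B c Psi) (twist B c Psi').
Proof.
move=> aB pr pr'; have [cP mP dP nP pP] := pr; have [cP' mP' dP' nP' pP'] := pr'.
pose Q (t x y : R) := (1 - t) * Psi x y + t * Psi' x y.
have cQ : continuous (fun p : R * (R * R) => Q p.1 p.2.1 p.2.2).
  move=> p; apply: tends_cts; rewrite /Q.
  have h : tends (nbhs p) (fun p : R * (R * R) => p.2) p.2 by tnd.
  have h1 := tends_at (h := fun p : R * R => Psi p.1 p.2) h (cP p.2).
  have h2 := tends_at (h := fun p : R * R => Psi' p.1 p.2) h (cP' p.2).
  apply: tendsD; apply: tendsM; by [exact: h1|exact: h2|tnd].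
have prQ t : 0 <= t <= 1 -> profile c (Q t).
  move=> /andP[t0 t1]; split.
  - move=> p; apply: tends_cts.
    apply: (tends_at (h := fun p : R * (R * R) => Q p.1 p.2.1 p.2.2) (f := fun p =>
      (t, p)) (a := (t, p))).
      by tnd.
    exact: cQ.
  - move=> x y z yz; rewrite /Q; have h := mP x y z yz; have h' := mP' x y z yz.
    have [->|tn] := eqVneq t 0; first by rewrite subr0 !mul1r !mul0r !addr0.
    have t0' : 0 < t by rewrite lt_neqAle eq_sym tn.
    by apply: ler_ltD; [apply: ler_wpM2l; [rewrite subr_ge0|exact: ltW]|rewrite ltr_pM2l].
  - by move=> x y; rewrite /Q dP dP'; ring.
  - by move=> y; rewrite /Q nP nP'; ring.
  - by move=> y; rewrite /Q pP pP'; ring.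
apply: (@isotopicI _ _ cS hS (fun p => twist B c (Q p.1) p.2)).
- apply: twist_family_continuous => // t; right; split; last split.
  + by move=> x y n; rewrite /Q (profile_int _ _ _ pr) (profile_int _ _ _ pr'); ring.
  + by move=> y; rewrite /Q nP nP'; ring.
  + by move=> y; rewrite /Q pP pP'; ring.
- by move=> t t01; exact: (twist_inj aB (prQ t t01)).
- by move=> t t01 y; exact: (twist_surj y aB (prQ t t01)).
- move=> z; congr (twist B c _ z); apply/funext => x; apply/funext => y.
  by rewrite /Q /=; ring.
- move=> z; congr (twist B c _ z); apply/funext => x; apply/funext => y.
  by rewrite /Q /=; ring.
Qed.
End Annulus.

(** * Lifts between parametrisations of one circle *)

Section CircleLift.
Variables (R : realType) (S : topologicalType).
Hypothesis hS : hausdorff_space S.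
Implicit Types (c : R -> S) (y z : R) (n : int).

Definition circle_param c := continuous c /\ forall s t, c s = c t <-> s - t \is a Num.int.

Definition circle_lift c1 c2 (phi : R -> R) n :=
  [/\ continuous phi, forall y, c1 y = c2 (phi y) & forall y, phi (y + 1) = phi y + n%:~R].

(** Read as a loop in the unit circle of the plane, the change of parameter has polar coordinates by
    [winds_exists]; their angle is the lift and their winding number is its degree. *)
Lemma circle_lift_exists c1 c2 : circle_param c1 -> circle_param c2 ->
  range c1 `<=` range c2 -> exists phi n, circle_lift c1 c2 phi n.
Proof.
move=> [cc1 p1] [cc2 p2] r12.
have /choice [z zE] : forall y, exists z, c2 z = c1 y.
  by move=> y; have [|x _ <-] := r12 (c1 y); [exists y|exists x].
have pi2 := pi2_gt0 R; have pi2n : 2 * pi != 0 :> R by rewrite gt_eqF.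
pose e (u : R) : R * R := circle_pt 0 1 (2 * pi * u).
have e_int u v : u - v \is a Num.int -> e u = e v.
  move=> /intrP[n nE]; rewrite /e -[RHS](circle_pt_period _ _ _ n); congr circle_pt.
  by rewrite -nE; ring.
have ce : continuous e by rewrite /e /circle_pt; cts u.
pose g s := e (z (s / (2 * pi))).
(* The chosen parameter [z] may jump by integers; the exponential [e] forgets these jumps. *)
have cez : continuous (fun y => e (z y)).
  move=> y0 U nU.
  have nD : \forall w \near ((0 : R), c1 y0), forall x, `[0 : R, 1]%classic x -> c2 x = w.2 ->
      (fun _ w => forall y, c1 y = w -> U (e (z y))) w.1 w.2.
    apply: (@near_descend _ _ _ `[0 : R, 1]%classic c2 (0 : R) (c1 y0) (fun _ w =>
      forall y, c1 y = w -> U (e (z y)))) => //; first exact: segment_compact.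
      exact: continuous_subspaceT.
    move=> x _ xE.
    have ex : e x = e (z y0) by apply: e_int; apply/p2; rewrite xE zE.
    have : \forall x' \near x, U (e x') by apply: (ce x); rewrite ex.
    move=> /(near_prodl (0 : R)); apply: filterS => -[x' t'] /= Ux' _ y yE.
    by rewrite (e_int _ x')//; apply/p2; rewrite zE.
  have t1 : tends (nbhs y0) (fun y => (0 : R, c1 y)) (0 : R, c1 y0).
    by tnd; exact: cc1.
  have : \forall y \near y0, forall x, `[0 : R, 1]%classic x -> c2 x = c1 y ->
      (forall y', c1 y' = c1 y -> U (e (z y'))) by exact: (t1 _ nD).
  move=> H; suff : \forall y \near y0, U (e (z y)) by [].
  apply: filterS H => y /= H.
  have [x [m [x0 x1 xE]]] := period_reduce (z y) (@ltr01 R).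
  apply: (H x) => //=; first by rewrite in_itv /= x0.
  by rewrite -zE; apply/p2; rewrite xE mulr1 opprD addrA subrr add0r rpredN rpred_int.
have cg : continuous g.
  move=> s; apply: tends_cts.
  apply: (tends_at (h := fun y => e (z y)) (f := fun s => s / (2 * pi))); last exact: cez.
  by tnd.
have [||n [rho [th [[cr ct] r0 thE gE]]]] := winds_exists (q := 0) cg.
- move=> s; apply: e_int; apply/p2; rewrite !zE; apply/p1.
  by rewrite mulrDl divff// addrC addKr rpred1.
- by move=> s; apply/eqP => /circle_pt_eq0 /eqP; rewrite oner_eq0.
exists (fun y => th (2 * pi * y) / (2 * pi)), n; split.
- by cts y; by [exact: ct|exact: pi2n].
- move=> y; rewrite -zE; apply/p2.
  have := gE (2 * pi * y); rewrite /g [2 * pi * y / _]mulrAC divff// mul1r.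
  move=> /circle_pt_inj[]// _ [k kE].
  have -> : z y = 2 * pi * z y / (2 * pi) by rewrite [2 * pi * _]mulrC mulfK.
  by rewrite kE mulrDl mulfK// addrC addKr rpred_int.
- by move=> y; rewrite mulrDr mulr1 (thE _).2 mulrDl mulfK.
Qed.

Lemma circle_lift_inj c1 c2 phi n y z : circle_param c1 -> circle_param c2 ->
  circle_lift c1 c2 phi n -> phi y - phi z \is a Num.int -> y - z \is a Num.int.
Proof. by move=> [_ p1] [_ p2] [_ h _] /p2; rewrite -!h => /p1. Qed.

(** Injectivity modulo integers against the intermediate value theorem: in degree 0 some value is
    taken on both halves of the period, and in degree of absolute value above 1 a translate of the
    initial value is reached too early. *)
Lemma circle_lift_degree c1 c2 phi n : circle_param c1 -> circle_param c2 ->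
  circle_lift c1 c2 phi n -> n = 1 \/ n = -1.
Proof.
move=> p1 p2 L; have [cphi hphi dphi] := L.
have iphi y z := @circle_lift_inj _ _ _ _ y z p1 p2 L.
have small (y : R) : 0 <= y <= 1 -> y \is a Num.int -> y = 0 \/ y = 1.
  move=> /andP[y0 y1] /intrP[m mE].
  have m0 : 0 <= m by rewrite -(@ler_int R) -mE.
  have m1 : m <= 1 by rewrite -(@ler_int R) -mE.
  by rewrite mE; case: m m0 m1 {mE} => [[|[|m]]|m] // _ _; [left|right].
have p01 : phi 1 = phi 0 + n%:~R by rewrite -dphi add0r.
have cw (a b : R) : {within `[a, b], continuous phi} by exact: continuous_subspaceT.
have n0 : n <> 0.
  move=> n0; rewrite n0 addr0 in p01.
  have h12 : phi 2^-1 <> phi 0.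
    move=> e; have i2 : 2^-1 \is a @Num.int R.
      by rewrite -[_^-1]subr0; apply: iphi; rewrite e subrr rpred0.
    have b2 : 0 <= (2^-1 : R) <= 1 by apply/andP; split; lra.
    by case: (small _ b2 i2); lra.
  pose v := (phi 0 + phi 2^-1) / 2.
  have vv : Num.min (phi 0) (phi 2^-1) <= v <= Num.max (phi 0) (phi 2^-1).
    by rewrite /v; case: (leP (phi 0) (phi 2^-1)) => h; apply/andP; split; lra.
  have [|a + aE] := @IVT R phi 0 2^-1 v _ (cw _ _) vv; first by lra.
  have vv' : Num.min (phi 2^-1) (phi 1) <= v <= Num.max (phi 2^-1) (phi 1).
    by rewrite p01 minC maxC.
  have [|b + bE] := @IVT R phi 2^-1 1 v _ (cw _ _) vv'; first by lra.
  rewrite !in_itv /= => /andP[b1 b2] /andP[a1 a2].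
  have ba : b - a \is a Num.int by apply: iphi; rewrite aE bE subrr rpred0.
  case: (small _ _ ba) => [|h|h]; first by apply/andP; split; lra.
    have ae : a = 2^-1 by lra.
    by apply: h12; move: aE; rewrite /v ae; lra.
  have ae : a = 0 by lra.
  by apply: h12; move: aE; rewrite /v ae; lra.
(* Here [m] is the sign of [n]. The value [phi 0 + m] is reached at some [y] of the unit segment,
   and [y] has to be an integer; [y = 0] is absurd and [y = 1] gives [n = m]. *)
have ge2 (m : int) : (m = 1 \/ m = -1) -> (0 < n * m) -> n = m.
  move=> m1 nm; apply: contrapT => nem.
  have [|y + yE] := @IVT R phi 0 1 (phi 0 + m%:~R) ler01 (cw _ _).
    rewrite p01; case: m1 nm nem => ->.
      rewrite mulr1 => n1 _; have h : 1 <= n%:~R :> R by rewrite ler1z -gtz0_ge1.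
      by rewrite min_l ?max_r; lra.
    rewrite mulrN1 oppr_gt0 => n1 _; have h : n%:~R <= -1 :> R.
      by rewrite -[-1]/((-1)%:~R) ler_int; move: n1; case: (n) => // k; rewrite ltNge.
    by rewrite -[(-1)%:~R]/(-1) min_r ?max_l; lra.
  rewrite in_itv /= => y01.
  have yint : y \is a Num.int.
    by rewrite -[y]subr0; apply: iphi; rewrite yE addrC addKr rpred_int.
  case: (small _ y01 yint) => h; move: yE; rewrite h ?p01 => /eqP.
    by rewrite -subr_eq0 opprD addNKr oppr_eq0 intr_eq0 => /eqP e; case: m1 => e1; rewrite e1 in e.
  by move=> /eqP /addrI /intr_inj.
have [h|h|//] := ltgtP n 0.
  by right; apply: ge2; [right|rewrite mulrN1 oppr_gt0].
by left; apply: ge2; [left|rewrite mulr1].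
Qed.

Lemma circle_lift_mono c1 c2 phi : circle_param c1 -> circle_param c2 ->
  circle_lift c1 c2 phi 1 -> forall y z, y < z -> phi y < phi z.
Proof.
move=> p1 p2 L; have [cphi hphi dphi] := L.
have iphi y z : phi y = phi z -> y = z.
  move=> e; have : y - z \is a Num.int by apply: (circle_lift_inj p1 p2 L); rewrite e subrr rpred0.
  move=> /intrP[m mE].
  have h' u : phi (u + 1) - (u + 1) = phi u - u by rewrite dphi; ring.
  have := @periodic_int _ _ (fun u => phi u - u) 1 h' z m.
  have -> : z + m%:~R * 1 = y by rewrite -mE; ring.
  by rewrite e => /addrI /oppr_inj.
have : {in `]-oo, +oo[ &, {mono phi : x y / x <= y}}.
  apply: itv_continuous_inj_le.
  - by exists 0, 1; rewrite !in_itv /= ltr01; split=> //; rewrite -[1]add0r dphi lerDl.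
  - exact: continuous_subspaceT.
  - by move=> x y _ _; exact: iphi.
by move=> m y z; rewrite !ltNge m ?in_itv.
Qed.

(** Any lift in the reverse direction inverts [phi] up to an integer, which is constant by
    continuity and can be subtracted. *)
Lemma circle_lift_inverse c1 c2 phi : circle_param c1 -> circle_param c2 ->
  range c2 `<=` range c1 -> circle_lift c1 c2 phi 1 ->
  exists psi, [/\ circle_lift c2 c1 psi 1, forall y, phi (psi y) = y & forall y, psi (phi y) = y].
Proof.
move=> p1 p2 r21 L; have [cphi hphi dphi] := L.
have mphi := circle_lift_mono p1 p2 L.
have iphi y z : phi y = phi z -> y = z.
  by move=> e; case: (ltgtP y z) => // /mphi; rewrite e ltxx.
have [psi0 [n [cpsi hpsi dpsi]]] := circle_lift_exists p2 p1 r21.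
have Z y : exists k : int, phi (psi0 y) - y = k%:~R.
  by apply/intrP; case: p2 => _ p2; apply/p2; rewrite -hphi -hpsi.
have [k kE] := Z 0.
have cst y : phi (psi0 y) - y = k%:~R.
  rewrite -kE; apply: (@int_valued_constant _ (fun y => phi (psi0 y) - y)) => //.
  by cts u; [exact: cpsi|exact: cphi].
have phiN y (m : int) : phi (y - m%:~R) = phi y - m%:~R.
  have h' u : phi (u + 1) - (u + 1) = phi u - u by rewrite dphi; ring.
  have e := @periodic_int _ _ (fun u => phi u - u) 1 h' y (- m).
  rewrite mulr1 mulrNz in e.
  by rewrite -[LHS](subrK (y - m%:~R)) e; ring.
pose psi y := psi0 y - k%:~R.
have psiK y : phi (psi y) = y by rewrite /psi phiN -(cst y); ring.
have psiK' y : psi (phi y) = y by apply: iphi; rewrite psiK.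
exists psi; split => //; split.
- by rewrite /psi; cts y; exact: cpsi.
- by move=> y; rewrite hphi psiK.
- by move=> y; apply: iphi; rewrite dphi !psiK.
Qed.
End CircleLift.

(** * Sides of an oriented curve *)

Section Sides.
Variable R : realType.
Implicit Types (p q : R * R) (s t r a b : R) (n m d e : int) (g : R -> R * R).

Lemma stay_between (f : R -> R) a b al be : continuous f -> a < b -> al < be ->
  f a = al -> f b = be -> (forall s, a < s < b -> f s != al /\ f s != be) ->
  forall s, a < s < b -> al < f s < be.
Proof.
move=> cf ab albe fa fb ne s /[dup] sab /andP[as_ sb].
have cw u v : {within `[u, v], continuous f} by exact: continuous_subspaceT.
have [n1 n2] := ne s sab.
apply/andP; split; rewrite ltNge; apply/negP => h.
  have h' : f s < al by rewrite lt_neqAle n1.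
  have [|c] := @IVT R f s b al (ltW sb) (cw _ _).
    by rewrite fb min_l ?max_r; [apply/andP; split; lra|lra|lra].
  rewrite in_itv /= => /andP[c1 c2] fc.
  have cb : c != b by apply/eqP => cb; move: fc; rewrite cb fb; lra.
  have : a < c < b by apply/andP; split; [lra|rewrite lt_neqAle cb].
  by move=> /ne[]; rewrite fc eqxx.
have h' : be < f s by rewrite lt_neqAle eq_sym n2.
have [|c] := @IVT R f a s be (ltW as_) (cw _ _).
  by rewrite fa min_l ?max_r; [apply/andP; split; lra|lra|lra].
rewrite in_itv /= => /andP[c1 c2] fc.
have ca : c != a by apply/eqP => ca; move: fc; rewrite ca fa; lra.
have : a < c < b by apply/andP; split; [rewrite lt_neqAle eq_sym ca|lra].
by move=> /ne[_]; rewrite fc eqxx.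
Qed.

Lemma not_skip (f : R -> R) a b (v : R) : continuous f -> a < b ->
  (f a < v < f b \/ f b < v < f a) -> (forall s, a < s < b -> f s != v) -> False.
Proof.
move=> cf ab h ne.
have [|c] := @IVT R f a b v (ltW ab) (continuous_subspaceT cf).
  case: h => /andP[h1 h2].
    by rewrite min_l ?max_r; [apply/andP; split; lra|lra|lra].
  by rewrite min_r ?max_l; [apply/andP; split; lra|lra|lra].
rewrite in_itv /= => /andP[c1 c2] fc.
have ca : c != a by apply/eqP => ca; move: h fc; rewrite ca => -[]/andP[]; lra.
have cb : c != b by apply/eqP => cb; move: h fc; rewrite cb => -[]/andP[]; lra.
have : a < c < b by rewrite !lt_neqAle c1 c2 cb eq_sym ca.
by move=> /ne; rewrite fc eqxx.
Qed.

Lemma cos_pihalf_int n : cos (pi / 2 + n%:~R * pi) = 0 :> R.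
Proof.
have := @periodic_int R R (fun s => cos s ^+ 2) pi _ (pi / 2) n.
rewrite cos_pihalf => /(_ _)/eqP.
rewrite expr0n /= sqrf_eq0 => H; apply/eqP; apply: H => s.
by rewrite cosDpi sqrrN.
Qed.

(** The loop meets the vertical line through [q] only at its lowest and highest parameter. Winding
    once and positively forces the angle to stay between consecutive odd multiples of pi/2 on each
    half, hence the right half to stay on the right. *)
Lemma winds_sides q g : winds q g 1 ->
  (g (- (pi / 2))).1 = q.1 -> (g (- (pi / 2))).2 < q.2 ->
  (g (pi / 2)).1 = q.1 -> q.2 < (g (pi / 2)).2 ->
  (forall s, - (pi / 2) < s < pi / 2 -> (g s).1 != q.1) ->
  (forall s, pi / 2 < s < 3 / 2 * pi -> (g s).1 != q.1) ->
  q.1 < (g 0).1 /\ (g pi).1 < q.1.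
Proof.
move=> [rho [th0 [[cr cth0] r0 thE0 gE0]]] gd1 gd2 gu1 gu2 hr hl.
have pi0 := @pi_gt0 R.
have trig s : (g s).1 - q.1 = rho s * cos (th0 s) /\ (g s).2 - q.2 = rho s * sin (th0 s).
  by rewrite gE0 /circle_pt /=; split; ring.
have cos0 s : ((g s).1 == q.1) = (cos (th0 s) == 0).
  by rewrite -subr_eq0 (trig s).1 mulf_eq0 gt_eqF.
have sgnu s (e : R) : cos (th0 s) = 0 -> 0 < e * sin (th0 s) -> e ^+ 2 = 1 -> sin (th0 s) = e.
  move=> c h e1; have := cos2Dsin2 (th0 s); rewrite c expr0n /= add0r => h2.
  have /eqP : (sin (th0 s) - e) * (sin (th0 s) + e) = 0 by rewrite -subr_sqr h2 e1 subrr.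
  rewrite mulf_eq0 subr_eq0 addr_eq0 => /orP[/eqP//|/eqP se].
  by move: h; rewrite se mulrN -expr2 e1 ltr0N1.
have [m mE] : exists m : int, th0 (- (pi / 2)) = - (pi / 2) + m%:~R * (2 * pi).
  have c0 : cos (th0 (- (pi / 2))) = 0 by apply/eqP; rewrite -cos0 gd1.
  apply: cos_sin_eq; rewrite ?cosN ?sinN ?cos_pihalf ?sin_pihalf//.
  apply: sgnu => //; last by rewrite sqrrN expr1n.
  rewrite mulN1r oppr_gt0 -(pmulr_rlt0 _ (r0 (- (pi / 2)))) -(trig _).2; lra.
have [j' jE'] : exists m : int, th0 (pi / 2) = pi / 2 + m%:~R * (2 * pi).
  have c0 : cos (th0 (pi / 2)) = 0 by apply/eqP; rewrite -cos0 gu1.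
  apply: cos_sin_eq; rewrite ?cos_pihalf ?sin_pihalf//.
  apply: sgnu => //; last by rewrite expr1n.
  by rewrite mul1r -(pmulr_rgt0 _ (r0 (pi / 2))) -(trig _).2; lra.
pose th s := th0 s - m%:~R * (2 * pi).
have cth : continuous th by rewrite /th; cts s; exact: cth0.
have cosE s : cos (th s) = cos (th0 s).
  by rewrite -[RHS](cosD2pi_int _ (- m)) mulrNz mulNr.
have th1 : th (- (pi / 2)) = - (pi / 2) by rewrite /th mE; ring.
pose j := j' - m.
have th2 : th (pi / 2) = pi / 2 + j%:~R * (2 * pi) by rewrite /th jE' /j intrB; ring.
have th3 : th (3 / 2 * pi) = 3 / 2 * pi.
  have -> : 3 / 2 * pi = - (pi / 2) + 2 * pi :> R by field.
  by rewrite /th (thE0 _).2 mE; ring.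
have nr s n : - (pi / 2) < s < pi / 2 -> th s != pi / 2 + n%:~R * pi.
  move=> hs; apply/eqP => e; have := hr s hs.
  by rewrite cos0 -cosE e cos_pihalf_int eqxx.
have nl s n : pi / 2 < s < 3 / 2 * pi -> th s != pi / 2 + n%:~R * pi.
  move=> hs; apply/eqP => e; have := hl s hs.
  by rewrite cos0 -cosE e cos_pihalf_int eqxx.
have ab1 : - (pi / 2) < pi / 2 :> R by lra.
have ab2 : pi / 2 < 3 / 2 * pi :> R by lra.
(* Any additional turn would make the angle cross an odd multiple of pi/2 inside one of the two open
   arcs, where the loop does not meet the vertical line. *)
have j0 : j = 0.
  case: (ltgtP j 0) => // hj.
    have hj' : j%:~R <= -1 :> R by rewrite -[-1]/((-1)%:~R) ler_int; move: hj; case: (j) => // k;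
      rewrite ltNge.
    exfalso; apply: (@not_skip th _ _ (pi / 2 + (-1)%:~R * pi) cth ab2).
      by left; rewrite th2 th3 -[(-1)%:~R]/(-1); apply/andP; split; nra.
    by move=> s hs; exact: nl.
  have hj' : 1 <= j%:~R :> R by rewrite ler1z -gtz0_ge1.
  exfalso; apply: (@not_skip th _ _ (pi / 2 + 0%:~R * pi) cth ab1).
    by left; rewrite th1 th2 -[0%:~R]/(0); apply/andP; split; nra.
  by move=> s hs; exact: nr.
rewrite j0 mul0r addr0 in th2.
have s1 := stay_between cth ab1 ab1 th1 th2.
have s2 := stay_between cth ab2 ab2 th2 th3.
have h0 : - (pi / 2) < (0 : R) < pi / 2 by apply/andP; split; lra.
have hp : pi / 2 < (pi : R) < 3 / 2 * pi by apply/andP; split; lra.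
split.
  rewrite -subr_gt0 (trig _).1 pmulr_rgt0// -cosE; apply: cos_gt0_pihalf.
  apply: s1 => // s hs; split.
    by have := nr s (-1) hs; rewrite (_ : _ + _ = - (pi / 2))// -[(-1)%:~R]/(-1); field.
  by have := nr s 0 hs; rewrite mul0r addr0.
rewrite -subr_lt0 (trig _).1 pmulr_rlt0// -cosE -oppr_gt0.
have -> : - cos (th pi) = cos (th pi - pi).
  by rewrite -[in LHS](subrK pi (th pi)) cosDpi opprK.
apply: cos_gt0_pihalf.
have /andP[h1 h2] : pi / 2 < th pi < 3 / 2 * pi.
  apply: s2 => // s hs; split.
    by have := nl s 0 hs; rewrite mul0r addr0.
  by have := nl s 1 hs; rewrite mul1r (_ : _ + _ = 3 / 2 * pi)//; field.
by apply/andP; split; lra.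
Qed.
End Sides.

Section RelativeDegree.
Variables (R : realType) (S : topologicalType) (O : set (R * R -> S)).
Hypothesis orO : orientation O.

(** Two signs at one point of the surface are compared by a map [k] of the plane, whose local degree
    is an honest winding number. *)
Lemma relative_degree K L (k : R * R -> R * R) (p : R * R) d1 e1 r0 rL :
  0 < r0 -> 0 < rL -> emb_disc K p r0 -> emb_disc k p r0 -> emb_disc L (k p) rL ->
  (forall x, disc p r0 x -> K x = L (k x)) ->
  has_sign O K p d1 -> has_sign O L (k p) e1 ->
  \forall r \near 0^'+, exists d, winds (k p) (fun s => k (circle_pt p r s)) d /\ d1 = d * e1.
Proof.
move=> r00 rL0 eK [ck ik] eL Kk sK sL.
have [psi [q [Opsi pq]]] := O_chart orO (L (k p)).
have opsi := O_emb orO Opsi.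
have ipsi : injective psi by case: opsi.
have [R1 [l [/andP[R10 R1L] lq el Ll]]] := chart_lift opsi rL0 eL pq.
have dK : degree_at K psi p q d1 by apply: sK => //; rewrite Kk//; exact: disc_center.
have dL : degree_at L psi (k p) (l (k p)) e1 by rewrite lq; exact: sL.
have := (degree_at_lift e1 ipsi R10 el Ll).1 dL => wl.
have : nbhs p (k @^-1` (disc (k p) R1)).
  by apply: (ck p (disc_center _ r00)); exact: disc_nbhs.
move=> /nbhs_disc [r2 r20 r2U].
near=> r; have /andP[rr0 rr1] : 0 < r < r0 by near: r; exact: near_right_lt.
have /andP[_ rr2] : 0 < r < r2 by near: r; exact: near_right_lt.
have [g [wg Kg _]] : exists g, [/\ winds q g d1, forall s, K (circle_pt p r s) = psi (g s) &
    forall s, disc q 1 (g s)] by near: r; exact: (dK 1 ltr01).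
have dc s : disc p r0 (circle_pt p r s) by rewrite disc_circle ltr_pXn2r// nnegrE ltW.
have dc2 s : disc (k p) R1 (k (circle_pt p r s)).
  by apply: r2U; rewrite disc_circle ltr_pXn2r// nnegrE ltW.
have [|||d wd] := @winds_exists _ (k p) (fun s => k (circle_pt p r s)).
- move=> s; apply: tends_cts; apply: (tends_at (h := k) (f := circle_pt p r)); last exact: ck.
  by rewrite /circle_pt; tnd.
- by move=> s; rewrite circle_pt_period1.
- move=> s; apply/eqP => /ik -/(_ (dc _) (disc_center _ r00)) /circle_pt_eq0.
  by move=> h; rewrite h ltxx in rr0.
exists d; split => //.
have [cl il] := el.
have hR : 0 < R1 / 2 < R1 by apply/andP; split; lra.
have w2 : winds q (fun s => l (k (circle_pt p r s))) (d * e1).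
  rewrite -lq; apply: (winds_mult cl _ hR (wl _ hR) wd dc2) => x dx xp.
  by apply: contra xp => /eqP /il -> //; exact: disc_center.
apply: (winds_uniq (winds_eq wg _) w2) => s.
by apply: ipsi; rewrite -Kg Kk// Ll.
Unshelve. all: by end_near. Qed.
End RelativeDegree.

Section LocalLift.
Variables (R : realType) (S : topologicalType).
Implicit Types (K L : R * R -> S) (p q : R * R).

Definition open_disc_map L q r :=
  forall y V, disc q r y -> nbhs y V -> nbhs (L y) (L @` V).

(** Unlike in [chart_lift], the map [L] is open on a small disc only, as annuli are, and the size of
    the lifted values is controlled by [e]. *)
Lemma local_chart_lift L K p q r0 rL (e : R) : 0 < r0 -> 0 < rL -> 0 < e ->
  emb_disc L q rL -> open_disc_map L q rL -> emb_disc K p r0 -> K p = L q ->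
  exists r k, [/\ 0 < r <= r0, k p = q, emb_disc k p r &
    forall x, disc p r x -> K x = L (k x) /\ disc q e (k x)].
Proof.
move=> r00 rL0 e0 [cL iL] oL [cK iK] KL.
pose m := Num.min rL e.
have m0 : 0 < m by rewrite lt_min rL0.
have mL : disc q m `<=` disc q rL by exact: disc_minl.
have me : disc q m `<=` disc q e by exact: disc_minr.
have : nbhs p (K @^-1` (L @` disc q m)).
  apply: (cK p (disc_center _ r00)); rewrite KL; apply: oL; first exact: disc_center.
  exact: disc_nbhs.
move=> /nbhs_disc [r1 r10 r1U].
pose r := Num.min r1 r0.
have r_gt0 : 0 < r by rewrite lt_min r10.
have s1 : disc p r `<=` disc p r1 by exact: disc_minl.
have s2 : disc p r `<=` disc p r0 by exact: disc_minr.
have [|||x /s1 /r1U [y Wy yK]|k kP] := @local_lift R S L (disc q m) K (disc p r).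
- by move=> y z /mL dy /mL; exact: iL.
- move=> y V Wy nV; apply: oL; first exact: mL.
  by apply: filterI => //; apply: open_nbhs_nbhs; split => //; exact: disc_open.
- by move=> x /s2; exact: cK.
- by exists y.
have kp : k p = q.
  have [Wk Kk _] := kP _ (disc_center p r_gt0).
  by apply: iL; [exact: mL|exact: disc_center|rewrite -Kk].
exists r, k; split => //.
- by rewrite r_gt0 ge_min lexx orbT.
- split=> [x dx|x y dx dy kxy].
    have [_ _] := kP x dx; apply; apply: open_nbhs_nbhs; split => //.
    exact: disc_open.
  apply: iK; [exact: s2|exact: s2|].
  by have [_ -> _] := kP _ dx; have [_ -> _] := kP _ dy; rewrite kxy.
- by move=> x dx; have [/me ? ? _] := kP _ dx.
Qed.

Lemma int_small (x : R) : x \is a Num.int -> -1 < x < 1 -> x = 0.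
Proof.
move=> /intrP[m ->] /andP[h1 h2].
have h1' : -1 < m by rewrite -(@ltr_int R).
have h2' : m < 1 by rewrite -(@ltr_int R).
by case: m h1' h2' {h1 h2} => [[|m]|[|m]] // _ _.
Qed.

Lemma disc_coord p r x : 0 < r -> disc p r x ->
  (- r < x.1 - p.1 < r) /\ (- r < x.2 - p.2 < r).
Proof.
move=> r0; rewrite /disc /=; set a := x.1 - p.1; set b := x.2 - p.2 => h.
have ha : a ^+ 2 < r ^+ 2 by apply: le_lt_trans h; rewrite lerDl sqr_ge0.
have hb : b ^+ 2 < r ^+ 2 by apply: le_lt_trans h; rewrite lerDr sqr_ge0.
by rewrite -!ltr_norml; split; rewrite -(@ltr_pXn2r _ 2)// ?nnegrE ?(ltW r0)// real_normK ?num_real.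
Qed.
End LocalLift.

Section AnnulusLocal.
Variables (R : realType) (S : topologicalType).
Hypotheses (hS : hausdorff_space S).
Implicit Types (A B : R * R -> S) (p q : R * R).

Lemma annulus_emb c B p : annulus c B -> open_band c p ->
  exists r, [/\ 0 < r, disc p r `<=` open_band c & emb_disc B p r].
Proof.
move=> [c0 cB iB oB] pc.
have : nbhs p (open_band c) by apply: open_nbhs_nbhs; split => //; exact: open_band_open.
move=> /nbhs_disc [r1 r10 r1U].
have h4 : 0 < 4^-1 :> R by [].
(* In so small a disc circular coordinates differ by less than 1, so the integer ambiguity of the
   annulus disappears. *)
exists (Num.min r1 4^-1).
have s1 : disc p (Num.min r1 4^-1) `<=` disc p r1 by exact: disc_minl.
have s2 : disc p (Num.min r1 4^-1) `<=` disc p 4^-1 by exact: disc_minr.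
split; [by rewrite lt_min r10|by move=> x /s1 /r1U|split].
  move=> x /s1 /r1U xb.
  have : {within open_band c, continuous B} by apply: continuous_subspaceW cB; exact: open_band_sub.
  rewrite continuous_open_subspace; last exact: open_band_open.
  by apply; rewrite inE.
move=> x y dx dy /iB -/(_ (open_band_sub (r1U _ (s1 _ dx))) (open_band_sub (r1U _ (s1 _ dy)))).
move=> [e1 e2]; rewrite [x]surjective_pairing [y]surjective_pairing e1.
have [_ /andP[x1 x2]] := disc_coord h4 (s2 _ dx).
have [_ /andP[y1 y2]] := disc_coord h4 (s2 _ dy).
have : x.2 - y.2 = 0 by apply: int_small => //; apply/andP; split; lra.
by move=> /subr0_eq ->.
Qed.

Lemma annulus_open_disc c B p r : annulus c B -> disc p r `<=` open_band c ->
  open_disc_map B p r.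
Proof.
move=> aB dr y V /dr yb nV; apply: filterS (annulus_open hS aB yb nV).
by move=> _ [x [Vx _] <-]; exists x.
Qed.

Lemma annulus_core c B : annulus c B -> circle_param (fun y => B (0, y)).
Proof.
move=> aB; have [c0 cB iB oB] := aB; split => [y|s t].
  have [|r [r0 _ [cr _]]] := @annulus_emb c B (0, y) aB.
    by rewrite /open_band /= oppr_lt0 c0.
  apply: tends_cts; apply: (tends_at (h := B) (f := fun y => (0, y)) (a := (0, y))).
    by tnd.
  by apply: cr; exact: disc_center.
have b0 u : band c (0, u) by rewrite /band /= oppr_le0 ltW.
by split=> [/iB -/(_ (b0 _) (b0 _)) [] //|h]; apply/iB.
Qed.

Definition flip (p : R * R) : R * R := (- p.1, - p.2).

Lemma flip_continuous : continuous flip.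
Proof. by rewrite /flip; cts p. Qed.

Lemma flipK : involutive flip.
Proof. by move=> [x y]; rewrite /flip /= !opprK. Qed.

Lemma flip_band c p : band c (flip p) <-> band c p.
Proof.
rewrite /band /flip /=; split => /andP[h1 h2]; apply/andP; split; lra.
Qed.

Lemma flip_open_band c p : open_band c (flip p) <-> open_band c p.
Proof.
rewrite /open_band /flip /=; split => /andP[h1 h2]; apply/andP; split; lra.
Qed.

Lemma annulus_flip c B : annulus c B -> annulus c (B \o flip).
Proof.
move=> [c0 cB iB oB]; split => //.
- apply: within_comp cB; last by move=> p /flip_band.
  apply: continuous_subspaceT; exact: flip_continuous.
- move=> p q /flip_band pb /flip_band qb /=; rewrite (iB _ _ pb qb) /flip /=.
  have e : - p.2 - - q.2 = - (p.2 - q.2) by ring.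
  by rewrite e rpredN; split=> -[e1 e2]; split => //; [exact: oppr_inj|rewrite e1].
- rewrite (_ : _ @` _ = B @` open_band c)//; apply/seteqP; split => _ [p pb <-].
    by exists (flip p) => //; apply/flip_open_band.
  by exists (flip p); [apply/flip_open_band|rewrite /= flipK].
Qed.

Lemma profile_flip (c : R) Psi : profile c Psi -> profile c (fun x y => 1 - Psi (- x) (- y)).
Proof.
move=> [cP mP dP nP pP]; split.
- move=> p; apply: tends_cts; apply: tendsB; first by tnd.
  have H : tends (nbhs p) (fun p : R * R => (- p.1, - p.2)) (- p.1, - p.2) by tnd.
  exact: (tends_at H (cP _)).
- by move=> x y z yz; rewrite ltrD2l ltrN2; apply: mP; rewrite ltrN2.
- move=> x y; have := dP (- x) (- y - 1); rewrite subrK => ->.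
  by rewrite opprD; ring.
- by move=> y; rewrite opprK pP; ring.
- by move=> y; rewrite nP opprK addrC.
Qed.

(** Turning the annulus by half a turn keeps its orientation and reverses its core. The twist stays
    a left twist; the added 1 brings the reflected profile back to the identity on the left edge and
    is absorbed by the period. *)
Lemma twist_flip c B Psi : annulus c B -> profile c Psi ->
  twist B c Psi =1 twist (B \o flip) c (fun x y => 1 - Psi (- x) (- y)).
Proof.
move=> aB pr z; have aBf := annulus_flip aB; have prf := profile_flip pr.
have [[p pc <-]|nz] := pselect ((B @` band c) z).
  rewrite (twist_band aB (fun x y n => profile_int x y n pr) pc).
  have -> : B p = (B \o flip) (flip p) by rewrite /= flipK.
  rewrite (twist_band aBf (fun x y n => profile_int x y n prf)); last exact/flip_band.
  rewrite /flip /= !opprK.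
  have := annulus_int (- (1 - Psi p.1 p.2)) 1 aB pc.
  by move=> <-; congr (B (_, _)); rewrite mulr1z; ring.
rewrite !twist_out// => -[p pc pz]; apply: nz.
by exists (flip p) => //; exact/flip_band.
Qed.
End AnnulusLocal.

(** * Independence of a twist from the chosen annulus *)

Section TwistUnique.
Variables (R : realType) (S : topologicalType) (O : set (R * R -> S)).
Hypotheses (cS : compact [set: S]) (hS : hausdorff_space S) (orO : orientation O).
Implicit Types (A B : R * R -> S) (p q : R * R).

(** Near the core [A] is [B] after a planar map [k]. This [k] carries the core increasingly to the
    core and has winding number 1, both annuli having sign 1, so [winds_sides] tells where the two
    halves of a small circle go. *)
Lemma annulus_sides_local A a B b phi y0 :
  annulus a A -> annulus b B ->
  circle_lift (fun y => A (0, y)) (fun y => B (0, y)) phi 1 ->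
  range (fun y => B (0, y)) `<=` range (fun y => A (0, y)) ->
  has_sign O A (0, y0) 1 -> has_sign O B (0, phi y0) 1 ->
  \forall z \near ((0 : R), y0),
    (0 < z.1 -> exists2 u : R * R, 0 < u.1 < b & A z = B u) /\
    (z.1 < 0 -> exists2 u : R * R, - b < u.1 < 0 & A z = B u).
Proof.
move=> aA aB L rBA sA sB.
have [cphi hphi dphi] := L.
have a0 : 0 < a by case: aA. have b0 : 0 < b by case: aB.
have mphi := circle_lift_mono (annulus_core aA) (annulus_core aB) L.
set p := ((0 : R), y0) in sA *. set q := ((0 : R), phi y0) in sB.
have pA : open_band a p by rewrite /open_band /= oppr_lt0 a0.
have qB : open_band b q by rewrite /open_band /= oppr_lt0 b0.
have [r0 [r00 r0A eA]] := annulus_emb aA pA.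
have [rL [rL0 rLB eB]] := annulus_emb aB qB.
(* The bound 1/2 makes the lift choose the same sheet as [phi], the bound [b] keeps it in the
   band. *)
pose e := Num.min 2^-1 b.
have e0 : 0 < e by rewrite lt_min b0 andbT.
have e2 : e <= 2^-1 by rewrite ge_min lexx.
have eb : e <= b by rewrite ge_min lexx orbT.
have [r [k [/andP[r_gt0 rr0] kp [ck ik] kE]]] :=
  local_chart_lift r00 rL0 e0 eB (annulus_open_disc hS aB rLB) eA (hphi y0).
have iA := let: And4 _ _ h _ := aA in h. have iB := let: And4 _ _ h _ := aB in h.
have sub x : disc p r x -> band a x.
  by move=> dx; apply: open_band_sub; apply: r0A; apply: disc_sub dx; rewrite ltW.
have kband x : disc p r x -> - b < (k x).1 < b.
  move=> /kE [_ /(disc_coord e0)[/andP[h1 h2] _]]; move: h1 h2; rewrite /= subr0 => h1 h2.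
  by apply/andP; split; lra.
have kband' x : disc p r x -> band b (k x).
  by move=> /kband; exact: open_band_sub.
have b00 v : band b (0, v) by rewrite /band /= oppr_le0 ltW.
have a00 v : band a (0, v) by rewrite /band /= oppr_le0 ltW.
have k0 y : disc p r (0, y) -> (k (0, y)).1 = 0 /\ exists n : int, (k (0, y)).2 = phi y + n%:~R.
  move=> dy; have [AB _] := kE _ dy.
  have [h1 /intrP[n h2]] := (iB _ _ (kband' _ dy) (b00 (phi y))).1 (etrans (esym AB) (hphi y)).
  by split => //; exists n; rewrite -h2 addrC subrK.
have kn0 x : disc p r x -> x.1 != 0 -> (k x).1 != 0.
  move=> dx; apply: contra => /eqP kx.
  have [AB _] := kE _ dx.
  have [v _ vE] : range (fun y => A (0, y)) (B (k x)) by apply: rBA; exists (k x).2;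
    rewrite // -kx -surjective_pairing.
  have [-> _] := (iA _ _ (sub _ dx) (a00 v)).1 (etrans AB (esym vE)).
  by [].
have : nbhs y0 [set y | phi y0 - 2^-1 < phi y < phi y0 + 2^-1].
  have t : tends (nbhs y0) phi (phi y0) by exact: cphi.
  have h1 : phi y0 - 2^-1 < phi y0 by lra.
  have h2 : phi y0 < phi y0 + 2^-1 by lra.
  by apply: filterS2 (tends_gt t h1) (tends_lt t h2) => y a1 a2; rewrite /= a1.
move=> /nbhs_ballP [r1 /= r10 r1U].
have eK : emb_disc A p r by apply: emb_disc_sub eA; rewrite ltW.
have sB' : has_sign O B (k p) 1 by rewrite kp.
have eB' : emb_disc B (k p) rL by rewrite kp.
have := relative_degree orO r_gt0 rL0 eK (conj ck ik) eB' (fun x dx => (kE x dx).1) sA sB'.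
move=> nW.
have [r' [/andP[r'0 r'r] /andP[_ r'1] [d [wd d1]]]] : exists r', [/\ 0 < r' < r, 0 < r' < r1 &
    exists d, winds (k p) (fun s => k (circle_pt p r' s)) d /\ 1 = d * 1 :> int].
  have [r' [[h1 h2] h3]] := @filter_ex _ (0^'+) _ _
    (filterI (filterI (near_right_lt r_gt0) (near_right_lt r10)) nW).
  by exists r'.
rewrite mulr1 in d1; rewrite -{}d1 in wd.
have dc s : disc p r (circle_pt p r' s) by rewrite disc_circle ltr_pXn2r// nnegrE ltW.
have pi0 := @pi_gt0 R.
have phi_near y : - r1 < y - y0 < r1 -> phi y0 - 2^-1 < phi y < phi y0 + 2^-1.
  by move=> h; apply: r1U; rewrite -ball_normE /ball_ /= ltr_norml; apply/andP; split;
    move: h => /andP[]; lra.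
have kphi y : disc p r (0, y) -> - r1 < y - y0 < r1 -> k (0, y) = (0, phi y).
  move=> dy /phi_near /andP[h1 h2]; have [k1 [n k2]] := k0 y dy.
  have [_ /(disc_coord e0)[_ /andP[h3 h4]]] := kE _ dy.
  have n0 : n%:~R = 0 :> R.
    apply: int_small; first exact: rpred_int.
    by move: h3 h4; rewrite k2 /=; move=> *; apply/andP; split; lra.
  by rewrite [k _]surjective_pairing k1 k2 n0 addr0.
have cu : circle_pt p r' (pi / 2) = (0, y0 + r').
  by rewrite /circle_pt cos_pihalf sin_pihalf /= mulr0 mulr1 addr0.
have cd : circle_pt p r' (- (pi / 2)) = (0, y0 - r').
  by rewrite /circle_pt cosN sinN cos_pihalf sin_pihalf /= mulr0 mulrN1 addr0.
have du := dc (pi / 2); rewrite cu in du.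
have dd := dc (- (pi / 2)); rewrite cd in dd.
have ku : k (0, y0 + r') = (0, phi (y0 + r')) by apply: kphi => //; apply/andP; split; lra.
have kd : k (0, y0 - r') = (0, phi (y0 - r')) by apply: kphi => //; apply/andP; split; lra.
have [] := winds_sides wd.
- by rewrite cd kd kp.
- by rewrite cd kd kp /=; apply: mphi; lra.
- by rewrite cu ku kp.
- by rewrite cu ku kp /=; apply: mphi; lra.
- move=> s hs; rewrite kp /=; apply: kn0 => //; rewrite /circle_pt /= add0r mulf_neq0 ?gt_eqF//.
  exact: cos_gt0_pihalf.
- move=> s /andP[h1 h2]; rewrite kp /=; apply: kn0 => //;
  rewrite /circle_pt /= add0r mulf_neq0 ?(gt_eqF r'0)//.
  rewrite -oppr_eq0 gt_eqF//.
  have -> : - cos s = cos (s - pi) by rewrite -[in LHS](subrK pi s) cosDpi opprK.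
  by apply: cos_gt0_pihalf; apply/andP; split; lra.
rewrite kp /= => kr kl.
have d0 := dc 0; have dpi := dc pi.
have c0E : (circle_pt p r' 0).1 = r' by rewrite /circle_pt /= cos0 mulr1 add0r.
have cpE : (circle_pt p r' pi).1 = - r' by rewrite /circle_pt /= cospi mulrN1 add0r.
(* [k] sends no point off the vertical axis onto that axis, so along a segment on one side the sign
   of the first coordinate of [k] cannot change. It thus spreads from one point of the small circle
   to the whole side. *)
have seg x y : disc p r x -> disc p r y -> 0 < x.1 * y.1 -> 0 < (k x).1 * (k y).1.
  move=> dx dy xy.
  rewrite ltNge; apply/negP => h.
  pose f t := (k (cvxcomb t x y)).1.
  have cf : {within `[0, 1], continuous f}.
    apply: continuous_in_subspaceT => t; rewrite inE /= in_itv /= => t01.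
    apply: tends_cts; apply: tends_fst.
    apply: (tends_at (h := k) (f := fun t => cvxcomb t x y)); first by rewrite /cvxcomb; tnd.
    by apply: ck; exact: disc_convex.
  have f0 : f 0 = (k x).1.
    by rewrite /f /cvxcomb subr0 !mul1r !mul0r !addr0 -surjective_pairing.
  have f1 : f 1 = (k y).1.
    by rewrite /f /cvxcomb subrr !mul1r !mul0r !add0r -surjective_pairing.
  have [|t] := @IVT R f 0 1 0 ler01 cf.
    rewrite f0 f1; case: (leP (k x).1 (k y).1) => hh; apply/andP; split; nra.
  rewrite in_itv /= => t01 ft.
  have e' : (1 - t) * x.1 + t * y.1 = 0.
    apply/eqP; apply: contraT => /(kn0 _ (disc_convex t01 dx dy)).
    by rewrite -/(f t) ft eqxx.
  move: t01 => /andP[t0 t1].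
  have e3 : (1 - t) * x.1 ^+ 2 + t * (x.1 * y.1) = 0.
    by rewrite -[RHS](mulr0 x.1) -e'; ring.
  have [tz|tn] := eqVneq t 0.
    move: e3; rewrite tz subr0 mul1r mul0r addr0 => /eqP; rewrite sqrf_eq0 => /eqP x0.
    by move: xy; rewrite x0 mul0r ltxx.
  have tp : 0 < t * (x.1 * y.1) by rewrite mulr_gt0// lt_neqAle eq_sym tn.
  have xp : 0 <= (1 - t) * x.1 ^+ 2 by rewrite mulr_ge0 ?sqr_ge0// subr_ge0.
  by lra.
apply: filterS (disc_nbhs p r_gt0) => z dz.
have [AB _] := kE _ dz.
have /andP[kb1 kb2] := kband _ dz.
split => zs; exists (k z) => //.
  rewrite kb2 andbT -(pmulr_rgt0 _ kr); apply: seg => //.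
  by rewrite c0E mulr_gt0.
rewrite kb1 /= -(nmulr_rgt0 _ kl); apply: seg => //.
by rewrite cpE mulNr -mulrN mulr_gt0// oppr_gt0.
Qed.

Definition two_sided A B (b de : R) := forall z : R * R, - de < z.1 < de ->
  (0 < z.1 -> exists2 u : R * R, 0 < u.1 < b & A z = B u) /\
  (z.1 < 0 -> exists2 u : R * R, - b < u.1 < 0 & A z = B u).

(** Compactness of one period of the core turns the local statement into a uniform width [de]. *)
Lemma annulus_sides A a B b phi :
  annulus a A -> annulus b B ->
  circle_lift (fun y => A (0, y)) (fun y => B (0, y)) phi 1 ->
  range (fun y => B (0, y)) `<=` range (fun y => A (0, y)) ->
  (forall y, has_sign O A (0, y) 1) -> (forall y, has_sign O B (0, y) 1) ->
  exists de, [/\ 0 < de, de <= a, de <= b & two_sided A B b de].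
Proof.
move=> aA aB L rBA sA sB.
have a0 : 0 < a by case: aA. have b0 : 0 < b by case: aB.
pose P (x y : R) := let z := (x, y) in
    (0 < z.1 -> exists2 u : R * R, 0 < u.1 < b & A z = B u) /\
    (z.1 < 0 -> exists2 u : R * R, - b < u.1 < 0 & A z = B u).
have : \forall x \near (0 : R), forall y, `[0 : R, 1]%classic y -> P x y.
  apply: near_compact; first exact: segment_compact.
  move=> y _.
  have t : tends (nbhs (y, (0 : R))) (fun z : R * R => (z.2, z.1)) ((0 : R), y) by tnd.
  have n := annulus_sides_local aA aB L rBA (sA y) (sB (phi y)).
  have n' := t _ n; rewrite /= nbhs_simpl /= in n'.
  by apply: filterS n' => -[y' x'] /= [h1 h2] _; split.
move=> /nbhs_ballP [e /= e0 eP].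
pose de := Num.min e (Num.min a b).
exists de; rewrite lt_min e0 lt_min a0 b0; split => //.
- by rewrite ge_min ge_min lexx orbT.
- by rewrite ge_min ge_min lexx !orbT.
move=> z /andP[z1 z2].
have dee : de <= e by rewrite ge_min lexx.
have dea : de <= a by rewrite ge_min ge_min lexx orbT.
have [n hn] := band_reduce z.
have ez : ball (0 : R) e z.1 by rewrite -ball_normE /ball_ /= sub0r normrN ltr_norml; apply/andP;
  split; lra.
have := eP _ ez (z.2 + n%:~R); rewrite /= in_itv /= => /(_ hn).
rewrite /P /= (annulus_int _ _ aA); last by apply/andP; split; lra.
by rewrite -surjective_pairing.
Qed.

(* A twist in the right half of [A] can be pushed inside this annulus to the left
   half of [B]. *)
Definition glue A B (phi : R -> R) (z : R * R) : S :=
  if z.1 <= 0 then B (z.1, phi z.2) else A z.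

Section Glue.
Variables (A B : R * R -> S) (a b de : R) (phi psi : R -> R).
Hypotheses (aA : annulus a A) (aB : annulus b B).
Hypothesis L : circle_lift (fun y => A (0, y)) (fun y => B (0, y)) phi 1.
Hypothesis L' : circle_lift (fun y => B (0, y)) (fun y => A (0, y)) psi 1.
Hypotheses (phiK : forall y, psi (phi y) = y) (psiK : forall y, phi (psi y) = y).
Hypotheses (de0 : 0 < de) (dea : de < a) (deb : de < b).
Hypothesis side : two_sided A B b de.

Let mphi := circle_lift_mono (annulus_core aA) (annulus_core aB) L.
Let mpsi := circle_lift_mono (annulus_core aB) (annulus_core aA) L'.
Let hphi y : A (0, y) = B (0, phi y). Proof. by case: L. Qed.

Let iA p q : band a p -> band a q -> (A p = A q <-> p.1 = q.1 /\ p.2 - q.2 \is a Num.int).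
Proof. by case: aA => _ _ h _; exact: h. Qed.
Let iB p q : band b p -> band b q -> (B p = B q <-> p.1 = q.1 /\ p.2 - q.2 \is a Num.int).
Proof. by case: aB => _ _ h _; exact: h. Qed.

Let glueA z : 0 <= z.1 -> glue A B phi z = A z.
Proof.
rewrite /glue; case: (ltgtP z.1 0) => // z0 _.
by rewrite [in RHS](surjective_pairing z) z0 hphi.
Qed.

Let glueB z : z.1 <= 0 -> glue A B phi z = B (z.1, phi z.2).
Proof. by rewrite /glue => ->. Qed.

Let separated z w : 0 < z.1 < de -> - b <= w.1 <= 0 -> A z <> B w.
Proof.
move=> /andP[z0 z1] /andP[w0 w1] e.
have [|/(_ z0)[u /andP[u0 u1] uE] _] := side (z := z); first by apply/andP; split; lra.
have ub : band b u by apply/andP; split; lra.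
have wb : band b w by apply/andP; split; lra.
have [h _] := (iB ub wb).1 (etrans (esym uE) e); lra.
Qed.

Let separated' z w : - de < z.1 < 0 -> 0 <= w.1 <= b -> A z <> B w.
Proof.
move=> /andP[z0 z1] /andP[w0 w1] e.
have [|_ /(_ z1)[u /andP[u0 u1] uE]] := side (z := z); first by apply/andP; split; lra.
have ub : band b u by apply/andP; split; lra.
have wb : band b w by apply/andP; split; lra.
have [h _] := (iB ub wb).1 (etrans (esym uE) e); lra.
Qed.

(** Injectivity across the core is the two-sidedness of [A] with respect to [B]. Openness is
    immediate off the core, where the glued map is locally one of the two given ones. *)
Lemma glue_annulus c : 0 < c < de -> annulus c (glue A B phi).
Proof.
move=> /andP[c0 cde]; have [cphi _ dphi] := L.
have [dea' deb'] : de < a /\ de < b by [].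
have sA z : 0 <= z.1 -> band c z -> band a z by move=> h /andP[h1 h2]; apply/andP; split; lra.
have sB z y : z.1 <= 0 -> band c z -> band b (z.1, y) by move=> h /andP[h1 h2]; apply/andP;
  split; rewrite /=; lra.
have [_ cA _ _] := aA; have [_ cB _ _] := aB.
split => //.
- have -> : band c = [set p | - c <= p.1 <= 0] `|` [set p | 0 <= p.1 <= c].
    apply/seteqP; split => z; rewrite /band /=.
      by move=> /andP[h1 h2]; case: (leP z.1 0) => h; [left; rewrite h1|right; rewrite h2 ltW].
    by move=> [] /andP[h1 h2]; apply/andP; split; lra.
  have cl (u v : R) : closed [set p : R * R | u <= p.1 <= v].
    have -> : [set p : R * R | u <= p.1 <= v] = fst @^-1` [set x | u <= x <= v] by [].
    apply: closed_comp; first by move=> x _; exact: cvg_fst.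
    have -> : [set x | u <= x <= v] = `[u, v]%classic by apply/seteqP; split => x /=;
      rewrite in_itv.
    exact: itv_closed.
  apply: withinU_continuous; [exact: cl|exact: cl| |].
    apply: (@within_eq _ _ _ (B \o (fun z => (z.1, phi z.2)))).
      by move=> z /= /andP[z0 z1]; rewrite glueB.
    apply: within_comp cB.
      by apply: continuous_subspaceT; cts z; exact: cphi.
    by move=> z /andP[h1 h2]; rewrite /band /=; apply/andP; split; lra.
  apply: (@within_eq _ _ _ A).
    by move=> z /= /andP[z0 z1]; rewrite glueA.
  by apply: continuous_subspaceW cA => z /andP[h1 h2]; apply/andP; split; lra.
- move=> p q pc qc.
  have iphi y z : phi y - phi z \is a Num.int <-> y - z \is a Num.int.
    split; first exact: (circle_lift_inj (annulus_core aA) (annulus_core aB) L).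
    move=> h; rewrite -(phiK y) -(phiK z) in h.
    exact: (circle_lift_inj (annulus_core aB) (annulus_core aA) L') h.
  case: (leP p.1 0) => hp; case: (leP q.1 0) => hq.
  + by rewrite !glueB// iB /=; [rewrite iphi|exact: sB|exact: sB].
  + rewrite (glueB hp) (glueA (ltW hq)); split => [e|[e _]]; last by move: hp; rewrite e leNgt hq.
    exfalso; apply: (@separated q (p.1, phi p.2)) => //=.
      by move: qc => /andP[h1 h2]; apply/andP; split; lra.
    by move: pc => /andP[h1 h2]; apply/andP; split; lra.
  + rewrite (glueA (ltW hp)) (glueB hq); split => [e|[e _]]; last by move: hp; rewrite e ltNge hq.
    exfalso; apply: (@separated p (q.1, phi q.2)) => //=.
      by move: pc => /andP[h1 h2]; apply/andP; split; lra.
    by move: qc => /andP[h1 h2]; apply/andP; split; lra.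
  + by rewrite (glueA (ltW hp)) (glueA (ltW hq)); apply: iA; apply: sA => //; exact: ltW.
- have oband (u v : R) : open [set p : R * R | u < p.1 < v].
    rewrite openE => p /andP[h1 h2].
    have h : tends (nbhs p) (fun p : R * R => p.1) p.1 by tnd.
    by apply: filterS2 (tends_gt h h1) (tends_lt h h2) => q u1 u2; rewrite /= u1 u2.
  have nband (u v : R) (p : R * R) : u < p.1 < v -> nbhs p [set p : R * R | u < p.1 < v].
    by move=> h; apply: open_nbhs_nbhs; split.
  have imB w : - c < w.1 <= 0 -> (glue A B phi @` open_band c) (B w).
    move=> /andP[h1 h2]; exists (w.1, psi w.2).
      by rewrite /open_band /=; apply/andP; split; lra.
    by rewrite glueB//= psiK -surjective_pairing.
  have imA w : 0 <= w.1 < c -> (glue A B phi @` open_band c) (A w).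
    move=> /andP[h1 h2]; exists w; last by rewrite glueA.
    by rewrite /open_band /=; apply/andP; split; lra.
  rewrite openE => _ [p /andP[p1 p2] <-].
  have [p0|p0|p0] := ltgtP p.1 0.
  + rewrite /interior (glueB (ltW p0)).
    have ob : open_band b (p.1, phi p.2) by rewrite /open_band /=; apply/andP; split; lra.
    have nb : nbhs (p.1, phi p.2) [set p : R * R | - c < p.1 < 0] by apply: nband; rewrite p1.
    apply: filterS (annulus_open hS aB ob nb) => _ [w [/andP[w1 w2] _] <-].
    by apply: imB; rewrite w1 ltW.
  + rewrite /interior (glueA (ltW p0)).
    have ob : open_band a p by rewrite /open_band /=; apply/andP; split; lra.
    have nb : nbhs p [set p : R * R | 0 < p.1 < c] by apply: nband; rewrite p0.
    apply: filterS (annulus_open hS aA ob nb) => _ [w [/andP[w1 w2] _] <-].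
    by apply: imA; rewrite w2 ltW.
  (* At the core a nearby point is both [A w] and [B v]. If [w] is on the right it is in the image
     through [A]; otherwise [v] cannot be on the right, and it is in the image through [B]. *)
  + have p0' : 0 <= p.1 by rewrite p0.
    rewrite /interior (glueA p0').
    have oa : open_band a p by rewrite /open_band /=; apply/andP; split; lra.
    have na : nbhs p [set p : R * R | - c < p.1 < c] by apply: nband; rewrite p1.
    have ob : open_band b (p.1, phi p.2) by rewrite /open_band /=; apply/andP; split; lra.
    have nb : nbhs (p.1, phi p.2) [set p : R * R | - c < p.1 < c] by apply: nband; rewrite /= p1.
    have AB : A p = B (p.1, phi p.2) by rewrite [p in LHS]surjective_pairing p0 hphi.
    have n1 := annulus_open hS aA oa na.
    have n2 := annulus_open hS aB ob nb; rewrite -AB in n2.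
    apply: filterS2 n1 n2 => _ [w [/andP[w1 w2] _] <-] [v [/andP[v1 v2] _] vw].
    have [w0|w0] := leP 0 w.1; first by apply: imA; rewrite w0.
    rewrite -vw; apply: imB; rewrite v1 /= leNgt; apply/negP => v0.
    apply: (@separated' w v) => //; apply/andP; split; lra.
Qed.

Definition right_profile (c x y : R) : R := y + clamp (x / c).
Definition left_profile (c x y : R) : R := y + clamp (1 + x / c).

Lemma clamp_le0 (x : R) : x <= 0 -> clamp x = 0.
Proof. by move=> h; rewrite /clamp max_r// min_l// ler01. Qed.

Lemma clamp_ge1 (x : R) : 1 <= x -> clamp x = 1.
Proof. by move=> h; rewrite /clamp max_l ?min_r//; lra. Qed.

Lemma shift_profile d (f : R -> R) : continuous f -> f (- d) = 0 -> f d = 1 ->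
  profile d (fun x y => y + f x).
Proof.
move=> cf f0 f1; split.
- by cts p; exact: cf.
- by move=> x y z; rewrite ltrD2r.
- by move=> x y; rewrite addrAC.
- by move=> y; rewrite f0 addr0.
- by move=> y; rewrite f1.
Qed.

Lemma right_profileP c d : 0 < c <= d -> profile d (right_profile c).
Proof.
move=> /andP[c0 cd]; apply: shift_profile.
- cts x; [by rewrite gt_eqF|exact: clamp_continuous].
- by apply: clamp_le0; rewrite mulNr oppr_le0 divr_ge0//; lra.
- by apply: clamp_ge1; rewrite ler_pdivlMr// mul1r.
Qed.

Lemma left_profileP c d : 0 < c <= d -> profile d (left_profile c).
Proof.
move=> /andP[c0 cd]; apply: shift_profile.
- cts x; [by rewrite gt_eqF|exact: clamp_continuous].
- by apply: clamp_le0; rewrite mulNr subr_le0 ler_pdivlMr// mul1r.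
- by apply: clamp_ge1; rewrite lerDl divr_ge0//; lra.
Qed.

Lemma shift_int (f : R -> R) x y (n : int) : (y + n%:~R) + f x = (y + f x) + n%:~R.
Proof. by rewrite addrAC. Qed.

(** Both maps move only points of the right half up to [c], where the glued annulus is [A] itself;
    elsewhere the profile is an integer shift. *)
Lemma glue_twist_right c : 0 < c < de ->
  twist A a (right_profile c) =1 twist (glue A B phi) c (right_profile c).
Proof.
move=> /[dup] cde' /andP[c0 cde] z; have [dea' deb'] : de < a /\ de < b by [].
have aG := glue_annulus cde'.
have fixA : (forall q, 0 < q.1 < c -> A q <> z) -> twist A a (right_profile c) z = z.
  move=> H; have [[q qa qz]|nz] := pselect ((A @` band a) z); last exact: twist_out.
  rewrite -qz (twist_band aA (@shift_int _)) // /right_profile.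
  have [q0|q0] := leP q.1 0.
    rewrite clamp_le0 ?addr0 -?surjective_pairing//.
    by rewrite pmulr_lle0 ?invr_gt0.
  have [qc|qc] := leP c q.1.
    rewrite clamp_ge1 ?ler_pdivlMr ?mul1r//.
    by rewrite (annulus_int q.2 1 aA qa) -surjective_pairing.
  by exfalso; apply: (H q) => //; rewrite q0.
have [[p pc pz]|nz] := pselect ((glue A B phi @` band c) z); last first.
  rewrite (twist_out _ nz) fixA// => q /andP[q0 qc] qz; apply: nz; exists q.
    by rewrite /band /=; apply/andP; split; lra.
  by rewrite glueA// ltW.
rewrite -[in RHS]pz (twist_band aG (@shift_int _)) //.
have /andP[pc1 pc2] := pc.
have [p0|p0] := leP p.1 0.
  rewrite /right_profile clamp_le0 ?pmulr_lle0 ?invr_gt0// addr0 -surjective_pairing pz.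
  apply: fixA => q /andP[q0 qc]; rewrite -pz (glueB p0) => e.
  apply: (@separated q (p.1, phi p.2)) => //=; first by apply/andP; split; lra.
  by apply/andP; split; lra.
rewrite -pz !glueA ?ltW// (twist_band aA (@shift_int _))//.
by rewrite /band /=; apply/andP; split; lra.
Qed.

(** On the left half the glued circular coordinate [y] is the coordinate [phi y] of [B], so the
    twist appears in [B] conjugated by [phi]. *)
Definition left_core_profile c (x y : R) : R := phi (left_profile c x (psi y)).

Lemma left_core_profileP c : 0 < c < de -> profile b (left_core_profile c).
Proof.
move=> /andP[c0 cde]; have [dea' deb'] : de < a /\ de < b by [].
have cb : 0 < c <= b by apply/andP; split; lra.
have [_ _ _ n1 p1] := left_profileP cb.
have [cphi _ dphi] := L; have [cpsi _ dpsi] := L'.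
rewrite /left_core_profile; split.
- rewrite /left_profile; cts p; [exact: cpsi|by rewrite gt_eqF|exact: clamp_continuous|exact: cphi].
- by move=> x y z yz; apply: mphi; rewrite /left_profile ltrD2r; exact: mpsi.
- by move=> x y; rewrite dpsi /left_profile addrAC dphi.
- by move=> y; rewrite n1 psiK.
- by move=> y; rewrite p1 dphi psiK.
Qed.

Lemma glue_twist_left c : 0 < c < de ->
  twist (glue A B phi) c (left_profile c) =1 twist B b (left_core_profile c).
Proof.
move=> /[dup] cde' /andP[c0 cde] z; have [dea' deb'] : de < a /\ de < b by [].
have aG := glue_annulus cde'.
have pL x y n := profile_int x y n (left_core_profileP cde').
have [cphi _ dphi] := L.
have fixB : (forall q, - c < q.1 <= 0 -> B q <> z) -> twist B b (left_core_profile c) z = z.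
  move=> H; have [[q qb qz]|nz] := pselect ((B @` band b) z); last exact: twist_out.
  rewrite -qz (twist_band aB pL) // /left_core_profile /left_profile.
  have [q0|q0] := leP q.1 (- c).
    rewrite clamp_le0 ?addr0 ?psiK -?surjective_pairing//.
    by rewrite -lerBrDl sub0r ler_pdivrMr// mulN1r.
  have [qc|qc] := leP q.1 0.
    by exfalso; apply: (H q) => //; rewrite q0.
  rewrite clamp_ge1 ?lerDl ?divr_ge0// ?ltW// dphi psiK.
  by rewrite (annulus_int q.2 1 aB qb) -surjective_pairing.
have [[p pc pz]|nz] := pselect ((glue A B phi @` band c) z); last first.
  rewrite (twist_out _ nz) fixB// => q /andP[q0 qc] qz; apply: nz; exists (q.1, psi q.2).
    by rewrite /band /=; apply/andP; split; lra.
  by rewrite glueB//= psiK -surjective_pairing.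
rewrite -[in LHS]pz (twist_band aG (@shift_int _)) //.
have /andP[pc1 pc2] := pc.
have [p0|p0] := leP p.1 0.
  rewrite -pz !glueB// (twist_band aB pL)//=; last first.
    by rewrite /band /=; apply/andP; split; lra.
  by rewrite /left_core_profile phiK.
rewrite /left_profile clamp_ge1 ?lerDl ?divr_ge0// ?ltW//.
rewrite (annulus_int p.2 1 aG pc) -surjective_pairing pz fixB// => q /andP[q0 qc].
rewrite -pz glueA ?ltW// => e.
have [pd|pd] := ltP p.1 de; last by lra.
apply: (@separated p q) => //; first by rewrite p0.
by apply/andP; split; lra.
Qed.
End Glue.

(** The twist of [A] is concentrated on the right half, where it is a twist of the glued annulus;
    there its profile is moved to the left half, where it is a twist of [B], and finally that
    profile is changed to the given one. *)
Lemma twist_unique_increasing A a B b phi Psi Psi' :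
  annulus a A -> annulus b B ->
  circle_lift (fun y => A (0, y)) (fun y => B (0, y)) phi 1 ->
  range (fun y => B (0, y)) `<=` range (fun y => A (0, y)) ->
  (forall y, has_sign O A (0, y) 1) -> (forall y, has_sign O B (0, y) 1) ->
  profile a Psi -> profile b Psi' -> isotopic R (twist A a Psi) (twist B b Psi').
Proof.
move=> aA aB L rBA sA sB pr pr'.
have [psi [L' phiK psiK]] := circle_lift_inverse hS (annulus_core aA) (annulus_core aB) rBA L.
have [de0 [de00 dea deb side0]] := annulus_sides aA aB L rBA sA sB.
(* [annulus_sides] gives weak bounds; halving twice makes the inequalities strict. *)
pose de := de0 / 2; pose c := de0 / 4.
have dea' : de < a by rewrite /de; lra. have deb' : de < b by rewrite /de; lra.
have cde : 0 < c < de by apply/andP; split; rewrite /c /de; lra.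
have side : two_sided A B b de by move=> z /andP[z1 z2]; apply: side0; apply/andP; split;
  rewrite /de in z1 z2; lra.
have ca : 0 < c <= a by apply/andP; split; rewrite /c; lra.
have cc : 0 < c <= c by rewrite lexx andbT; case/andP: cde.
have aG := glue_annulus aA aB L L' psiK phiK dea' deb' side cde.
have prr := right_profileP ca; have prl := right_profileP cc; have pll := left_profileP cc.
have plc := left_core_profileP aA aB L L' phiK dea' deb' cde.
have i1 := twist_isotopic cS hS aA pr prr.
have i2 := twist_isotopic cS hS aG prl pll.
have i3 := twist_isotopic cS hS aB plc pr'.
have e1 : twist A a (right_profile c) = twist (glue A B phi) c (right_profile c).
  by apply/funext; exact: (glue_twist_right aA aB L L' psiK phiK dea' deb' side cde).
have e2 : twist (glue A B phi) c (left_profile c) = twist B b (left_core_profile phi psi c).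
  by apply/funext; exact: (glue_twist_left aA aB L L' psiK phiK dea' deb' side cde).
rewrite e1 in i1; rewrite e2 in i2.
apply: isotopic_trans_homeomorphism i1 _.
  exact: (twist_homeomorphism cS hS aG prl).
apply: isotopic_trans_homeomorphism i2 i3.
exact: (twist_homeomorphism cS hS aB plc).
Qed.

Lemma flip_sign B b y d : annulus b B -> has_sign O B (0, - y) d ->
  has_sign O (B \o @flip R) (0, y) d.
Proof.
move=> aB sB; have b0 : 0 < b by case: aB.
have pB : open_band b (0, - y) by rewrite /open_band /= oppr_lt0 b0.
have [r [r0 _ eB]] := annulus_emb aB pB.
have e : @flip R (0, y) = (0, - y) by rewrite /flip /= oppr0.
have := @degree_at_isometry R S B (@flip R) (0, y) pi 1.
rewrite e => /(_ _) dB.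
rewrite -[d]mul1r; apply: (has_sign_comp orO r0 eB _ _ sB); first by rewrite /= e.
apply: dB => r' s; rewrite mul1r /flip /circle_pt /= cosDpi sinDpi !mulrN !add0r.
by rewrite opprD.
Qed.

(** The lift between the cores has degree 1 or -1. In the second case the first annulus is turned by
    [flip], which changes neither its twist nor its sign. *)
Lemma twist_unique A a B b Psi Psi' :
  annulus a A -> annulus b B ->
  range (fun y => A (0, y)) = range (fun y => B (0, y)) ->
  (forall y, has_sign O A (0, y) 1) -> (forall y, has_sign O B (0, y) 1) ->
  profile a Psi -> profile b Psi' -> isotopic R (twist A a Psi) (twist B b Psi').
Proof.
move=> aA aB rAB sA sB pr pr'.
have cA := annulus_core aA; have cB := annulus_core aB.
have [|phi [n L]] := circle_lift_exists hS cA cB; first by rewrite rAB.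
have rBA : range (fun y => B (0, y)) `<=` range (fun y => A (0, y)) by rewrite rAB.
case: (circle_lift_degree cA cB L) => n1; rewrite n1 in L.
  exact: twist_unique_increasing L rBA sA sB pr pr'.
have fE y : @flip R (0, y) = (0, - y) by rewrite /flip /= oppr0.
have -> : twist A a Psi = twist (A \o @flip R) a (fun x y => 1 - Psi (- x) (- y)).
  by apply/funext; exact: twist_flip.
apply: (@twist_unique_increasing _ _ _ _ (fun y => phi (- y))) => //.
- exact: annulus_flip.
- have [cphi hphi dphi] := L; split => [|y|y].
  + by cts y; exact: cphi.
  + by rewrite /= fE hphi.
  + rewrite opprD; have := dphi (- y - 1); rewrite subrK => ->.
    by rewrite -[(-1)%:~R]/(-1) mulr1z subrK.
- move=> _ /rBA[y _ <-]; exists (- y) => //.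
  by rewrite /= fE opprK.
- by move=> y; apply: flip_sign aA _.
- exact: profile_flip.
Qed.
End TwistUnique.

(** * From the Dehn twists of the theorem to profiles *)

Section DehnTwist.
Variables (R : realType) (S : topologicalType) (O : set (R * R -> S)).
Hypotheses (hS : hausdorff_space S) (orO : orientation O).

(** It gives openness of the interior of a twist annulus: that interior is exactly the set of points
    moved by the twist. *)
Lemma moved_open (f : S -> S) : continuous f -> open [set z | f z <> z].
Proof.
move=> cf; rewrite openE => z /= /eqP nz.
move: hS; rewrite open_hausdorff => /(_ _ _ nz)[[U V] /= [/set_mem zU /set_mem zV] [oU oV UV]].
have nU : nbhs (f z) U by apply: open_nbhs_nbhs; split.
have nV : nbhs z V by apply: open_nbhs_nbhs; split.
have fU : \forall w \near z, U (f w) by exact: (cf z _ nU).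
rewrite /interior; apply: filterS2 fU nV => w wU wV e.
have : (U `&` V) w by split => //; rewrite e in wU.
by rewrite (eqP UV).
Qed.

Definition shift_half (A : R * R -> S) (p : R * R) : S := A (p.1 + 2^-1, p.2).

(** The annulus is recentred at its core, and the twist is equal, not merely isotopic, to the one of
    a profile. Points at depth strictly between 0 and 1 move since their shift is no integer; edge
    points and outer points are fixed. *)
Lemma dehn_twist_annulus C (t : Mod O) : left_dehn_twist C t ->
  exists A c Psi (f : homeo O), [/\ annulus c A /\ profile c Psi,
    range (fun y => A (0, y)) = C, forall y, has_sign O A (0, y) 1,
    t = isotopy_class f & (f : S -> S) =1 twist A c Psi].
Proof.
move=> [A [f [[cA iA oA] CE [tA tid] tE]]].
pose A' := shift_half A.
pose Psi := fun x y : R => y + clamp (x + 2^-1).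
have bs p : band 2^-1 p -> @strip R (p.1 + 2^-1, p.2).
  by rewrite /band /strip /= => /andP[h1 h2]; apply/andP; split; lra.
have A'E p : A p = A' (p.1 - 2^-1, p.2) by rewrite /A' /shift_half /= subrK -surjective_pairing.
have iA' p q : band 2^-1 p -> band 2^-1 q -> (A' p = A' q <-> p.1 = q.1 /\ p.2 - q.2 \is a Num.int).
  move=> /bs pb /bs qb; rewrite /A' /shift_half (iA _ _ pb qb) /=.
  by split=> -[h1 h2]; split => //; [exact: addIr h1|rewrite h1].
have oE : A' @` open_band 2^-1 = [set z | f z <> z].
  apply/seteqP; split => [_ [p /andP[h1 h2] <-] /=|z /= nz].
    have ps : 0 <= p.1 + 2^-1 <= 1 by apply/andP; split; lra.
    rewrite /A' /shift_half tA// => /iA[] // _ /=.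
    rewrite addrAC subrr add0r => hi.
    suff : p.1 + 2^-1 = 0 by lra.
    by apply: int_small => //; apply/andP; split; lra.
  have [[p /andP[p0 p1] pz]|n] := pselect ((A @` @strip R) z); last by have := tid _ n.
  rewrite -pz [p]surjective_pairing tA ?p0// in nz.
  exists (p.1 - 2^-1, p.2); last by rewrite -A'E.
  have pn0 : p.1 != 0 by apply/eqP => e; apply: nz; rewrite e addr0.
  have pn1 : p.1 != 1.
    apply/eqP => e; apply: nz; apply/iA; rewrite /strip /= ?e ?lexx ?ler01//.
    by rewrite addrAC subrr add0r; split => //; exact: rpred1.
  have h1 : 0 < p.1 by rewrite lt_neqAle eq_sym pn0.
  have h2 : p.1 < 1 by rewrite lt_neqAle pn1.
  by apply/andP; split; rewrite /=; lra.
have aA : annulus 2^-1 A'.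
  split => //.
  - apply: within_comp cA; last exact: bs.
    by apply: continuous_subspaceT; cts p.
  - rewrite oE; apply: moved_open; exact: homeo_cont.
have pr : profile 2^-1 Psi.
  apply: (@shift_profile R 2^-1 (fun x => clamp (x + 2^-1))).
  - by cts x; [rewrite pnatr_eq0|exact: clamp_continuous].
  - by rewrite clamp_le0// addNr.
  - by rewrite clamp_ge1// [leRHS](_ : _ = 1)//; lra.
exists A', 2^-1, Psi, f; split => //.
- rewrite CE; apply/seteqP; split => [_ [y _ <-]|_ [[x y] /= -> <-]].
    by exists (2^-1, y) => //; rewrite /A' /shift_half /= add0r.
  by exists y => //; rewrite /A' /shift_half /= add0r.
- move=> y psi q Opsi pq.
  have ob : open_band 2^-1 (0, y) :> Prop by rewrite /open_band /=; apply/andP; split; lra.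
  have [r [r0 _ eA]] := annulus_emb aA ob.
  apply: (co_oriented_degree (O_emb orO Opsi) r0 eA pq).
  have := oA _ Opsi (2^-1, y) q; rewrite /= => /(_ _)[].
  + by apply/andP; split; lra.
  + by rewrite pq /A' /shift_half /= add0r.
  + move=> r1 r10 H; exists r1 => // r2 h1 h2.
    have [rho [theta [h3 h4 h5 h6]]] := H _ h1 h2.
    exists rho, theta; split => // s; rewrite -h6 /A' /shift_half /circle_pt /= add0r.
    by rewrite addrC.
- move=> z; have [[p pb <-]|n] := pselect ((A' @` band 2^-1) z).
    rewrite (twist_band aA (fun x y n => profile_int x y n pr))//.
    rewrite /A' /shift_half tA /= /Psi ?clampid//; move: (pb); rewrite /band /= => /andP[h1 h2];
      apply/andP; split; lra.
  rewrite (twist_out _ n) tid// => -[p /andP[p1 p2] pz]; apply: n.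
  exists (p.1 - 2^-1, p.2); last by rewrite -A'E.
  by rewrite /band /=; apply/andP; split; lra.
Qed.
End DehnTwist.

(** * The holed plane and handles *)

Section Plane.
Variable R : realType.
Implicit Types (p q c v w z : R * R) (x y : R) (G : R * R -> R * R).

Lemma pair_eqP (T U : Type) (a b : T * U) : a.1 = b.1 -> a.2 = b.2 -> a = b.
Proof. by case: a b => [a1 a2] [b1 b2] /= -> ->. Qed.

(** Hole centres have both coordinates in 1/2 + Z, so the cells are the unit squares with integer
    corners and [cell] is the signed coordinate relative to the centre. It jumps at the integers
    from 1/2 to -1/2, but its square is continuous. *)
Definition cell x : R := x - 2^-1 - (Num.floor x)%:~R.
Definition offset p : R * R := (cell p.1, cell p.2).
Definition center_of p : R * R := ((Num.floor p.1)%:~R + 2^-1, (Num.floor p.2)%:~R + 2^-1).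
Definition sqn v : R := v.1 ^+ 2 + v.2 ^+ 2.
Definition hole_dist p : R := sqn (offset p).
Definition lattice z := z.1 \is a Num.int /\ z.2 \is a Num.int.
Definition center c := lattice (c.1 - 2^-1, c.2 - 2^-1).

Lemma center_offset p : center_of p + offset p = p.
Proof. by apply: pair_eqP => /=; rewrite /cell; lra. Qed.

Lemma offsetE p : offset p = p - center_of p.
Proof. by rewrite -{2}(center_offset p) addrAC subrr add0r. Qed.

Lemma center_center_of p : center (center_of p).
Proof. by split; rewrite /= addrK. Qed.

Lemma cell_itv x : - 2^-1 <= cell x < 2^-1.
Proof. by have /andP[h1 h2] := frac_itv x; rewrite /cell; apply/andP; split; lra. Qed.

Lemma floor_center (c w : R) : c - 2^-1 \is a Num.int -> - 2^-1 <= w < 2^-1 ->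
  (Num.floor (c + w))%:~R = c - 2^-1 :> R.
Proof.
move=> /intrP[m cm] /andP[w1 w2]; rewrite cm; congr (_%:~R).
by apply: floor_def; rewrite -cm -[(m + 1)%:~R]/(_) intrD -cm; apply/andP; split; lra.
Qed.

Lemma cell_center (c w : R) : c - 2^-1 \is a Num.int -> - 2^-1 <= w < 2^-1 ->
  cell (c + w) = w.
Proof. by move=> ci wi; rewrite /cell floor_center//; lra. Qed.

Lemma sqn_lt_cell w : sqn w < 4^-1 ->
  (- 2^-1 <= w.1 < 2^-1) /\ (- 2^-1 <= w.2 < 2^-1).
Proof. by rewrite /sqn => h; split; apply/andP; split; nra. Qed.

Lemma offset_center c w : center c -> sqn w < 4^-1 -> offset (c + w) = w.
Proof.
move=> [c1 c2] /sqn_lt_cell[w1 w2].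
by apply: pair_eqP; rewrite /= cell_center.
Qed.

Lemma center_of_center c w : center c -> sqn w < 4^-1 -> center_of (c + w) = c.
Proof.
move=> [c1 c2] /sqn_lt_cell[w1 w2].
by apply: pair_eqP; rewrite /= floor_center// subrK.
Qed.

Lemma floorD_int x y : y \is a Num.int -> (Num.floor (x + y))%:~R = (Num.floor x)%:~R + y :> R.
Proof.
move=> yi; have := @floor_center ((Num.floor x)%:~R + 2^-1 + y) (cell x) _ (cell_itv x).
have -> : (Num.floor x)%:~R + 2^-1 + y + cell x = x + y by rewrite /cell; ring.
move=> ->; first by ring.
have -> : (Num.floor x)%:~R + 2^-1 + y - 2^-1 = (Num.floor x)%:~R + y :> R by ring.
by rewrite rpredD// rpred_int.
Qed.

Lemma offset_lattice p z : lattice z -> offset (p + z) = offset p.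
Proof. by move=> [z1 z2]; apply: pair_eqP; rewrite /= /cell floorD_int//; ring. Qed.

Lemma center_of_lattice p z : lattice z -> center_of (p + z) = center_of p + z.
Proof. by move=> [z1 z2]; apply: pair_eqP; rewrite /= floorD_int//; ring. Qed.

(** No hole centre is nearer than that of the own cell, so the quantifiers over all holes reduce to
    one inequality on [hole_dist]. *)
Lemma cell_sqr_le x (m : int) : cell x ^+ 2 <= (x - 2^-1 - m%:~R) ^+ 2.
Proof.
have /andP[h1 h2] := cell_itv x.
have -> : x - 2^-1 - m%:~R = cell x + (Num.floor x - m)%:~R by rewrite /cell intrB; ring.
set k := Num.floor x - m.
have [k0|k0] := leP k 0; last first.
  have : 1 <= k%:~R :> R.
    rewrite -[1]/(1%:~R) ler_int; move: k0; clear; lia.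
  move: (cell x) (k%:~R) h1 h2 => a b h1 h2 h3; nra.
have [->|k1] := eqVneq k 0; first by rewrite addr0.
have : k%:~R <= -1 :> R.
  rewrite -[-1]/((-1)%:~R) ler_int; move: k0 k1; clear; lia.
move: (cell x) (k%:~R) h1 h2 => a b h1 h2 h3; nra.
Qed.

Lemma hole_dist_le p m n : hole_dist p <= dist2_hole p m n.
Proof. by rewrite /hole_dist /sqn /dist2_hole /= lerD// cell_sqr_le. Qed.

Lemma hole_dist_floor p : dist2_hole p (Num.floor p.1) (Num.floor p.2) = hole_dist p.
Proof. by []. Qed.

Lemma holed_planeP p : @holed_plane R p <-> 4^-1 ^+ 2 <= hole_dist p.
Proof.
split => [h|h m n]; first by rewrite -hole_dist_floor; exact: h.
exact: le_trans h (hole_dist_le p m n).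
Qed.

Lemma hole_boundaryP p : @hole_boundary R p <-> hole_dist p = 4^-1 ^+ 2.
Proof.
split => [[m [n e]]|h]; last by exists (Num.floor p.1), (Num.floor p.2).
pose c : R * R := (m%:~R + 2^-1, n%:~R + 2^-1).
have cc : center c by split; rewrite /= addrK.
pose w : R * R := (p.1 - 2^-1 - m%:~R, p.2 - 2^-1 - n%:~R).
have pE : p = c + w by apply: pair_eqP; rewrite /= ; ring.
have we : sqn w = 4^-1 ^+ 2 by [].
by rewrite /hole_dist pE offset_center// we; lra.
Qed.

Lemma boundary_holed p : @hole_boundary R p -> @holed_plane R p.
Proof. by move=> /hole_boundaryP h; apply/holed_planeP; rewrite h. Qed.

Lemma hole_dist_lattice p z : lattice z -> hole_dist (p + z) = hole_dist p.
Proof. by move=> lz; rewrite /hole_dist offset_lattice. Qed.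

Lemma cell_sqr_continuous : continuous (fun x => cell x ^+ 2).
Proof.
have -> : (fun x => cell x ^+ 2) = (fun y => (fun t : R =>
  (t - 2^-1) ^+ 2) (y - (Num.floor y)%:~R)).
  by apply/funext => x; rewrite /cell; congr (_ ^+ 2); ring.
apply: (@frac_continuous R _ (fun t : R => (t - 2^-1) ^+ 2)); last by field.
by cts x; rewrite pnatr_eq0.
Qed.

Lemma hole_dist_continuous : continuous hole_dist.
Proof.
rewrite /hole_dist /sqn /= => p; apply: tends_cts; apply: tendsD.
  by apply: (tends_at (h := fun x => cell x ^+ 2) (f := fst)); [tnd|exact: cell_sqr_continuous].
by apply: (tends_at (h := fun x => cell x ^+ 2) (f := snd)); [tnd|exact: cell_sqr_continuous].
Qed.

Lemma sqn_continuous : continuous sqn.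
Proof. by rewrite /sqn; cts v. Qed.

Lemma center_of_near p : hole_dist p < 4^-1 -> \forall q \near p, center_of q = center_of p.
Proof.
move=> hp.
have t : tends (nbhs p) (fun q => sqn (q - center_of p)) (hole_dist p).
  have -> : hole_dist p = sqn (p - center_of p).
    by rewrite /hole_dist -{2}(center_offset p) addrAC subrr add0r.
  by apply: (tends_at (h := sqn) (f := fun q => q - center_of p)); [tnd|exact: sqn_continuous].
apply: filterS (tends_lt t hp) => q hq.
rewrite -[q in LHS](subrK (center_of p)) addrC.
exact: center_of_center (center_center_of p) hq.
Qed.

Definition periodize G p : R * R := center_of p + G (offset p).

(** The radius 3/8 is halfway between the hole of radius 1/4 and the edge of the cell at 1/2: there
    is room to change the map near the hole and a margin within which the change cannot meet the
    discontinuities of [offset]. *)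
Definition supported G := forall v, (3 / 8) ^+ 2 <= sqn v -> G v = v.

Lemma periodize_lattice G p z : lattice z -> periodize G (p + z) = periodize G p + z.
Proof. by move=> lz; rewrite /periodize offset_lattice// center_of_lattice// addrAC. Qed.

Lemma periodize_offset G p : supported G ->
  (forall v, sqn v < (3 / 8) ^+ 2 -> sqn (G v) < 4^-1) ->
  offset (periodize G p) = G (offset p) /\ center_of (periodize G p) = center_of p.
Proof.
move=> sG bG; rewrite /periodize.
have [h|h] := ltP (sqn (offset p)) ((3 / 8) ^+ 2).
  have cc := center_center_of p; have b := bG _ h.
  by rewrite (offset_center cc b) (center_of_center cc b).
by rewrite sG// center_offset.
Qed.

Lemma periodize_far G p : supported G -> (3 / 8) ^+ 2 <= hole_dist p -> periodize G p = p.
Proof. by move=> sG h; rewrite /periodize sG// center_offset. Qed.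

Lemma periodize_continuous G p : supported G ->
  (hole_dist p < 4^-1 -> {for offset p, continuous G}) -> {for p, continuous (periodize G)}.
Proof.
move=> sG cG.
have [h|h] := ltP (hole_dist p) 4^-1.
  apply: tends_cts.
  have n := center_of_near h.
  apply: (tends_near_eq (g := fun q => center_of p + G (q - center_of p))).
    by apply: filterS n => q e; rewrite /periodize offsetE e.
  rewrite /periodize; apply: tendsD2; first exact: tends_cst.
  rewrite offsetE; apply: (tends_at (h := G) (f := fun q => q - center_of p)); first by tnd.
  by rewrite -offsetE; exact: cG.
apply: tends_cts.
have h' : (3 / 8) ^+ 2 < hole_dist p by apply: lt_le_trans h; lra.
apply: (tends_near_eq (g := fun q => q)).
  have t : tends (nbhs p) hole_dist (hole_dist p) by exact: hole_dist_continuous.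
  by apply: filterS (tends_gt t h') => q hq; rewrite periodize_far// ltW.
by rewrite periodize_far ?(ltW h')//; tnd.
Qed.
End Plane.

Section Handles.
Variables (R : realType) (S : topologicalType).
Implicit Types (p q z : R * R) (h : R * R -> S) (k l : R * R -> R * R).
Local Notation H := (@holed_plane R).
Local Notation dH := (@hole_boundary R).

Lemma lattice0 : lattice (0 : R * R).
Proof. by split; exact: rpred0. Qed.

Lemma latticeN (z : R * R) : lattice z -> lattice (- z).
Proof. by move=> [a b]; split; rewrite /= rpredN. Qed.

Lemma holed_lattice p z : lattice z -> H p -> H (p + z).
Proof. by move=> lz /holed_planeP h; apply/holed_planeP; rewrite hole_dist_lattice. Qed.

Lemma boundary_lattice p z : lattice z -> dH p -> dH (p + z).
Proof. by move=> lz /hole_boundaryP h; apply/hole_boundaryP; rewrite hole_dist_lattice. Qed.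

Lemma boundary_congr p q : lattice (p - q) -> dH q -> dH p.
Proof. by move=> lz bq; rewrite -[p](subrK q) addrC; exact: boundary_lattice. Qed.

Definition handle h := {within H, continuous h} /\
  forall p q, H p -> H q -> (h p = h q <-> lattice (p - q)).

Definition handles h h' := [/\ handle h /\ handle h',
  forall x : S, (exists2 p, H p & h p = x) \/ (exists2 p, H p & h' p = x) &
  forall p q, H p -> H q -> h p = h' q -> dH p /\ dH q].

Lemma handles_sym h h' : handles h h' -> handles h' h.
Proof.
move=> [[a b] c d]; split => // [z|p q Hp Hq e]; first by case: (c z); [right|left].
by have [] := d q p Hq Hp (esym e).
Qed.

Lemma handle_lattice h p z : handle h -> H p -> lattice z -> h (p + z) = h p.
Proof.
move=> [_ i] Hp lz; apply/i => //; first exact: holed_lattice.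
by rewrite addrAC subrr add0r.
Qed.

Definition unit_square : set (R * R) := `[0, 1] `*` `[0, 1].
Definition domain : set (R * R) := unit_square `&` H.

Lemma holed_closed : closed H.
Proof.
rewrite (_ : H = @hole_dist R @^-1` [set x | 4^-1 ^+ 2 <= x]); last first.
  by apply/seteqP; split => p /holed_planeP.
by apply: closed_comp; [by move=> p _; apply: hole_dist_continuous|exact: closed_ge].
Qed.

Lemma unit_square_compact : compact unit_square.
Proof. by apply: compact_setX; exact: segment_compact. Qed.

Lemma domain_compact : compact domain.
Proof.
apply: (subclosed_compact _ unit_square_compact); last by move=> p [].
apply: closedI holed_closed; apply: compact_closed; last exact: unit_square_compact.
exact: norm_hausdorff.
Qed.

Lemma domain_reduce p : exists2 z, lattice z & unit_square (p + z).
Proof.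
exists (- ((Num.floor p.1)%:~R, (Num.floor p.2)%:~R)).
  by apply: latticeN; split; rewrite /= rpred_int.
have /andP[h1 h2] := frac_itv p.1; have /andP[h3 h4] := frac_itv p.2.
by split; rewrite /= in_itv /=; apply/andP; split => //; exact: ltW.
Qed.

Lemma domain_reduceH p : H p -> exists2 z, lattice z & domain (p + z).
Proof. by move=> Hp; have [z lz uz] := domain_reduce p; exists z => //; split => //;
  exact: holed_lattice. Qed.

Section Pair.
Hypotheses (hS : hausdorff_space S).
Variables (h h' : R * R -> S).
Hypothesis hh : handles h h'.

(** The complement of the image is the union of the images of two compact sets: the rest of a
    fundamental domain of the first handle, and all of the second handle. *)
Lemma handle_open (U : set (R * R)) : open U ->
  (forall p, U p -> 4^-1 ^+ 2 < hole_dist p) ->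
  (forall p z, lattice z -> U p -> U (p + z)) -> open (h @` U).
Proof.
have [[[ch ih] [ch' ih']] cov meet] := hh.
move=> oU UH Uz.
have UHp p : U p -> H p by move=> /UH h0; apply/holed_planeP; exact: ltW.
have -> : h @` U = ~` (h @` (domain `\` U) `|` h' @` domain).
  apply/seteqP; split => x.
    move=> [p Up <-] [[q [[uq Hq] nUq] e]|[q [uq Hq] e]].
      have := (ih _ _ (UHp _ Up) Hq).1 (esym e) => l; apply: nUq.
      by rewrite -[q](subKr p) -[p - (p - q)]/(p + - (p - q)); apply: Uz Up; exact: latticeN.
    have [/hole_boundaryP d _] := meet _ _ (UHp _ Up) Hq (esym e).
    by have := UH _ Up; rewrite d ltxx.
  move=> nx; case: (cov x) => -[p Hp px].
    have [z lz pz] := domain_reduceH Hp.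
    exists (p + z); last by rewrite (handle_lattice _ Hp).
    by apply: contrapT => nU; apply: nx; left; exists (p + z) => //; rewrite (handle_lattice _ Hp).
  exfalso; apply: nx; right; have [z lz pz] := domain_reduceH Hp.
  by exists (p + z) => //; rewrite (handle_lattice _ Hp).
apply: closed_openC; apply: closedU; apply: compact_closed => //.
  apply: continuous_compact; first by apply: continuous_subspaceW ch => p [[]].
  apply: (subclosed_compact _ domain_compact); last by move=> p [].
  rewrite setDE; apply: closedI; last exact: open_closedC.
  by apply: compact_closed; [exact: norm_hausdorff|exact: domain_compact].
apply: continuous_compact; last exact: domain_compact.
by apply: continuous_subspaceW ch' => p [].
Qed.
End Pair.

Lemma handle_emb h p : handle h -> 4^-1 ^+ 2 < hole_dist p -> exists2 r, 0 < r &
  emb_disc h p r /\ forall q, disc p r q -> 4^-1 ^+ 2 < hole_dist q.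
Proof.
move=> [ch ih] hp.
have n : \forall q \near p, 4^-1 ^+ 2 < hole_dist q.
  have t : tends (nbhs p) (@hole_dist R) (hole_dist p) by exact: hole_dist_continuous.
  exact: tends_gt t hp.
have [r r0 rn] := nbhs_disc n.
exists (Num.min r 2^-1); first by rewrite lt_min r0 /=.
have sub q : disc p (Num.min r 2^-1) q -> 4^-1 ^+ 2 < hole_dist q.
  by move=> /(disc_minl r0)-/(_ _)dq; apply: rn; apply: dq.
split => //; split => [q dq|q q' dq dq' e].
  have oH : open [set q | 4^-1 ^+ 2 < @hole_dist R q].
    rewrite (_ : [set _ | _] = @hole_dist R @^-1` [set x | 4^-1 ^+ 2 < x])//.
    by apply: open_comp; [by move=> x _; apply: hole_dist_continuous|exact: open_gt].
  have := sub _ dq => Hq.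
  have chI : {within [set q | 4^-1 ^+ 2 < @hole_dist R q], continuous h}.
    by apply: continuous_subspaceW ch => x /= hx; apply/holed_planeP; exact: ltW.
  by move: chI; rewrite continuous_open_subspace// => chI; apply: chI; rewrite inE.
have [] := (ih q q' _ _).1 e; [by apply/holed_planeP; apply: ltW; exact: sub..|].
have m0 : 0 < Num.min r 2^-1 by rewrite lt_min r0 /=.
have m2 : Num.min r 2^-1 <= 2^-1 by rewrite ge_min lexx orbT.
have [/andP[a1 a2] /andP[a3 a4]] := disc_coord m0 dq.
have [/andP[b1 b2] /andP[b3 b4]] := disc_coord m0 dq'.
move=> /= i1 i2; apply: pair_eqP; apply/eqP; rewrite -subr_eq0; apply/eqP;
  apply: int_small => //; apply/andP; split; lra.
Qed.

(* A self-map of the holed plane that induces a self-map of the one-holed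
   torus preserving the boundary circle. *)
Definition descends k := [/\ forall p, H p -> H (k p),
  forall p q, H p -> H q -> lattice (p - q) -> lattice (k p - k q) &
  forall p, dH p -> dH (k p)].

Lemma descends_comp k l : descends k -> descends l -> descends (k \o l).
Proof.
move=> [k1 k2 k3] [l1 l2 l3]; split => [p /l1/k1//|p q Hp Hq /l2|p /l3/k3//] e.
by apply: k2; [exact: l1..|exact: e].
Qed.

(** One planar formula on both halves. On the common circle the first handle is preferred, which is
    harmless for [glued] parametrisations; the default [x] is never reached when the handles cover
    the surface. *)
Definition desc h h' k (x : S) : S :=
  match pselect (exists p, H p /\ h p = x) with
  | left e => h (k (sval (cid e)))
  | right _ => match pselect (exists p, H p /\ h' p = x) with
     | left e => h' (k (sval (cid e))) | right _ => x end
  end.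

Definition glued h h' := handles h h' /\ forall p, dH p -> h p = h' p.

Lemma glued_sym h h' : glued h h' -> glued h' h.
Proof. by move=> [/handles_sym a b]; split => // p /b. Qed.

Section Descent.
Hypotheses (cS : compact [set: S]) (hS : hausdorff_space S).
Variables (h h' : R * R -> S).
Hypothesis hh : glued h h'.

Lemma desc_left k p : descends k -> H p -> desc h h' k (h p) = h (k p).
Proof.
move=> [k1 k2 k3] Hp; have [[[[_ ih] _] _ _] _] := hh.
rewrite /desc; case: pselect => [e|[]]; last by exists p.
case: (cid e) => q [Hq qp] /=; apply/ih; [exact: k1..|].
by apply: k2 => //; apply/ih.
Qed.

Lemma desc_right k p : descends k -> H p -> desc h h' k (h' p) = h' (k p).
Proof.
move=> [k1 k2 k3] Hp; have [[[_ [_ ih']] _ meet] gl] := hh.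
rewrite /desc; case: pselect => [e|_].
  case: (cid e) => q [Hq qp] /=; have [bq bp] := meet _ _ Hq Hp qp.
  rewrite gl; last exact: k3.
  apply/ih'; [exact: k1..|]; apply: k2 => //; apply/ih' => //.
  by rewrite -gl.
case: pselect => [e|[]]; last by exists p.
case: (cid e) => q [Hq qp] /=; apply/ih'; [exact: k1..|].
by apply: k2 => //; apply/ih'.
Qed.

Lemma handles_ind (P : S -> Prop) :
  (forall p, H p -> P (h p)) -> (forall p, H p -> P (h' p)) -> forall x, P x.
Proof. by move=> P1 P2 x; have [[_ cov _] _] := hh; case: (cov x) => -[p Hp <-]; auto. Qed.

Lemma desc_comp k l : descends k -> descends l ->
  desc h h' (k \o l) =1 desc h h' k \o desc h h' l.
Proof.
move=> dk dl; have dkl := descends_comp dk dl; have [l1 _ _] := dl.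
by apply: handles_ind => p Hp /=; [rewrite !desc_left//; exact: l1|rewrite !desc_right//;
  exact: l1].
Qed.

Lemma desc_id k : (forall p, H p -> k p = p) -> desc h h' k =1 id.
Proof.
move=> kid; have dk : descends k.
  split => [p Hp|p q Hp Hq|p bp]; rewrite ?kid//; exact: boundary_holed.
by apply: handles_ind => p Hp; [rewrite desc_left// kid|rewrite desc_right// kid].
Qed.

Lemma eq_desc k l : descends k -> descends l -> (forall p, H p -> k p = l p) ->
  desc h h' k =1 desc h h' l.
Proof.
by move=> dk dl e; apply: handles_ind => p Hp; [rewrite !desc_left// e|rewrite !desc_right// e].
Qed.

Lemma handle_reduce_image (f : R * R -> S) : handle f -> f @` domain = f @` H.
Proof.
move=> hf; apply/seteqP; split => [_ [p [_ Hp] <-]|_ [p Hp <-]]; first by exists p.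
 have [z lz pz] := domain_reduceH Hp.
by exists (p + z) => //; exact: handle_lattice.
Qed.

Lemma desc_continuous2 (T : topologicalType) (K : T -> R * R ->
  R * R) : (forall t, descends (K t)) ->
  {within [set x : T * (R * R) | H x.2], continuous (fun x => K x.1 x.2)} ->
  continuous (fun x : T * S => desc h h' (K x.1) x.2).
Proof.
move=> dK cK; have [[[a1 a2] cov _] _] := hh; have [ch ih] := a1; have [ch' ih'] := a2.
have KH t p : H p -> H (K t p) by case: (dK t) => kH _ _; exact: kH.
have sub : domain `<=` H by move=> p [].
have key (f : R * R -> S) : {within H, continuous f} ->
    (forall t p, H p -> desc h h' (K t) (f p) = f (K t p)) -> forall t p, domain p ->
    tends (within (fun z : R * R * T => domain z.1) (nbhs (p, t))) (fun z : R * R * T =>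
      desc h h' (K z.2) (f z.1)) (desc h h' (K t) (f p)).
  move=> cf fE t p /sub Hp; rewrite fE//.
  have nD : \forall z \near within (fun z : R * R * T => domain z.1) (nbhs (p, t)), H z.1.
    by apply: filterS (near_within_mem (T := (R * R * T)%type) (fun z : R * R * T =>
      domain z.1) (p, t)) => z; exact: sub.
  apply: (tends_near_eq (g := fun z : R * R * T => f (K z.2 z.1))).
    by apply: filterS nD => z Hz; rewrite fE.
  apply: (tends_within cf); first exact: KH.
    have sw : tends (within (fun z : R * R * T =>
      domain z.1) (nbhs (p, t))) (fun z : R * R * T => (z.2, z.1)) (t, p) by tnd.
    by exact: (tends_within (A := [set x : T * (R * R) | H x.2]) (l := (t, p)) cK Hp sw nD).
  by apply: filterS nD => z; exact: KH.
apply: (@continuous_descend2 _ _ _ _ _ domain domain h h' _ hS domain_compact domain_compact).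
- exact: continuous_subspaceW ch.
- exact: continuous_subspaceW ch'.
- rewrite !handle_reduce_image//; apply/seteqP; split => // x _.
  by case: (cov x) => -[p Hp px]; [left|right]; exists p.
- by apply: key => // t p Hp; exact: desc_left.
- by apply: key => // t p Hp; exact: desc_right.
Qed.

Lemma desc_continuous k : descends k -> {within H, continuous k} -> continuous (desc h h' k).
Proof.
move=> dk ck.
have c2 := @desc_continuous2 R (fun=> k) (fun=> dk).
have : continuous (fun x : R * S => desc h h' k x.2).
  apply: c2; apply: (within_comp (k := snd) (E := H)) ck => //.
  by apply: continuous_subspaceT; cts x.
move=> cc x; apply: tends_cts.
have t : tends (nbhs x) (fun y : S => (0 : R, y)) (0, x) by tnd.
exact: (tends_at (h := fun x : R * S => desc h h' k x.2) t (cc _)).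
Qed.

Lemma desc_homeomorphism k l : descends k -> descends l -> {within H, continuous k} ->
  (forall p, H p -> k (l p) = p) -> (forall p, H p -> l (k p) = p) ->
  homeomorphism (desc h h' k).
Proof.
move=> dk dl ck kl lk.
have e1 x : desc h h' k (desc h h' l x) = x by rewrite -[LHS](desc_comp dk dl) desc_id.
have e2 x : desc h h' l (desc h h' k x) = x by rewrite -[LHS](desc_comp dl dk) desc_id.
apply: homeomorphism_bij => //.
- exact: desc_continuous.
- exact: can_inj e2.
- by move=> y; exists (desc h h' l y).
Qed.

(** The inverse family supplies bijectivity at each time, and compactness then makes every stage a
    homeomorphism. *)
Lemma desc_isotopic (K L : R -> R * R -> R * R) : (forall t, descends (K t)) ->
  (forall t, descends (L t)) ->
  {within [set x : R * (R * R) | H x.2], continuous (fun x => K x.1 x.2)} ->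
  (forall t p, H p -> K t (L t p) = p) -> (forall t p, H p -> L t (K t p) = p) ->
  isotopic R (desc h h' (K 0)) (desc h h' (K 1)).
Proof.
move=> dK dL cK KL LK.
have e1 t x : desc h h' (K t) (desc h h' (L t) x) = x.
  by rewrite -[LHS](desc_comp (dK t) (dL t)) desc_id//; exact: KL.
have e2 t x : desc h h' (L t) (desc h h' (K t) x) = x.
  by rewrite -[LHS](desc_comp (dL t) (dK t)) desc_id//; exact: LK.
apply: (@isotopicI R S cS hS (fun x => desc h h' (K x.1) x.2)) => //.
- exact: desc_continuous2.
- by move=> t _ /=; exact: can_inj (e2 t).
- by move=> t _ y; exists (desc h h' (L t) y); exact: e1.
Qed.
End Descent.
End Handles.

(** * Blowing up the centre of the hole *)

Section BlowUp.
Variable R : realType.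
Implicit Types (p q c v w z : R * R) (m L : R * R -> R * R) (r s t : R).
Local Notation H := (@holed_plane R).
Local Notation dH := (@hole_boundary R).

Definition scal s v : R * R := (s * v.1, s * v.2).
Definition nrm v : R := Num.sqrt (sqn v).

Lemma scalA s t v : scal s (scal t v) = scal (s * t) v.
Proof. by rewrite /scal /= !mulrA. Qed.

Lemma scal1 v : scal 1 v = v.
Proof. by rewrite /scal !mul1r -surjective_pairing. Qed.

Lemma sqn_scal s v : sqn (scal s v) = s ^+ 2 * sqn v.
Proof. by rewrite /sqn /scal /=; ring. Qed.

Lemma sqn_ge0 v : 0 <= sqn v.
Proof. by rewrite addr_ge0// sqr_ge0. Qed.

Lemma nrm_ge0 v : 0 <= nrm v.
Proof. exact: sqrtr_ge0. Qed.

Lemma nrm_sqr v : nrm v ^+ 2 = sqn v.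
Proof. by rewrite sqr_sqrtr// sqn_ge0. Qed.

Lemma nrm_scal s v : 0 <= s -> nrm (scal s v) = s * nrm v.
Proof. by move=> s0; rewrite /nrm sqn_scal sqrtrM ?sqr_ge0// sqrtr_sqr ger0_norm. Qed.

Lemma nrm_gt0 v : (0 < nrm v) = (0 < sqn v).
Proof. by rewrite sqrtr_gt0. Qed.

Lemma nrm_le s v : 0 <= s -> (s <= nrm v) = (s ^+ 2 <= sqn v).
Proof. by move=> s0; rewrite -nrm_sqr ler_pXn2r// nnegrE nrm_ge0. Qed.

Lemma nrm_lt s v : 0 <= s -> (s < nrm v) = (s ^+ 2 < sqn v).
Proof. by move=> s0; rewrite -nrm_sqr ltr_pXn2r// nnegrE nrm_ge0. Qed.

Lemma nrm_eq s v : 0 <= s -> (nrm v == s) = (sqn v == s ^+ 2).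
Proof. by move=> s0; rewrite -nrm_sqr eqrXn2// nrm_ge0. Qed.

Lemma sqn_lt s v : 0 <= s -> (nrm v < s) = (sqn v < s ^+ 2).
Proof. by move=> s0; rewrite -nrm_sqr ltr_pXn2r// nnegrE nrm_ge0. Qed.

Lemma sqn_eq0 v : sqn v = 0 -> v = 0.
Proof.
move=> h; have h1 := sqr_ge0 v.1; have h2 := sqr_ge0 v.2; rewrite /sqn in h.
apply: pair_eqP; apply/eqP; rewrite -sqrf_eq0; apply/eqP => /=; lra.
Qed.

Lemma center_offset0 q : center q <-> sqn (offset q) = 0.
Proof.
split => [cq|/sqn_eq0 o0].
  rewrite -[q]addr0 offset_center//.
    by rewrite /sqn /= expr0n addr0.
  by rewrite /sqn /= expr0n addr0 invr_gt0.
by rewrite -(center_offset q) o0 addr0; exact: center_center_of.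
Qed.

(* [collapse] contracts the annulus of radii 1/4 and 3/8 radially onto the
   punctured disc of radius 3/8, and [expand] is its inverse. *)
Definition collapse_factor r : R := Num.max 0 (Num.min 1 (3 - 3 / 4 / r)).
Definition expand_factor r : R := Num.max 1 (3^-1 + 4^-1 / r).
Definition collapse v : R * R := scal (collapse_factor (nrm v)) v.
Definition expand v : R * R := scal (expand_factor (nrm v)) v.

Lemma collapse_factor_far r : 3 / 8 <= r -> collapse_factor r = 1.
Proof.
move=> h; have r0 : 0 < r by lra.
have h1 : 3 / 4 / r <= 2 by rewrite ler_pdivrMr//; lra.
by rewrite /collapse_factor min_l ?max_r//; lra.
Qed.

(** It is the ratio for the affine map [3 * r - 3 / 4] of radii, which sends 1/4 to 0 and fixes 3/8;
    outside this range the maximum and minimum take over continuously. *)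
Lemma collapse_factor_near r : 4^-1 <= r < 3 / 8 -> collapse_factor r = 3 - 3 / 4 / r.
Proof.
move=> /andP[h h']; have r0 : 0 < r by lra.
have h1 : 2 <= 3 / 4 / r by rewrite ler_pdivlMr//; lra.
have h2 : 3 / 4 / r <= 3 by rewrite ler_pdivrMr//; lra.
by rewrite /collapse_factor min_r ?max_r//; lra.
Qed.

Lemma expand_factor_far r : 3 / 8 <= r -> expand_factor r = 1.
Proof.
move=> h; have r0 : 0 < r by lra.
have h1 : 4^-1 / r <= 2 / 3 by rewrite ler_pdivrMr//; lra.
by rewrite /expand_factor max_l//; lra.
Qed.

Lemma expand_factor_near r : 0 < r < 3 / 8 -> expand_factor r = 3^-1 + 4^-1 / r.
Proof.
move=> /andP[h h'].
have h1 : 2 / 3 <= 4^-1 / r by rewrite ler_pdivlMr//; lra.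
by rewrite /expand_factor max_r//; lra.
Qed.

Lemma far_nrm v : ((3 / 8) ^+ 2 <= sqn v) = (3 / 8 <= nrm v).
Proof. by rewrite nrm_le//; lra. Qed.

Lemma supported_collapse : supported collapse.
Proof. by move=> v; rewrite far_nrm => h; rewrite /collapse collapse_factor_far// scal1. Qed.

Lemma supported_expand : supported expand.
Proof. by move=> v; rewrite far_nrm => h; rewrite /expand expand_factor_far// scal1. Qed.

Lemma near_nrm v : sqn v < (3 / 8) ^+ 2 -> nrm v < 3 / 8.
Proof. by rewrite -sqn_lt//; lra. Qed.

Lemma collapse_bound v : sqn v < (3 / 8) ^+ 2 -> sqn (collapse v) < 4^-1.
Proof.
move=> h; rewrite /collapse sqn_scal.
have h0 : 0 <= collapse_factor (nrm v) <= 1.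
  by rewrite /collapse_factor le_max lexx /= ge_max ler01 /= ge_min lexx.
have := sqn_ge0 v; move: (collapse_factor _) (sqn v) h0 h => a b /andP[a0 a1] h b0.
have : a ^+ 2 * b <= b by rewrite ler_piMl// expr_le1.
by lra.
Qed.

Lemma expand_near v : 0 < nrm v < 3 / 8 -> nrm (expand v) = nrm v / 3 + 4^-1.
Proof.
move=> /[dup] h /andP[r0 r1]; rewrite /expand expand_factor_near// nrm_scal.
  by field; rewrite gt_eqF.
by rewrite addr_ge0// ?divr_ge0// ltW.
Qed.

Lemma expand_bound v : sqn v < (3 / 8) ^+ 2 -> sqn (expand v) < 4^-1.
Proof.
move=> /near_nrm h; have := nrm_ge0 v; rewrite le_eqVlt => /orP[/eqP e|e].
  by rewrite /expand sqn_scal -nrm_sqr -e expr0n mulr0.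
have -> : 4^-1 = 2^-1 ^+ 2 :> R by field.
by rewrite -sqn_lt// expand_near ?e//; lra.
Qed.

Lemma expand_gt v : 0 < sqn v -> 4^-1 ^+ 2 < sqn (expand v).
Proof.
rewrite -nrm_gt0 => h; rewrite -nrm_lt//.
have [h'|h'] := leP (3 / 8) (nrm v); first by rewrite supported_expand ?far_nrm//; lra.
by rewrite expand_near ?h//; lra.
Qed.

Lemma collapse_near v : 4^-1 <= nrm v < 3 / 8 -> nrm (collapse v) = 3 * nrm v - 3 / 4.
Proof.
move=> /[dup] h /andP[r0 r1]; have rp : 0 < nrm v by lra.
rewrite /collapse collapse_factor_near// nrm_scal.
  by field; rewrite gt_eqF.
by rewrite subr_ge0 ler_pdivrMr//; lra.
Qed.

Lemma collapse_gt0 v : 4^-1 ^+ 2 < sqn v -> 0 < sqn (collapse v).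
Proof.
rewrite -nrm_lt// => h; rewrite -nrm_gt0.
have [h'|h'] := leP (3 / 8) (nrm v); first by rewrite supported_collapse ?far_nrm//; lra.
by rewrite collapse_near ?h' ?ltW//; lra.
Qed.

Lemma expandK v : 0 < sqn v -> collapse (expand v) = v.
Proof.
rewrite -nrm_gt0 => h.
have [h'|h'] := leP (3 / 8) (nrm v).
  by rewrite supported_expand ?supported_collapse ?far_nrm.
have e := expand_near (v := v); rewrite h h' in e; move/(_ isT) in e.
rewrite /collapse e collapse_factor_near; last by apply/andP; split; lra.
rewrite /expand scalA expand_factor_near ?h// -[RHS]scal1; congr scal.
have n1 : nrm v != 0 by rewrite gt_eqF.
have n2 : nrm v / 3 + 4^-1 != 0 by rewrite gt_eqF//; lra.
by move: (nrm v) n1 n2 => a n1 n2; field; apply/andP; split => //; apply: contra n2 => /eqP n2;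
  apply/eqP; lra.
Qed.

Lemma collapseK v : 4^-1 ^+ 2 < sqn v -> expand (collapse v) = v.
Proof.
rewrite -nrm_lt// => h.
have [h'|h'] := leP (3 / 8) (nrm v).
  by rewrite supported_collapse ?supported_expand ?far_nrm.
have e := collapse_near (v := v); rewrite h' ltW// in e; move/(_ isT) in e.
rewrite /expand e expand_factor_near; last by apply/andP; split; lra.
rewrite /collapse scalA collapse_factor_near ?h' ?ltW// -[RHS]scal1; congr scal.
have n1 : nrm v != 0 by rewrite gt_eqF//; lra.
have n2 : 3 * nrm v - 3 / 4 != 0 by rewrite gt_eqF//; lra.
by move: (nrm v) n1 n2 => a n1 n2; field; apply/andP; split => //; apply: contra n2 => /eqP n2;
  apply/eqP; lra.
Qed.

Lemma tends_scal {T : Type} {F : set_system T} {FF : Filter F} (s : T -> R) (v : T -> R * R) a b :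
  tends F s a -> tends F v b -> tends F (fun x => scal (s x) (v x)) (scal a b).
Proof. by move=> ts tv; rewrite /scal; tnd. Qed.

Lemma tends_nrm {T : Type} {F : set_system T} {FF : Filter F} (v : T -> R * R) b :
  tends F v b -> tends F (fun x => nrm (v x)) (nrm b).
Proof. by move=> tv; rewrite /nrm /sqn; tnd. Qed.

Lemma collapse_continuous v : 0 < sqn v -> {for v, continuous collapse}.
Proof.
rewrite -nrm_gt0 => h; apply: tends_cts; rewrite /collapse /collapse_factor.
apply: tends_scal; last by tnd.
have tn : tends (nbhs v) nrm (nrm v) by apply: (tends_nrm (v := fun x => x)); tnd.
apply: tends_max; first exact: tends_cst.
apply: tends_min; first exact: tends_cst.
by apply: tendsB; [exact: tends_cst|apply: tendsM; [exact: tends_cst|apply: tendsV => //;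
  rewrite gt_eqF]].
Qed.

Lemma expand_continuous v : 0 < sqn v -> {for v, continuous expand}.
Proof.
rewrite -nrm_gt0 => h; apply: tends_cts; rewrite /expand /expand_factor.
apply: tends_scal; last by tnd.
have tn : tends (nbhs v) nrm (nrm v) by apply: (tends_nrm (v := fun x => x)); tnd.
apply: tends_max; first exact: tends_cst.
by apply: tendsD; [exact: tends_cst|apply: tendsM; [exact: tends_cst|apply: tendsV => //;
  rewrite gt_eqF]].
Qed.

Definition blow_down := periodize collapse.
Definition blow_up := periodize expand.

Lemma offset_blow_down p : offset (blow_down p) = collapse (offset p) /\
  center_of (blow_down p) = center_of p.
Proof. exact: periodize_offset supported_collapse collapse_bound. Qed.

Lemma offset_blow_up p : offset (blow_up p) = expand (offset p) /\
  center_of (blow_up p) = center_of p.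
Proof. exact: periodize_offset supported_expand expand_bound. Qed.

Lemma blow_downK p : 4^-1 ^+ 2 < hole_dist p -> blow_up (blow_down p) = p.
Proof.
move=> h; have [e1 e2] := offset_blow_down p.
by rewrite /blow_up /periodize e1 e2 collapseK// center_offset.
Qed.

Lemma blow_upK p : 0 < hole_dist p -> blow_down (blow_up p) = p.
Proof.
move=> h; have [e1 e2] := offset_blow_up p.
by rewrite /blow_down /periodize e1 e2 expandK// center_offset.
Qed.

Lemma blow_down_gt0 p : 4^-1 ^+ 2 < hole_dist p -> 0 < hole_dist (blow_down p).
Proof. by move=> h; rewrite /hole_dist (offset_blow_down p).1 collapse_gt0. Qed.

Lemma blow_up_gt p : 0 < hole_dist p -> 4^-1 ^+ 2 < hole_dist (blow_up p).
Proof. by move=> h; rewrite {1}/hole_dist (offset_blow_up p).1 expand_gt. Qed.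

Lemma blow_down_continuous p : 0 < hole_dist p -> {for p, continuous blow_down}.
Proof. by move=> h; apply: (periodize_continuous supported_collapse) => _;
  exact: collapse_continuous. Qed.

Lemma blow_up_continuous p : 0 < hole_dist p -> {for p, continuous blow_up}.
Proof. by move=> h; apply: (periodize_continuous supported_expand) => _;
  exact: expand_continuous. Qed.

(* [m] induces a self-map of the torus that fixes the centre of the hole, near
   which it is given by [L]. *)
Definition toral m L := [/\ forall p z, lattice z -> lattice (m (p + z) - m p),
  forall p, center (m p) <-> center p,
  forall c w, center c -> sqn w < (3 / 8) ^+ 2 -> m (c + w) = m c + L w,
  forall s v, 0 <= s -> L (scal s v) = scal s (L v) &
  forall v, 0 < sqn v -> 0 < sqn (L v)].

(** The boundary circle stands for the rays at the removed centre, and [L] acts on these rays; off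
    the circle the map is [m] conjugated by the radial change of coordinates. *)
Definition blow m L p : R * R :=
  if hole_dist p == 4^-1 ^+ 2
  then m (center_of p) + scal (4^-1 / nrm (L (offset p))) (L (offset p))
  else blow_up (m (blow_down p)).

Lemma sqn_unit v s : 0 < sqn v -> 0 <= s -> sqn (scal (s / nrm v) v) = s ^+ 2.
Proof.
move=> v0 s0; rewrite -nrm_sqr nrm_scal ?divr_ge0 ?nrm_ge0// divfK//.
by rewrite gt_eqF// nrm_gt0.
Qed.

Lemma hole_distE p : nrm (offset p) ^+ 2 = hole_dist p.
Proof. exact: nrm_sqr. Qed.

Section Blow.
Variables (m L : R * R -> R * R).
Hypothesis mL : toral m L.

Lemma toral_hole_dist p : 0 < hole_dist p -> 0 < hole_dist (m p).
Proof.
have [_ mc _ _ _] := mL; rewrite !lt_neqAle !sqn_ge0 !andbT => h.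
by apply: contra h => /eqP e; rewrite eq_sym; apply/eqP/center_offset0/mc/center_offset0.
Qed.

Lemma blow_boundary p : dH p -> [/\ hole_dist (blow m L p) = 4^-1 ^+ 2,
  center_of (blow m L p) = m (center_of p) &
  offset (blow m L p) = scal (4^-1 / nrm (L (offset p))) (L (offset p))].
Proof.
have [_ mc _ _ L0] := mL.
move=> /hole_boundaryP e; rewrite /blow e eqxx /hole_dist.
have o0 : 0 < sqn (L (offset p)).
  by apply: L0; rewrite -/(hole_dist p) e exprn_gt0.
have u : sqn (scal (4^-1 / nrm (L (offset p))) (L (offset p))) = 4^-1 ^+ 2.
  by rewrite sqn_unit.
have u' : sqn (scal (4^-1 / nrm (L (offset p))) (L (offset p))) < 4^-1 by rewrite u; lra.
have cc : center (m (center_of p)) by apply/mc; exact: center_center_of.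
by rewrite offset_center// center_of_center.
Qed.

Lemma blow_interior p : 4^-1 ^+ 2 < hole_dist p ->
  blow m L p = blow_up (m (blow_down p)) /\ 4^-1 ^+ 2 < hole_dist (blow m L p).
Proof.
move=> h; rewrite /blow gt_eqF//; split => //; apply: blow_up_gt.
by apply: toral_hole_dist; exact: blow_down_gt0.
Qed.

Lemma holed_cases p : H p -> dH p \/ 4^-1 ^+ 2 < hole_dist p.
Proof.
move=> /holed_planeP; rewrite le_eqVlt => /orP[/eqP e|]; last by right.
by left; apply/hole_boundaryP.
Qed.

Lemma blow_lattice p z : lattice z -> lattice (blow m L (p + z) - blow m L p).
Proof.
have [ml _ _ _ _] := mL.
move=> lz; rewrite /blow hole_dist_lattice// offset_lattice// center_of_lattice//.
case: ifP => _.
  by rewrite opprD addrACA subrr addr0; exact: ml.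
rewrite /blow_down periodize_lattice//.
set a := m (_ + z); set b := m _.
have -> : a = b + (a - b) by rewrite addrC subrK.
rewrite /blow_up periodize_lattice; last exact: ml.
by rewrite addrAC subrr add0r; exact: ml.
Qed.

Lemma blow_descends : descends (blow m L).
Proof.
split.
- move=> p /holed_cases[/blow_boundary[e _ _]|/blow_interior[_ h]]; apply/holed_planeP.
    by rewrite e.
  exact: ltW.
- move=> p q Hp Hq lpq; have -> : p = q + (p - q) by rewrite addrC subrK.
  exact: blow_lattice.
- by move=> p /blow_boundary[e _ _]; apply/hole_boundaryP.
Qed.
End Blow.

(** Functoriality is exact: inside, expansion and collapse cancel between the two maps; on the
    circle, positive homogeneity of [L] makes the intermediate normalisation irrelevant. *)
Lemma blow_comp m L m' L' p : toral m L -> toral m' L' -> H p ->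
  blow (m \o m') (L \o L') p = blow m L (blow m' L' p).
Proof.
move=> mL mL' /holed_cases[bp|ip].
  have [e1 e2 e3] := blow_boundary mL' bp.
  rewrite {2}/blow e1 eqxx e2 e3 {1}/blow; move/hole_boundaryP: (bp) => e; rewrite e eqxx /=.
  have [_ _ _ hL L0] := mL; have [_ _ _ _ L0'] := mL'.
  have n' : 0 < nrm (L' (offset p)) by rewrite nrm_gt0; apply: L0';
    rewrite -/(hole_dist p) e exprn_gt0.
  have n : 0 < nrm (L (L' (offset p))) by rewrite nrm_gt0; apply: L0; rewrite -nrm_gt0.
  have s0 : 0 < 4^-1 / nrm (L' (offset p)) by rewrite divr_gt0.
  rewrite hL ?(ltW s0)// nrm_scal ?(ltW s0)// scalA; congr (_ + scal _ _).
  by field; rewrite !gt_eqF.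
have [-> h'] := blow_interior mL' ip.
rewrite {1}/blow gt_eqF//= {1}/blow gt_eqF; last by have [<-] := blow_interior mL' ip.
rewrite blow_upK//; apply: (toral_hole_dist mL'); exact: blow_down_gt0.
Qed.

Lemma blow_id p : H p -> blow id id p = p.
Proof.
move=> /holed_cases[/hole_boundaryP e|ip]; rewrite /blow; last by rewrite gt_eqF// blow_downK.
rewrite e eqxx.
have -> : nrm (offset p) = 4^-1.
  by apply/eqP; rewrite nrm_eq//; apply/eqP.
by rewrite divff ?invr_eq0// scal1 center_offset.
Qed.

(* One formula for both branches of [blow], whence its continuity at the
   boundary circle. *)
Lemma blow_near_boundary m L q (r := nrm (offset q)) (l := nrm (L (offset q))) :
  toral m L -> H q -> r < 3 / 8 -> 3 * (r - 4^-1) * l < 3 / 8 * r ->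
  blow m L q = m (center_of q) + scal (4^-1 / l + 1 - 4^-1 / r) (L (offset q)).
Proof.
move=> mL Hq r38 small.
have [_ mc mlin hL L0] := mL.
have r4 : 4^-1 <= r by rewrite nrm_le//; exact/holed_planeP.
have r0 : 0 < r by lra.
have l0 : 0 < l by rewrite nrm_gt0; apply: L0; rewrite -nrm_gt0.
have cc := center_center_of q.
move: r4; rewrite le_eqVlt => /orP[/eqP re|r4].
  rewrite /blow; have -> : hole_dist q == 4^-1 ^+ 2 by rewrite -hole_distE -/r -re.
  by congr (_ + scal _ _); rewrite -/l -re; field; rewrite gt_eqF.
have Hq' : 4^-1 ^+ 2 < hole_dist q by rewrite -nrm_lt.
rewrite (blow_interior mL Hq').1 {1}/blow_down /periodize.
have cE : collapse (offset q) = scal (3 - 3 / 4 / r) (offset q).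
  by rewrite /collapse -/r collapse_factor_near// (ltW r4).
have k0 : 0 < 3 - 3 / 4 / r by rewrite subr_gt0 ltr_pdivrMr//; lra.
have kr : (3 - 3 / 4 / r) * r = 3 * r - 3 / 4 by field; rewrite gt_eqF.
have kl : (3 - 3 / 4 / r) * l < 3 / 8.
  have -> : (3 - 3 / 4 / r) * l = 3 * (r - 4^-1) * l / r by field; rewrite gt_eqF.
  by rewrite ltr_pdivrMr.
rewrite cE mlin//; last first.
  have := nrm_scal (offset q) (ltW k0); rewrite -/r kr => e3.
  by rewrite -sqn_lt ?e3; lra.
rewrite hL ?(ltW k0)// /blow_up /periodize.
have s4 : sqn (scal (3 - 3 / 4 / r) (L (offset q))) < 4^-1.
  have -> : 4^-1 = 2^-1 ^+ 2 :> R by field.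
  by rewrite -sqn_lt ?nrm_scal ?(ltW k0)// -/l; lra.
have cm : center (m (center_of q)) by apply/mc.
rewrite offset_center// center_of_center//; congr (_ + _).
(* With [k] the collapse factor, expansion multiplies by [1/3 + 1/(4 k l)]; the total factor
   [k/3 + 1/(4 l)] is [1/(4 l) + 1 - 1/(4 r)]. *)
rewrite /expand nrm_scal ?(ltW k0)// -/l expand_factor_near ?kl ?mulr_gt0//.
rewrite scalA; congr scal.
have n1 : r != 0 by rewrite gt_eqF. have n2 : l != 0 by rewrite gt_eqF.
have n3 : 3 * r - 3 / 4 != 0 by rewrite gt_eqF//; lra.
move: (r) (l) n1 n2 n3 => a b n1 n2 n3; field; rewrite n1 n2 /=.
by apply: contra n3 => /eqP n3; apply/eqP; lra.
Qed.

(** Time is a variable, as isotopies demand. At a boundary point the smallness condition of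
    [blow_near_boundary] reads [0 < 3/32], so its branch-free formula is valid in a
    neighbourhood. *)
Lemma blow_continuous (m L : R -> R * R -> R * R) : (forall t, toral (m t) (L t)) ->
  continuous (fun x : R * (R * R) => m x.1 x.2) ->
  continuous (fun x : R * (R * R) => L x.1 x.2) ->
  {within [set x : R * (R * R) | H x.2], continuous (fun x => blow (m x.1) (L x.1) x.2)}.
Proof.
move=> mL cm cL; apply/subspace_continuousP => -[t p] /= Hp.
set D := [set x : R * (R * R) | H x.2].
change (tends (within D (nbhs (t, p))) (fun x : R * (R * R) =>
  blow (m x.1) (L x.1) x.2) (blow (m t) (L t) p)).
have t1 : tends (within D (nbhs (t, p))) (fun x => x.1) t by apply: tends_fstp; exact: tends_idw.
have t2 : tends (within D (nbhs (t, p))) (fun x => x.2) p by apply: tends_sndp; exact: tends_idw.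
have th : tends (within D (nbhs (t, p))) (fun x => hole_dist x.2) (hole_dist p).
  by apply: (tends_at (h := @hole_dist R) t2); exact: hole_dist_continuous.
have [bp|ip] := holed_cases Hp; last first.
  have n : \forall x \near within D (nbhs (t, p)),
    4^-1 ^+ 2 < hole_dist x.2 by exact: tends_gt th ip.
  apply: (tends_near_eq (g := fun x => blow_up (m x.1 (blow_down x.2)))).
    by apply: filterS n => x hx; rewrite (blow_interior (mL x.1) hx).1.
  rewrite (blow_interior (mL t) ip).1.
  apply: (tends_at (h := blow_up)); last first.
    by apply: blow_up_continuous; apply: (toral_hole_dist (mL t)); exact: blow_down_gt0.
  have td : tends (within D (nbhs (t, p))) (fun x => (x.1, blow_down x.2)) (t, blow_down p).
    apply: tends_pair => //; apply: (tends_at (h := blow_down) t2).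
    by apply: blow_down_continuous; apply: lt_trans ip; rewrite exprn_gt0.
  exact: (tends_at (h := fun x : R * (R * R) => m x.1 x.2) td (cm _)).
have /hole_boundaryP e := bp.
set c := center_of p.
have nc : \forall x \near within D (nbhs (t, p)), center_of x.2 = c.
  have nc : \forall q \near p, center_of q = c by apply: center_of_near; rewrite e; lra.
  exact: (t2 _ nc).
have to : tends (within D (nbhs (t, p))) (fun x => x.2 - c) (offset p).
  by rewrite offsetE -/c; apply: tendsB2 => //; exact: tends_cst.
have FD : Filter (within D (nbhs (t, p))) by exact: within_filter.
have tr := @tends_nrm _ _ FD _ _ to.
have r4 : nrm (offset p) = 4^-1 by apply/eqP; rewrite nrm_eq//; apply/eqP.
have tL : tends (within D (nbhs (t, p))) (fun x => L x.1 (x.2 - c)) (L t (offset p)).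
  have td := @tends_pair _ _ FD _ _ _ _ _ _ t1 to.
  exact: (tends_at (h := fun x : R * (R * R) => L x.1 x.2) td (cL _)).
have tl := @tends_nrm _ _ FD _ _ tL.
have l0 : nrm (L t (offset p)) != 0.
  have [_ _ _ _ L0] := mL t; rewrite gt_eqF// nrm_gt0; apply: L0.
  by rewrite -nrm_gt0 r4 invr_gt0.
have r0 : nrm (offset p) != 0 by rewrite r4 invr_eq0.
have n1 : \forall x \near within D (nbhs (t, p)), nrm (x.2 - c) < 3 / 8.
  by apply: tends_lt tr _; rewrite r4; lra.
have n2 : \forall x \near within D (nbhs (t, p)),
    3 * (nrm (x.2 - c) - 4^-1) * nrm (L x.1 (x.2 - c)) - 3 / 8 * nrm (x.2 - c) < 0.
  apply: (@tends_lt _ _ _ _ _ (3 * (nrm (offset p) - 4^-1) * nrm (L t (offset p)) - 3 / 8 * nrm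
    (offset p))).
    apply: tendsB; apply: tendsM => //; try exact: tends_cst.
    apply: tendsM => //; try exact: tends_cst.
    by apply: tendsB => //; exact: tends_cst.
  by rewrite r4 subrr mulr0 mul0r; lra.
have nD := near_within_mem (T := (R * (R * R))%type) D (t, p).
apply: (tends_near_eq (g := fun x =>
  m x.1 c + scal (4^-1 / nrm (L x.1 (x.2 - c)) + 1 - 4^-1 / nrm (x.2 - c)) (L x.1 (x.2 - c)))).
  apply: filterS2 (filterI nD nc) (filterI n1 n2) => x [Dx xc] [x1 x2].
  have oE : offset x.2 = x.2 - c by rewrite offsetE xc.
  rewrite blow_near_boundary ?oE ?xc//; lra.
rewrite blow_near_boundary//; first last.
- by rewrite r4 subrr mulr0 mul0r; lra.
- by rewrite r4; lra.
apply: tendsD2.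
  have td : tends (within D (nbhs (t, p))) (fun x => (x.1, c)) (t, c).
    by apply: tends_pair => //; exact: tends_cst.
  exact: (tends_at (h := fun x : R * (R * R) => m x.1 x.2) td (cm _)).
apply: tends_scal => //.
apply: tendsB; first apply: tendsD; try exact: tends_cst.
  by apply: tendsM; [exact: tends_cst|exact: tendsV].
by apply: tendsM; [exact: tends_cst|exact: tendsV].
Qed.
End BlowUp.

(** * The linear action on the holed torus and its shears *)

Section LinearMaps.
Variable R : realType.
Implicit Types (p q c v w z : R * R) (M N : 'M[int]_2) (m L : R * R -> R * R) (s : R -> R).
Local Notation H := (@holed_plane R).

Definition lin M v : R * R :=
  ((M 0 0)%:~R * v.1 + (M 0 1)%:~R * v.2, (M 1 0)%:~R * v.1 + (M 1 1)%:~R * v.2).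
Definition hole_center : R * R := (2^-1, 2^-1).
(** The fixed point is a hole centre, not the origin: an integer matrix need not map the
    half-integer points to themselves, whereas this conjugate permutes the hole centres. *)
Definition affine M p : R * R := hole_center + lin M (p - hole_center).

Lemma mulmx2E M N i j : (M *m N) i j = M i 0 * N 0 j + M i 1 * N 1 j.
Proof.
rewrite mxE !big_ord_recl big_ord0 addr0.
by congr (_ * _ + _ * _); congr (_ _ _); apply/val_inj.
Qed.

Lemma lin_mul M N v : lin (M *m N) v = lin M (lin N v).
Proof. by rewrite /lin !mulmx2E !intrD !intrM /=; apply: pair_eqP => /=; ring. Qed.

Lemma lin1 v : lin 1%:M v = v.
Proof. by rewrite /lin !mxE /=; apply: pair_eqP => /=; ring. Qed.

Lemma linD M v w : lin M (v + w) = lin M v + lin M w.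
Proof. by apply: pair_eqP => /=; ring. Qed.

Lemma lin_scal M (a : R) v : lin M (scal a v) = scal a (lin M v).
Proof. by apply: pair_eqP => /=; ring. Qed.

Lemma lin0 M v : sqn v = 0 -> sqn (lin M v) = 0.
Proof.
by move=> /sqn_eq0 ->; rewrite /lin /sqn /= !mulr0 addr0 expr0n addr0.
Qed.

Lemma lin_lattice M z : lattice z -> lattice (lin M z).
Proof. by move=> [z1 z2]; split; rewrite /= rpredD// rpredM// rpred_int. Qed.

Lemma linK M v : M \in unitmx -> lin (invmx M) (lin M v) = v.
Proof. by move=> uM; rewrite -lin_mul mulVmx// lin1. Qed.

Lemma affine_toral M : M \in unitmx -> toral (affine M) (lin M).
Proof.
move=> uM; have aff c w : affine M (c + w) = affine M c + lin M w.
  have e : c + w - hole_center = c - hole_center + w by rewrite addrAC.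
  by rewrite /affine e linD addrA.
have cE q : center q = lattice (q - hole_center) by [].
split => // [p z lz|p|a v _|v v0].
- by rewrite aff addrAC subrr add0r; exact: lin_lattice.
- rewrite !cE /affine addrAC subrr add0r; split => [l|l]; last exact: lin_lattice.
  by rewrite -(linK (p - hole_center) uM); exact: lin_lattice.
- exact: lin_scal.
- rewrite lt_neqAle sqn_ge0 andbT; apply/eqP => e.
  have := lin0 (invmx M) (esym e); rewrite linK// => e'.
  by move: v0; rewrite e' ltxx.
Qed.

Lemma affine_mul M N : affine (M *m N) = affine M \o affine N.
Proof.
by apply/funext => p; rewrite /affine /= lin_mul [hole_center + lin N _]addrC addrK.
Qed.

Definition torus_map M := blow (affine M) (lin M).

Lemma torus_map_mul M N p : M \in unitmx -> N \in unitmx -> H p ->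
  torus_map (M *m N) p = torus_map M (torus_map N p).
Proof.
move=> uM uN Hp; rewrite /torus_map -(blow_comp (affine_toral uM) (affine_toral uN) Hp).
rewrite affine_mul; congr blow.
by apply/funext => v; rewrite /= lin_mul.
Qed.

Lemma torus_map1 p : H p -> torus_map 1%:M p = p.
Proof.
move=> Hp; rewrite -[RHS](blow_id Hp) /torus_map; congr blow; apply/funext => v.
  by rewrite /affine lin1 addrC subrK.
by rewrite lin1.
Qed.

Lemma torus_map_descends M : M \in unitmx -> descends (torus_map M).
Proof. by move=> uM; apply: blow_descends; exact: affine_toral. Qed.

Lemma torus_map_continuous M : M \in unitmx -> {within H, continuous (torus_map M)}.
Proof.
move=> uM; have := @blow_continuous R (fun=> affine M) (fun=> lin M) (fun=> affine_toral uM).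
have c1 : continuous (fun x : R * (R * R) => affine M x.2) by rewrite /affine /lin; cts x.
have c2 : continuous (fun x : R * (R * R) => lin M x.2) by rewrite /lin; cts x.
move=> /(_ c1 c2) cb.
have := within_comp (D := H) (k := fun p => (0 : R, p)) _ _ cb.
apply => //; apply: continuous_subspaceT; cts p.
Qed.

Definition swap p : R * R := (p.2, p.1).
Definition swap_mx : 'M[int]_2 := \matrix_(i, j) (i != j)%:R.

Lemma swapK : involutive swap.
Proof. by case. Qed.

Lemma hole_dist_swap p : hole_dist (swap p) = hole_dist p.
Proof. by rewrite /hole_dist /sqn /= addrC. Qed.

Lemma nrm_swap v : nrm (swap v) = nrm v.
Proof. by rewrite /nrm /sqn /= addrC. Qed.

Lemma torus_map_swap p : H p -> torus_map swap_mx p = swap p.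
Proof.
move=> Hp.
have linE v : lin swap_mx v = swap v by rewrite /lin !mxE /=; apply: pair_eqP => /=; ring.
have affE q : affine swap_mx q = swap q by rewrite /affine linE; apply: pair_eqP => /=; ring.
rewrite /torus_map /blow linE !affE nrm_swap.
have [bp|ip] := holed_cases Hp.
  have /hole_boundaryP e := bp.
  rewrite e eqxx -[p in RHS]center_offset.
  have -> : nrm (offset p) = 4^-1 by apply/eqP; rewrite nrm_eq//; apply/eqP.
  by rewrite divff ?invr_eq0// scal1.
rewrite gt_eqF// -[p in RHS](blow_downK ip).
rewrite /blow_up /periodize /expand -[nrm (offset (swap _))]nrm_swap.
by [].
Qed.

Lemma swap_mxK : swap_mx *m swap_mx = 1%:M.
Proof. by apply/matrixP => i j; rewrite mulmx2E !mxE; case: i j => [[|[|i]] ?] [[|[|j]] ?]. Qed.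

Lemma swap_mx_unit : swap_mx \in unitmx.
Proof. by have [] := mulmx1_unit swap_mxK. Qed.

Definition shear s p : R * R := (p.1 + s p.2, p.2).

Lemma shear_toral s (a : R) :
  (forall y n, n \is a Num.int -> s (y + n) - s y \is a Num.int) ->
  s 2^-1 \is a Num.int ->
  (forall c w : R, c - 2^-1 \is a Num.int -> w ^+ 2 < (3 / 8) ^+ 2 -> s (c + w) = s c + a * w) ->
  toral (shear s) (shear (fun y => a * y)).
Proof.
move=> sp s2 sl.
have sc y : y - 2^-1 \is a Num.int -> s y \is a Num.int.
  move=> yi; have := sp 2^-1 (y - 2^-1) yi; rewrite [2^-1 + _]addrC subrK => h.
  by rewrite -[s y](subrK (s 2^-1)) rpredD.
split.
- move=> p z [z1 z2]; split; rewrite /shear /=.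
    rewrite opprD addrACA [p.1 + _]addrC addrK rpredD//; exact: sp.
  by rewrite addrAC subrr add0r.
- move=> p; split => -[c1 c2]; split => //; rewrite /shear /= in c1 c2 *.
    by rewrite -[p.1](addrK (s p.2)) addrAC rpredB//; exact: sc.
  by rewrite addrAC rpredD//; exact: sc.
- move=> c w [c1 c2] hw; apply: pair_eqP => //=; rewrite sl//; first by ring.
  by apply: le_lt_trans hw; rewrite /sqn lerDr sqr_ge0.
- by move=> t v _; apply: pair_eqP => //=; ring.
- move=> v v0; rewrite lt_neqAle sqn_ge0 andbT; apply/eqP => /esym/sqn_eq0 e.
  have e2 : v.2 = 0 by have := congr1 snd e.
  have := congr1 fst e; rewrite /= e2 mulr0 addr0 => e1.
  by move: v0; rewrite /sqn e1 e2 expr0n addr0 ltxx.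
Qed.

(* Interpolates between the slope-one function [y - 1/2] and a step function
   that is constant near the hole. *)
Definition step t (y : R) : R := let f := y + 2^-1 - (Num.floor (y + 2^-1))%:~R in
  y - 2^-1 + t * (clamp (4 * f - 3 / 2) - f).

Lemma step_int t y n : n \is a Num.int -> step t (y + n) = step t y + n.
Proof.
move=> ni; have e : y + n + 2^-1 = y + 2^-1 + n by ring.
rewrite /step e (floorD_int (y + 2^-1) ni).
have -> : y + 2^-1 + n - ((Num.floor (y + 2^-1))%:~R + n) = y + 2^-1 - (Num.floor (y + 2^-1))%:~R
  by ring.
by ring.
Qed.

Lemma step_cell t y : - 2^-1 <= y < 2^-1 ->
  step t y = y - 2^-1 + t * (clamp (4 * y + 2^-1) - (y + 2^-1)).
Proof.
move=> /andP[y1 y2]; rewrite /step.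
have -> : Num.floor (y + 2^-1) = 0 by apply: floor_def; rewrite add0r; apply/andP; split; lra.
by rewrite mulr0z subr0; congr (_ + t * (clamp _ - _)); lra.
Qed.

(** At [t = 1] the whole rise takes place within 1/8 of the integers, so over the disc of radius 3/8
    about a hole centre the shear is a translation. The split at [w = 0] is due to the floor of
    [y + 1/2] jumping at centres. *)
Lemma step_center t (c w : R) : c - 2^-1 \is a Num.int -> w ^+ 2 < (3 / 8) ^+ 2 ->
  step t (c + w) = c - 2^-1 + (1 - t) * w.
Proof.
move=> ci hw; have w38 : -(3/8) < w < 3/8 by apply/andP; split; nra.
move: w38 => /andP[w1 w2].
have [w0|w0] := ltP w 0.
  have -> : c + w = (w + 2^-1) + (c - 2^-1) by ring.
  rewrite step_int// step_cell; last by apply/andP; split; lra.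
  by rewrite clamp_ge1; [field|lra].
have -> : c + w = (w - 2^-1) + (c - 2^-1 + 1) by field.
have ni : c - 2^-1 + 1 \is a Num.int by rewrite rpredD ?rpred1.
rewrite step_int// step_cell; last by apply/andP; split; lra.
by rewrite clamp_le0; [field|lra].
Qed.

Lemma step_toral t e : e = 1 \/ e = -1 ->
  toral (shear (fun y => e * step t y)) (shear (fun y => e * (1 - t) * y)).
Proof.
move=> e1; have ei : e \is a Num.int by case: e1 => ->; rewrite ?rpredN rpred1.
apply: shear_toral => [y n ni||c w ci hw].
- by rewrite step_int// -mulrBr addrAC subrr add0r rpredM.
- rewrite -[2^-1]addr0 step_center ?subrr ?rpred0//.
    by rewrite mulr0 add0r mulr0 rpred0.
  by rewrite expr0n exprn_gt0// divr_gt0.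
- have := step_center t ci hw => ->.
  by rewrite -[c in step t c]addr0 step_center//; [ring|rewrite expr0n exprn_gt0// divr_gt0].
Qed.

Lemma step_continuous : continuous (fun x : R * R => step x.1 x.2).
Proof.
pose chi (f : R) : R := clamp (4 * f - 3 / 2) - f.
have cchi : continuous (fun y : R => chi (y - (Num.floor y)%:~R)).
  apply: frac_continuous.
    by rewrite /chi; cts x; first [by rewrite pnatr_eq0|exact: clamp_continuous].
  by rewrite /chi clamp_le0 ?clamp_ge1; lra.
rewrite /step -/(chi _) => x; apply: tends_cts; apply: tendsD.
  by apply: tendsB; [tnd|exact: tends_cst].
apply: tendsM; first by tnd.
apply: (tends_at (h := fun y : R => chi (y - (Num.floor y)%:~R)) (f := fun x : R * R =>
  x.2 + 2^-1)); last exact: cchi.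
by apply: tendsD; [tnd|exact: tends_cst].
Qed.

(** With [L] the identity, [m] translates the disc of radius 3/8 about a hole centre onto another
    one, and radial collapse and expansion commute with translations. *)
Lemma blow_isometric m m' p : toral m id -> toral m' id ->
  (forall q, m' (m q) = q) -> H p -> blow m id p = m p.
Proof.
move=> mL mL' m'm Hp.
have [_ mc ml _ _] := mL; have [_ mc' ml' _ _] := mL'.
have cc := center_center_of p.
have [bp|ip] := holed_cases Hp.
  have /hole_boundaryP e := bp.
  rewrite /blow e eqxx -[p in RHS]center_offset ml//; last first.
    by rewrite -/(hole_dist p) e ltr_pXn2r ?nnegrE//; lra.
  have -> : nrm (offset p) = 4^-1 by apply/eqP; rewrite nrm_eq//; apply/eqP.
  by rewrite divff ?invr_eq0// scal1.
rewrite (blow_interior mL ip).1.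
have [near|far] := ltP (hole_dist p) ((3 / 8) ^+ 2).
  have cs : sqn (collapse (offset p)) < (3 / 8) ^+ 2.
    rewrite -sqn_lt; last by lra.
    have r1 : nrm (offset p) < 3 / 8 by apply: near_nrm.
    have r2 : 4^-1 <= nrm (offset p) by rewrite nrm_le// ltW.
    by rewrite collapse_near ?r2//; lra.
  rewrite /blow_down /periodize ml// /blow_up /periodize.
  have cm : center (m (center_of p)) by apply/mc.
  have cs' : sqn (collapse (offset p)) < 4^-1 by exact: collapse_bound.
  by rewrite offset_center// center_of_center// collapseK// -ml// center_offset.
rewrite /blow_down periodize_far//; last exact: supported_collapse.
rewrite /blow_up periodize_far//; first exact: supported_expand.
(* A point far from the holes stays far: otherwise the inverse, also a translation near the holes,
   would bring it back near. *)
rewrite leNgt; apply/negP => h.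
have e : p = m' (center_of (m p)) + offset (m p) by rewrite -ml' ?center_offset ?m'm//;
  exact: center_center_of.
have cm' : center (m' (center_of (m p))) by apply/mc'; exact: center_center_of.
have h4 : sqn (offset (m p)) < 4^-1 by apply: lt_trans h _; lra.
have : hole_dist p = hole_dist (m p) by rewrite {1}/hole_dist {1}e offset_center.
by move=> e'; move: far; rewrite e' leNgt h.
Qed.
End LinearMaps.

(** * Dehn twists as shears *)

Section HandleTwist.
Variables (R : realType) (S : topologicalType) (O : set (R * R -> S)).
Hypotheses (hS : hausdorff_space S) (orO : orientation O).
Implicit Types (p q z : R * R) (e : int) (h : R * R -> S).
Local Notation H := (@holed_plane R).

(** Exchanges the roles of axis and transverse coordinate: a rotation for [e = 1] and a reflection
    for [e = -1]. Composed with a handle of sign [e] it is positively oriented in both cases. *)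
Definition across e p : R * R := (p.2, - (e%:~R * p.1)).

Lemma across_circle e p r s : e = 1 \/ e = -1 ->
  across e (circle_pt p r s) = circle_pt (across e p) r (e%:~R * s + - (e%:~R * (pi / 2))).
Proof.
rewrite /across /circle_pt /= => -[->|->].
  by rewrite !mul1r cosB sinB cos_pihalf sin_pihalf; apply: pair_eqP => /=; ring.
have -> : (-1)%:~R * s + - ((-1)%:~R * (pi / 2)) = pi / 2 - s :> R.
  by rewrite -[(-1)%:~R]/(-1 : R); ring.
by rewrite cosB sinB cos_pihalf sin_pihalf; apply: pair_eqP => /=; rewrite -?[(-1)%:~R]/(-1 : R);
  ring.
Qed.

Lemma cell_small (x : R) : - 8^-1 <= x <= 8^-1 -> (3 / 8) ^+ 2 <= cell x ^+ 2.
Proof.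
move=> /andP[x1 x2]; rewrite /cell; have [x0|x0] := ltP x 0.
  have -> : Num.floor x = -1 by apply: floor_def; rewrite -[(-1)%:~R]/(-1 : R) addNr; apply/andP;
    split; lra.
  by rewrite -[(-1)%:~R]/(-1 : R); nra.
have -> : Num.floor x = 0 by apply: floor_def; rewrite add0r; apply/andP; split; lra.
by rewrite mulr0z; nra.
Qed.

Lemma cell_large (x : R) : - 2^-1 <= x < 2^-1 -> (3 / 8) ^+ 2 < cell x ^+ 2 -> - 8^-1 < x < 8^-1.
Proof.
move=> /andP[x1 x2]; rewrite /cell; have [x0|x0] := ltP x 0.
  have -> : Num.floor x = -1 by apply: floor_def; rewrite -[(-1)%:~R]/(-1 : R) addNr; apply/andP;
    split; lra.
  by rewrite -[(-1)%:~R]/(-1 : R) => hh; apply/andP; split; nra.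
have -> : Num.floor x = 0 by apply: floor_def; rewrite add0r; apply/andP; split; lra.
by rewrite mulr0z => hh; apply/andP; split; nra.
Qed.

Lemma near_axis_dist p : (3 / 8) ^+ 2 <= cell p.2 ^+ 2 -> 4^-1 ^+ 2 < hole_dist p.
Proof. by rewrite /hole_dist /sqn /= => h; have := sqr_ge0 (cell p.1); lra. Qed.

Lemma near_axis_holed p : (3 / 8) ^+ 2 <= cell p.2 ^+ 2 -> H p.
Proof. by move=> /near_axis_dist h; apply/holed_planeP; exact: ltW. Qed.

Lemma reduce_second p : exists2 z, lattice z & - 2^-1 <= (p + z).2 < 2^-1 /\ (p + z).1 = p.1.
Proof.
exists (0, - (Num.floor (p.2 + 2^-1))%:~R); first by split; rewrite /= ?rpred0 ?rpredN ?rpred_int.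
have /andP[h1 h2] := frac_itv (p.2 + 2^-1).
by split; rewrite /= ?addr0//; apply/andP; split; lra.
Qed.

Section OneHandle.
Variables (h h' : R * R -> S) (e : int).
Hypothesis hh : handles h h'.
Hypothesis e1 : e = 1 \/ e = -1.

Let ee : e%:~R * e%:~R = 1 :> R.
Proof. by case: e1 => ->; rewrite ?mulr1 // -[(-1)%:~R]/(-1 : R) mulrNN mulr1. Qed.

Let e_int (x : R) : e%:~R * x \is a Num.int -> x \is a Num.int.
Proof. by move=> hx; rewrite -[x]mul1r -ee -mulrA rpredM// rpred_int. Qed.

Let e_band (c x : R) : - c <= e%:~R * x <= c <-> - c <= x <= c.
Proof.
by case: e1 => ->; rewrite ?mul1r// -[(-1)%:~R]/(-1 : R) mulN1r; split => /andP[a b]; apply/andP;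
  split; lra.
Qed.

Let e_open_band (c x : R) : - c < e%:~R * x < c <-> - c < x < c.
Proof.
by case: e1 => ->; rewrite ?mul1r// -[(-1)%:~R]/(-1 : R) mulN1r; split => /andP[a b]; apply/andP;
  split; lra.
Qed.

Let e_opp (c x : R) : - c <= x <= c -> - c <= - x <= c.
Proof. by move=> /andP[a b]; apply/andP; split; lra. Qed.

Lemma across_band p : band 8^-1 p -> (3 / 8) ^+ 2 <= cell (across e p).2 ^+ 2.
Proof. by move=> bp; apply: cell_small; apply: e_opp; apply/e_band. Qed.

(** Half-width 1/8 keeps the band at distance at least 3/8 from the hole centres. Its interior has
    the same image as a lattice-invariant open set, to which [handle_open] applies. *)
Lemma axis_annulus : annulus 8^-1 (h \o across e).
Proof.
have [[[ch ih] _] _ _] := hh.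
have bH p : band 8^-1 p -> H (across e p) by move=> /across_band; exact: near_axis_holed.
split; first by rewrite invr_gt0.
- apply: (within_comp (E := H)) ch => //.
  by apply: continuous_subspaceT; rewrite /across; cts p.
- move=> p q pb qb /=; rewrite (ih _ _ (bH _ pb) (bH _ qb)) /lattice /across /=.
  have -> : - (e%:~R * p.1) - - (e%:~R * q.1) = e%:~R * (q.1 - p.1) :> R by ring.
  split => [[i1 /e_int i2]|[i1 i2]]; last by split; rewrite // i1 subrr mulr0 rpred0.
  split => //; apply/esym/eqP; rewrite -subr_eq0; apply/eqP; apply: int_small => //.
  by move: pb qb; rewrite /band /= => /andP[a1 a2] /andP[b1 b2]; apply/andP; split; lra.
- pose U : set (R * R) := [set p | (3 / 8) ^+ 2 < cell p.2 ^+ 2].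
  have -> : (h \o across e) @` open_band 8^-1 = h @` U.
    apply/seteqP; split => [_ [p bp <-]|_ [p Up <-]].
      exists (across e p) => //; rewrite /U /= lt_neqAle across_band ?andbT;
        last exact: open_band_sub.
      apply/eqP => ed; move: bp => /= bp.
      have : - 8^-1 < - (e%:~R * p.1) < 8^-1.
        by move/e_open_band: bp => /andP[a b]; apply/andP; split; lra.
      move: (- _) ed => x; rewrite /cell => ed /andP[x1 x2].
      have [x0|x0] := ltP x 0.
        have fx : Num.floor x = -1 by apply: floor_def; rewrite -[(-1)%:~R]/(-1 : R) addNr;
          apply/andP; split; lra.
        by move: ed; rewrite fx -[(-1)%:~R]/(-1 : R) => ed; nra.
      have fx : Num.floor x = 0 by apply: floor_def; rewrite add0r; apply/andP; split; lra.
      by move: ed; rewrite fx mulr0z => ed; nra.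
    have [z lz [bz z1]] := reduce_second p.
    have Hp : H p by apply: near_axis_holed; exact: ltW.
    have cz : (3 / 8) ^+ 2 < cell (p + z).2 ^+ 2.
      by have := congr1 snd (offset_lattice p lz) => /= ->.
    have := cell_large bz cz; set w := p + z => hw.
    exists (- (e%:~R * w.2), w.1).
      rewrite /open_band /= -mulrN; apply/e_open_band.
      by move: hw; rewrite /w /= => /andP[a b]; apply/andP; split; lra.
    have wE q : across e (- (e%:~R * q.2), q.1) = q.
      by rewrite /across /= mulrN opprK mulrA ee mul1r -surjective_pairing.
    by rewrite [LHS]/= (wE w) /w handle_lattice.
  apply: (handle_open hS hh).
  + rewrite (_ : U = (fun p : R * R => cell p.2 ^+ 2) @^-1` [set x | (3 / 8) ^+ 2 < x])//.
    apply: open_comp; last exact: open_gt.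
    move=> x _; apply: tends_cts.
    by apply: (tends_at (h := fun x : R => cell x ^+ 2) (f := snd));
      [tnd|exact: cell_sqr_continuous].
  + by move=> p Up; apply: near_axis_dist; exact: ltW.
  + move=> p z lz; rewrite /U /=.
    by have := congr1 snd (offset_lattice p lz) => /= ->.
Qed.

Lemma axis_core : range (fun y : R => (h \o across e) (0, y)) = h @` [set p | p.2 = 0].
Proof.
apply/seteqP; split => [_ [y _ <-]|_ [p /= p2 <-]].
  by exists (across e (0, y)) => //=; rewrite mulr0 oppr0.
by exists p.1 => //; rewrite /across /= mulr0 oppr0 -p2 -surjective_pairing.
Qed.

Lemma axis_sign : (forall x, has_sign O h (x, 0) e) ->
  forall y, has_sign O (h \o across e) (0, y) 1.
Proof.
move=> sh y; have [[hdl _] _ _] := hh.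
have aE : across e (0, y) = (y, 0) by rewrite /across /= mulr0 oppr0.
have [r r0 [er _]] : exists2 r, 0 < r & emb_disc h (y, 0) r /\ forall q, disc (y, 0) r q ->
  4^-1 ^+ 2 < hole_dist q.
  apply: handle_emb => //; apply: near_axis_dist; apply: cell_small => /=.
  by apply/andP; split; lra.
suff: has_sign O (h \o across e) (0, y) (e * e) by case: e1 => ->.
apply: (has_sign_comp orO r0 er _ _ (sh y)); first by rewrite /= aE.
rewrite -aE; apply: degree_at_isometry => r' s.
exact: across_circle.
Qed.

Definition ramp (x y : R) : R := y + clamp (4 * x + 2^-1).

Lemma ramp_profile : profile 8^-1 ramp.
Proof.
apply: (@shift_profile R 8^-1 (fun x => clamp (4 * x + 2^-1))).
- by cts x; first [by rewrite pnatr_eq0|exact: clamp_continuous].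
- by rewrite clamp_le0//; lra.
- by rewrite clamp_ge1//; lra.
Qed.

Lemma clampN (x : R) : clamp (1 - x) = 1 - clamp x.
Proof.
have [x0|x0] := leP x 0; first by rewrite clamp_ge1 ?clamp_le0//; lra.
have [x1|x1] := leP 1 x; first by rewrite clamp_le0 ?clamp_ge1//; lra.
by rewrite !clampid//; apply/andP; split; lra.
Qed.

Lemma axis_twist_other p : H p -> twist (h \o across e) 8^-1 ramp (h' p) = h' p.
Proof.
move=> Hp; have [_ _ meet] := hh; apply: twist_out => -[q bq qp].
have := across_band bq => /[dup] /near_axis_holed Hq /near_axis_dist.
have [/hole_boundaryP -> _] := meet _ _ Hq Hp qp.
by rewrite ltxx.
Qed.

(** In the coordinates [across e] the ramp acts on the first coordinate of the handle as a function
    of the second, which is a step; the sign of the slope is opposite to that of the handle. Both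
    sides are compared modulo the lattice. *)
Lemma axis_twist p : H p ->
  twist (h \o across e) 8^-1 ramp (h p) = h (shear (fun y => - e%:~R * step 1 y) p).
Proof.
move=> Hp; have [[hdl _] _ meet] := hh; have [_ ih] := hdl.
have tor : toral (shear (fun y : R => - e%:~R * step 1 y)) (shear (fun y => - e%:~R * (1 - 1) * y)).
  by apply: step_toral; case: e1 => ->; [right|left; rewrite -[(-1)%:~R]/(-1 : R) opprK].
have shear_H q z : lattice z -> H q -> h (shear (fun y =>
  - e%:~R * step 1 y) (q + z)) = h (shear (fun y => - e%:~R * step 1 y) q).
  move=> lz Hq; have [sl _ _ _ _] := tor.
  have Hs : H (shear (fun y => - e%:~R * step 1 y) q).
    have -> : shear (fun y => - e%:~R * step 1 y) q = blow (shear (fun y =>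
      - e%:~R * step 1 y)) (shear (fun y => - e%:~R * (1 - 1) * y)) q.
      have idE (a : R) : shear (fun y : R => a * (1 - 1) * y) = id.
        by apply/funext => w; rewrite /shear subrr mulr0 mul0r addr0 -surjective_pairing.
      have tor' : toral (shear (fun y : R => e%:~R * step 1 y)) id.
        by rewrite -[X in toral _ X](idE e%:~R); apply: step_toral; case: e1 => ->; [left|right].
      move: tor; rewrite idE => tor.
      rewrite (blow_isometric tor tor' _ Hq)// => w.
      by rewrite /shear /= mulNr subrK -surjective_pairing.
    by have [dH _ _] := blow_descends tor; exact: dH.
  set a := shear _ q; have -> : shear (fun y =>
    - e%:~R * step 1 y) (q + z) = a + (shear (fun y => - e%:~R * step 1 y) (q + z) - a).
    by rewrite [RHS]addrC subrK.
  by apply: handle_lattice => //; exact: sl.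
have [z lz [/[dup] bz /andP[z1 z2] _]] := reduce_second p.
rewrite -(shear_H p z lz Hp) -(handle_lattice hdl Hp lz).
have Hw := holed_lattice lz Hp; move: (p + z) bz z1 z2 Hw => {p z Hp lz} w bz z1 z2 Hw.
have st : step 1 w.2 = clamp (4 * w.2 + 2^-1) - 1 by rewrite step_cell//; field.
(* For [e = 1] the reflection of [clamp] gives exact agreement; for [e = -1] the ramp starts one
   unit above the step, hence the shift -1. *)
have sE : exists2 n : int, shear (fun y =>
  - e%:~R * step 1 y) w = (w.1 + clamp (4 * (- (e%:~R * w.2)) + 2^-1), w.2) + (n%:~R, 0) & True.
  rewrite /shear st; case: e1 => ->.
    exists 0 => //; rewrite mul1r.
    have -> : 4 * - w.2 + 2^-1 = 1 - (4 * w.2 + 2^-1) by field.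
    by rewrite clampN; apply: pair_eqP => /=; ring.
  exists (-1) => //; rewrite -[(-1)%:~R]/(-1 : R) !mulN1r !opprK mul1r.
  by apply: pair_eqP => /=; ring.
have [n -> _] := sE.
have ln : lattice (n%:~R, 0 : R) by split; rewrite /= ?rpred_int ?rpred0.
have aA := axis_annulus.
have [/[dup] bw /andP[w1 w2]|nw] := boolP (- 8^-1 <= w.2 <= 8^-1).
  have wE : w = across e (- (e%:~R * w.2), w.1).
    by rewrite /across /= mulrN opprK mulrA ee mul1r -surjective_pairing.
  have bx : band 8^-1 (- (e%:~R * w.2), w.1).
    by rewrite /band /= -mulrN; apply/e_band; apply: e_opp.
  have -> : h w = (h \o across e) (- (e%:~R * w.2), w.1) by rewrite /= -wE.
  rewrite (twist_band aA (fun x y n => profile_int x y n ramp_profile))//= /ramp.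
  have -> : across e (- (e%:~R * w.2),
    w.1 + clamp (4 * - (e%:~R * w.2) + 2^-1)) = (w.1 + clamp (4 * - (e%:~R * w.2) + 2^-1), w.2).
    by rewrite /across /= mulrN opprK mulrA ee mul1r.
  rewrite handle_lattice//; apply: near_axis_holed => /=; exact: cell_small.
rewrite twist_out; last first.
  move=> [q bq]; rewrite /= => /ih-/(_ _ Hw)[]; first by apply: near_axis_holed; exact: across_band.
  rewrite /across /= => _ i2.
  have : - 8^-1 <= - (e%:~R * q.1) <= 8^-1 by apply: e_opp; apply/e_band.
  move=> /andP[q1 q2].
  have : - (e%:~R * q.1) - w.2 = 0 by apply: int_small => //; apply/andP; split; lra.
  by move=> ez; move: nw => /negP; apply; apply/andP; split; lra.
have [m mE] : exists m : int, clamp (4 * - (e%:~R * w.2) + 2^-1) = m%:~R :> R.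
  have : 4 * - (e%:~R * w.2) + 2^-1 <= 0 \/ 1 <= 4 * - (e%:~R * w.2) + 2^-1.
    move: nw; rewrite negb_and -!ltNge => /orP[] hw; case: e1 => ->;
      rewrite ?mul1r -?[(-1)%:~R]/(-1 : R) ?mulN1r.
    - by right; lra.
    - by left; lra.
    - by left; lra.
    - by right; lra.
  by case=> hc; [exists 0; rewrite clamp_le0|exists 1; rewrite clamp_ge1].
rewrite mE; have -> : (w.1 + m%:~R, w.2) + (n%:~R, 0) = w + ((m + n)%:~R, 0).
  by apply: pair_eqP => /=; rewrite ?intrD; ring.
by rewrite handle_lattice//; split; rewrite /= ?rpred_int ?rpred0.
Qed.
End OneHandle.
End HandleTwist.

Section TwistDifference.
Variables (R : realType) (S : topologicalType) (O : set (R * R -> S)).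
Hypotheses (cS : compact [set: S]) (hS : hausdorff_space S) (orO : orientation O).
Implicit Types (p q z : R * R) (e d : int) (h : R * R -> S).
Local Notation H := (@holed_plane R).

Definition upper_mx : 'M[int]_2 := \matrix_(i, j) (i <= j)%N%:R.

Lemma tends_step {T : Type} {F : set_system T} {FF : Filter F} (f g : T -> R) a b :
  tends F f a -> tends F g b -> tends F (fun x => step (f x) (g x)) (step a b).
Proof.
move=> tf tg; have t : tends F (fun x => (f x, g x)) (a, b) by exact: tends_pair.
exact: (tends_at (h := fun x : R * R => step x.1 x.2) t (@step_continuous R _)).
Qed.

Lemma upper_mx_unit : upper_mx \in unitmx.
Proof.
suff /mulmx1_unit[] : upper_mx *m (\matrix_(i, j) ((i == j)%:R - (i < j)%N%:R)) = 1%:M by [].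
by apply/matrixP => i j; rewrite mulmx2E !mxE; case: i j => [[|[|i]] ?] [[|[|j]] ?].
Qed.

Lemma step_descends e : e = 1 \/ e = -1 -> descends (shear (fun y : R => e%:~R * step 1 y)) /\
  (forall p, H p -> blow (shear (fun y : R => e%:~R * step 1 y)) id p = shear (fun y : R =>
    e%:~R * step 1 y) p).
Proof.
move=> e1.
have idE (a : R) : shear (fun y : R => a * (1 - 1) * y) = id.
  by apply/funext => w; rewrite /shear subrr mulr0 mul0r addr0 -surjective_pairing.
have t1 : toral (shear (fun y : R => e%:~R * step 1 y)) id.
  by rewrite -[X in toral _ X](idE e%:~R); apply: step_toral; case: e1 => ->; [left|right].
have t2 : toral (shear (fun y : R => - e%:~R * step 1 y)) id.
  rewrite -[X in toral _ X](idE (- e%:~R)); apply: step_toral; case: e1 => ->; [right|left] => //.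
  by rewrite -[(-1)%:~R]/(-1 : R) opprK.
have bE p : H p -> blow (shear (fun y : R => e%:~R * step 1 y)) id p = shear (fun y : R =>
  e%:~R * step 1 y) p.
  move=> Hp; rewrite (blow_isometric t1 t2 _ Hp)// => w.
  by rewrite /shear /= mulNr addrK -surjective_pairing.
have [d1 d2 d3] := blow_descends t1.
split => //; split => [p Hp|p q Hp Hq|p bp].
- by rewrite -bE//; exact: d1.
- by rewrite -!bE//; exact: d2.
- by rewrite -bE//; [exact: d3|exact: boundary_holed].
Qed.

Section Shear.
Variables (h h' : R * R -> S).
Hypothesis hh : glued h h'.

(** The slope near the holes is [1 - t]: at time 0 the shear is affine, at time 1 it is a
    translation near the holes and the blow-up changes nothing. The shears of opposite slope provide
    the inverses. *)
Lemma shear_isotopic :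
  isotopic R (desc h h' (torus_map upper_mx)) (desc h h' (shear (step 1))).
Proof.
pose m (e : R) (t : R) := shear (fun y : R => e * step t y).
pose L (e : R) (t : R) := shear (fun y : R => e * (1 - t) * y).
have tor (e t : R) : e = 1 \/ e = -1 -> toral (m e t) (L e t) by exact: step_toral.
have p1 : (1 : R) = 1 \/ (1 : R) = -1 by left. have n1 : (-1 : R) = 1 \/ (-1 : R) = -1 by right.
have mK (e t : R) : m e t \o m (- e) t = id.
  by apply/funext => p; rewrite /m /shear /= mulNr subrK -surjective_pairing.
have LK (e t : R) : L e t \o L (- e) t = id.
  by apply/funext => p; rewrite /L /shear /= !mulNr subrK -surjective_pairing.
have bK (e t : R) p : e = 1 \/ e = -1 -> - e = 1 \/ - e = -1 -> H p ->
    blow (m e t) (L e t) (blow (m (- e) t) (L (- e) t) p) = p.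
  move=> e1 e2 Hp; rewrite -(blow_comp (tor _ _ e1) (tor _ _ e2) Hp) mK LK.
  exact: blow_id.
have nn : (- -1 : R) = 1 \/ (- -1 : R) = -1 by rewrite opprK; left.
have cm : continuous (fun x : R * (R * R) => m 1 x.1 x.2).
  rewrite /m /shear; move=> x; apply: tends_cts; apply: tends_pair; last by tnd.
  apply: tendsD; first by tnd.
  apply: tendsM; first exact: tends_cst.
  by apply: tends_step; tnd.
have cL : continuous (fun x : R * (R * R) => L 1 x.1 x.2) by rewrite /L /shear; cts x.
have iso := desc_isotopic cS hS hh (K := fun t => blow (m 1 t) (L 1 t)) (L := fun t =>
  blow (m (-1) t) (L (-1) t))
  (fun t => blow_descends (tor 1 t p1)) (fun t => blow_descends (tor (-1) t n1))
  (blow_continuous (fun t => tor 1 t p1) cm cL)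
  (fun t p Hp => bK 1 t p p1 n1 Hp) _.
have e0 : blow (m 1 0) (L 1 0) = torus_map upper_mx.
  rewrite /torus_map; congr blow; apply/funext => w.
    rewrite /m /affine /lin /shear /step mul0r addr0 mul1r !mxE /=.
    by apply: pair_eqP => /=; rewrite ?mul0r ?mul1r; field.
  by rewrite /L /lin /shear !mxE /=; apply: pair_eqP => /=; ring.
have e1 : desc h h' (blow (m 1 1) (L 1 1)) = desc h h' (shear (step 1)).
  have sE : (fun y : R => 1%:~R * step 1 y) = step 1 by apply/funext => y; rewrite mul1r.
  have [ds bs] := step_descends (or_introl (erefl (1 : int))).
  rewrite sE in ds bs; have LE : L 1 1 = id.
    by apply/funext => w; rewrite /L /shear subrr mulr0 mul0r addr0 -surjective_pairing.
  apply/funext; apply: eq_desc => //; first exact: (blow_descends (tor 1 1 p1)).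
  by move=> p Hp; rewrite LE /m sE bs.
rewrite -e0 -e1; apply: iso => t p Hp.
by have := bK (-1) t p n1 nn Hp; rewrite opprK.
Qed.

(** On the first half the twist undoes the step shear. On the second half, of opposite sign, the
    other twist is the same step shear. Hence the shear is the first twist inverted, followed after
    the second. *)
Lemma shear_twist x :
  twist (h \o across 1) 8^-1 (@ramp R) (desc h h' (shear (step 1)) x) =
  twist (h' \o across (-1)) 8^-1 (@ramp R) x.
Proof.
have [hd gl] := hh; have hd' := handles_sym hd.
have o1 : (1 : int) = 1 \/ (1 : int) = -1 by left.
have on1 : (-1 : int) = 1 \/ (-1 : int) = -1 by right.
have sE : (fun y : R => 1%:~R * step 1 y) = step 1 by apply/funext => y; rewrite mul1r.
have [ds _] := step_descends o1; rewrite sE in ds; have [dsH _ _] := ds.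
move: x; apply: (handles_ind hh) => p Hp.
  rewrite (desc_left hh ds Hp) (axis_twist hS hd o1 (dsH _ Hp)) (axis_twist_other hd' on1 Hp).
  by congr h; rewrite /shear /= mulN1r addrK -surjective_pairing.
rewrite (desc_right hh ds Hp) (axis_twist_other hd o1 (dsH _ Hp)) (axis_twist hS hd' on1 Hp).
by congr h'; congr (shear _ _); apply/funext => y; rewrite -[(-1)%:~R]/(-1 : R) opprK mul1r.
Qed.

(** With model twists [T1], [T2] and the step shear [D]: the class contains the inverse of [f1]
    after [f2], which is isotopic to the inverse of [f1] after [T2], that is, after [T1 \o D]; as
    [f1] is isotopic to [T1], this deforms to [D] and then to the blown-up linear shear. *)
Lemma twist_difference t t' (f : homeo O) :
  (forall x, has_sign O h (x, 0) 1) -> (forall x, has_sign O h' (x, 0) (-1)) ->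
  left_dehn_twist (h @` [set p | p.2 = 0]) t ->
  left_dehn_twist (h' @` [set p | p.2 = 0]) t' ->
  isotopy_class f = (t^-1 * t')%g -> isotopic R f (desc h h' (torus_map upper_mx)).
Proof.
move=> s1 s2 d1 d2 fE.
have [hd gl] := hh; have hd' := handles_sym hd.
have o1 : (1 : int) = 1 \/ (1 : int) = -1 by left.
have on1 : (-1 : int) = 1 \/ (-1 : int) = -1 by right.
have [A1 [c1 [P1 [f1 [[aA1 pr1] r1 sA1 t1 f1E]]]]] := dehn_twist_annulus hS orO d1.
have [A2 [c2 [P2 [f2 [[aA2 pr2] r2 sA2 t2 f2E]]]]] := dehn_twist_annulus hS orO d2.
have aB1 := axis_annulus hS hd o1; have aB2 := axis_annulus hS hd' on1.
have i1 := twist_unique cS hS orO aA1 aB1 (etrans r1 (esym (axis_core h 1)))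
  sA1 (axis_sign orO hd o1 s1) pr1 (@ramp_profile R).
have i2 := twist_unique cS hS orO aA2 aB2 (etrans r2 (esym (axis_core h' (-1))))
  sA2 (axis_sign orO hd' on1 s2) pr2 (@ramp_profile R).
have {}f1E : (f1 : S -> S) = twist A1 c1 P1 by apply/funext.
have {}f2E : (f2 : S -> S) = twist A2 c2 P2 by apply/funext.
rewrite -f1E in i1; rewrite -f2E in i2.
set T1 := twist (h \o across 1) _ _ in i1; set T2 := twist (h' \o across (-1)) _ _ in i2.
have hT1 : homeomorphism T1 by exact: (twist_homeomorphism cS hS aB1 (@ramp_profile R)).
have hT2 : homeomorphism T2 by exact: (twist_homeomorphism cS hS aB2 (@ramp_profile R)).
set D := desc h h' (shear (step 1)).
have T12 : T1 \o D = T2 by apply/funext => x; exact: shear_twist.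
have fE' : isotopic R f (homeoM (homeoV f1) f2).
  by apply/isotopy_classP; rewrite -Mod_mulE -Mod_invE fE t1 t2.
have h1V : homeomorphism (homeo_inv f1) by exact: (homeoP (homeoV f1)).
have sE : (fun y : R => 1%:~R * step 1 y) = step 1 by apply/funext => y; rewrite mul1r.
have hD : homeomorphism D.
  have [dp _] := step_descends o1; have [dn _] := step_descends on1.
  rewrite sE in dp; apply: (desc_homeomorphism cS hS hh dp dn).
  - apply: continuous_subspaceT => p; apply: tends_cts; apply: tends_pair; last by tnd.
    apply: tendsD; first by tnd.
    by apply: (tends_step (f := fun=> 1)); tnd.
  - move=> p _; rewrite /shear /= -[(-1)%:~R]/(-1 : R) mulN1r.
    by rewrite subrK -surjective_pairing.
  - move=> p _; rewrite /shear /= -[(-1)%:~R]/(-1 : R) mulN1r.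
    by rewrite addrK -surjective_pairing.
have j1 : isotopic R (homeoM (homeoV f1) f2) (homeo_inv f1 \o T2).
  exact: (isotopic_compl h1V i2).
have j2 : isotopic R (homeo_inv f1 \o T2) (homeo_inv f1 \o f1 \o D).
  rewrite -T12; apply: isotopic_sym.
  exact: (isotopic_compl h1V (isotopic_compr hD i1)).
have e1 : homeo_inv f1 \o f1 \o D = D by apply/funext => x /=; rewrite homeoK.
rewrite e1 in j2.
have k1 : isotopic R (homeoM (homeoV f1) f2) D.
  by apply: isotopic_trans_homeomorphism j1 j2; exact: homeomorphism_comp.
apply: isotopic_trans_homeomorphism fE' _; first exact: homeoP.
apply: isotopic_trans_homeomorphism k1 _ => //.
by apply: isotopic_sym; exact: shear_isotopic.
Qed.
End Shear.

Lemma sign_along h (gam : R -> R * R) d : handle h -> continuous gam ->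
  (forall t, 4^-1 ^+ 2 < hole_dist (gam t)) ->
  has_sign O h (gam 0) d -> has_sign O h (gam 1) d.
Proof.
move=> hd cg gH; apply: (has_sign_path orO cg) => t _.
by have [r r0 [er _]] := handle_emb hd (gH t); exists r.
Qed.

Lemma sign_horizontal h d : handle h -> has_sign O h (0, 0) d -> forall x, has_sign O h (x, 0) d.
Proof.
move=> hd h0 x; have := @sign_along h (fun t => (t * x, 0)) d hd.
rewrite mul0r mul1r; apply => //; first by cts t.
by move=> t; apply: near_axis_dist; apply: cell_small; apply/andP; split => /=; lra.
Qed.

Lemma sign_vertical h d : handle h -> has_sign O h (0, 0) d -> forall y, has_sign O h (0, y) d.
Proof.
move=> hd h0 y; have := @sign_along h (fun t => (0, t * y)) d hd.
rewrite mul0r mul1r; apply => //; first by cts t.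
move=> t; rewrite -hole_dist_swap; apply: near_axis_dist; apply: cell_small.
by apply/andP; split => /=; lra.
Qed.

Lemma swap_circle p r s : swap (circle_pt p r s) = circle_pt (swap p) r ((-1)%:~R * s + pi / 2).
Proof.
have -> : (-1)%:~R * s + pi / 2 = pi / 2 - s :> R by rewrite -[(-1)%:~R]/(-1 : R); ring.
by rewrite /circle_pt /swap cosB sinB cos_pihalf sin_pihalf; apply: pair_eqP => /=; ring.
Qed.

(** Exchanging the coordinates is a reflection, which is why the two handles trade places when
    longitudes are treated as meridians. *)
Lemma sign_swap h d p : handle h -> 4^-1 ^+ 2 < hole_dist (swap p) ->
  has_sign O h (swap p) d -> has_sign O (h \o swap (R := R)) p (- d).
Proof.
move=> hd hp sd; have [r r0 [er _]] := handle_emb hd hp.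
rewrite -mulN1r; apply: (has_sign_comp orO r0 er _ _ sd) => //.
exact: (degree_at_isometry (a := pi / 2) (e := -1) h (swap_circle p)).
Qed.

Lemma handle_swap h : handle h -> handle (h \o swap (R := R)).
Proof.
move=> [ch ih]; have Hs p : H p -> H (swap p).
  by move=> /holed_planeP e; apply/holed_planeP; rewrite hole_dist_swap.
split; first by apply: (within_comp (E := H)) ch => //; apply: continuous_subspaceT;
  rewrite /swap; cts p.
move=> p q Hp Hq /=; rewrite (ih _ _ (Hs _ Hp) (Hs _ Hq)).
by split=> -[a b].
Qed.

Lemma glued_swap h h' : glued h h' -> glued (h \o swap (R := R)) (h' \o swap (R := R)).
Proof.
have Hs p : H (swap p) <-> H p.
  by split => /holed_planeP e; apply/holed_planeP; move: e; rewrite hole_dist_swap.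
have bs p : @hole_boundary R (swap p) <-> @hole_boundary R p.
  by split => /hole_boundaryP e; apply/hole_boundaryP; move: e; rewrite hole_dist_swap.
move=> [[[a b] cov meet] gl]; split; last by move=> p /bs; exact: gl.
split; first by split; exact: handle_swap.
  move=> x; case: (cov x) => -[p Hp <-]; [left|right]; exists (swap p); rewrite ?Hs//=;
    by case: p Hp.
by move=> p q Hp Hq /= e; have [/bs ? /bs ?] := meet _ _ ((Hs p).2 Hp) ((Hs q).2 Hq) e.
Qed.

Lemma desc_swap h h' k x : glued h h' -> descends k ->
  descends (swap (R := R) \o k \o swap (R := R)) ->
  desc (h \o swap (R := R)) (h' \o swap (R := R)) k x = desc h h' (swap (R := R) \o k \o swap (R
    := R)) x.
Proof.
move=> hh dk dsk; have hs := glued_swap hh.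
have Hs p : H p -> H (swap p) by move=> /holed_planeP e; apply/holed_planeP; rewrite hole_dist_swap.
move: x; apply: (handles_ind hs) => p Hp.
  by rewrite (desc_left hs dk Hp) /= (desc_left hh dsk (Hs p Hp)) /= swapK.
by rewrite (desc_right hs dk Hp) /= (desc_right hh dsk (Hs p Hp)) /= swapK.
Qed.
End TwistDifference.

(** * Normal form of the two handles *)

Section Collar.
Variable R : realType.
Implicit Types (p q v w z : R * R) (r s y : R).
Local Notation H := (@holed_plane R).
Local Notation dH := (@hole_boundary R).

Definition pol r y : R * R := (r * cos (2 * pi * y), r * sin (2 * pi * y)).

Lemma pol_int r y (n : int) : pol r (y + n%:~R) = pol r y.
Proof.
have e : 2 * pi * (y + n%:~R) = 2 * pi * y + n%:~R * (2 * pi) :> R by ring.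
by rewrite /pol e cosD2pi_int sinD2pi_int.
Qed.

Lemma sqn_pol r y : sqn (pol r y) = r ^+ 2.
Proof. by rewrite /sqn /= !exprMn -mulrDr cos2Dsin2 mulr1. Qed.

Lemma nrm_pol r y : 0 <= r -> nrm (pol r y) = r.
Proof. by move=> r0; apply/eqP; rewrite nrm_eq// sqn_pol. Qed.

Lemma pol_eq r y y' : 0 < r -> pol r y = pol r y' -> exists n : int, y = y' + n%:~R.
Proof.
move=> r0 e; have rn : r != 0 by rewrite gt_eqF.
have /(mulfI rn) e1 := congr1 fst e; have /(mulfI rn) e2 := congr1 snd e.
have [n en] := cos_sin_eq e1 e2; exists n.
have p2 : 2 * pi != 0 :> R by rewrite gt_eqF// pi2_gt0.
by apply: (mulfI p2); rewrite en; ring.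
Qed.

Lemma pol_surj v : 0 < sqn v -> exists y, v = pol (nrm v) y.
Proof.
move=> v0; have [|th ->] := @polar R v.
  by apply/eqP => e; move: v0; rewrite e /sqn /= expr0n addr0 ltxx.
exists (th / (2 * pi)).
have p2 : 2 * pi != 0 :> R by rewrite gt_eqF// pi2_gt0.
have e : 2 * pi * (th / (2 * pi)) = th by rewrite mulrC divfK.
rewrite /pol e; set r := Num.sqrt _.
have -> // : nrm (r * cos th, r * sin th) = r.
by apply/eqP; rewrite nrm_eq ?sqrtr_ge0// /sqn /= !exprMn -mulrDr cos2Dsin2 mulr1.
Qed.

(** An arbitrary, discontinuous choice of argument, measured in turns. It is used only through maps
    that commute with integer shifts. *)
Definition ang v : R := if pselect (exists y, v = pol (nrm v) y) is left e then sval (cid e) else 0.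

Lemma pol_ang v : 0 < sqn v -> pol (nrm v) (ang v) = v.
Proof.
move=> v0; rewrite /ang; case: pselect => [e|[]]; last exact: pol_surj.
by case: (cid e) => y /= <-.
Qed.

Section Angular.
Variable eta : R -> R -> R.
Hypothesis ceta : continuous (fun x : R * R => eta x.1 x.2).
Hypothesis eta1 : forall r y, eta r (y + 1) = eta r y + 1.

Let eta_int r y (n : int) : eta r (y + n%:~R) = eta r y + n%:~R.
Proof.
have h : forall y, eta r (y + 1) - (y + 1) = eta r y - y by move=> y'; rewrite eta1; ring.
have := @periodic_int R R (fun y => eta r y - y) 1 h y n.
by rewrite mulr1 => e; rewrite -[LHS](subrK (y + n%:~R)) e; ring.
Qed.

Definition angular v : R * R := pol (nrm v) (eta (nrm v) (ang v)).

Lemma angular_pol r y : 0 < r -> angular (pol r y) = pol r (eta r y).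
Proof.
move=> r0; rewrite /angular nrm_pol ?ltW//.
have s0 : 0 < sqn (pol r y) by rewrite sqn_pol exprn_gt0.
have := pol_ang s0; rewrite nrm_pol ?ltW// => /(pol_eq r0)[n ->].
by rewrite eta_int pol_int.
Qed.

Lemma sqn_angular v : sqn (angular v) = sqn v.
Proof. by rewrite /angular sqn_pol nrm_sqr. Qed.

Lemma tends_eta {T : Type} {F : set_system T} {FF : Filter F} (f g : T -> R) a b :
  tends F f a -> tends F g b -> tends F (fun x => eta (f x) (g x)) (eta a b).
Proof.
move=> tf tg; have t : tends F (fun x => (f x, g x)) (a, b) by exact: tends_pair.
by apply: (tends_at (h := fun x : R * R => eta x.1 x.2) t); exact: ceta.
Qed.

Lemma tends_pol {T : Type} {F : set_system T} {FF : Filter F} (f g : T -> R) a b :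
  tends F f a -> tends F g b -> tends F (fun x => pol (f x) (g x)) (pol a b).
Proof. by move=> tf tg; rewrite /pol; tnd. Qed.

(** Near [v] the chosen argument is replaced by a continuous branch: an arctangent in the frame
    turned towards [v]. *)
Lemma angular_continuous v : 0 < sqn v -> {for v, continuous angular}.
Proof.
move=> v0; have [y0 vE] := pol_surj v0; set th := 2 * pi * y0.
have r0 : 0 < nrm v by rewrite nrm_gt0.
pose dt w := w.1 * cos th + w.2 * sin th.
pose cr w := w.2 * cos th - w.1 * sin th.
pose yy w := y0 + atan (cr w / dt w) / (2 * pi).
have p2 : 2 * pi != 0 :> R by rewrite gt_eqF// pi2_gt0.
have cs : cos th ^+ 2 + sin th ^+ 2 = 1 by exact: cos2Dsin2.
have wE w : 0 < dt w -> w = pol (nrm w) (yy w).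
  move=> d0; have [h1 h2] := cos_sin_atan (cr w) d0.
  have nE : nrm w = Num.sqrt (dt w ^+ 2 + cr w ^+ 2).
    rewrite /nrm; congr Num.sqrt; rewrite /sqn /dt /cr.
    rewrite -[LHS]mulr1 -cs; ring.
  have aE : 2 * pi * yy w = th + atan (cr w / dt w).
    by rewrite /yy mulrDr [X in _ + X]mulrC divfK.
  rewrite /pol aE cosD sinD nE; apply: pair_eqP => /=.
    rewrite mulrBr mulrCA h1 mulrCA h2 /dt /cr.
    by rewrite -[LHS]mulr1 -cs; ring.
  rewrite mulrDr mulrCA h1 mulrCA h2 /dt /cr.
  by rewrite -[LHS]mulr1 -cs; ring.
have dv : 0 < dt v.
  have -> : dt v = nrm v; last by [].
  by rewrite /dt {1 2}vE /pol /= -/th -[RHS]mulr1 -cs; ring.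
have tdt : tends (nbhs v) dt (dt v) by rewrite /dt; tnd.
have tcr : tends (nbhs v) cr (cr v) by rewrite /cr; tnd.
have tn : tends (nbhs v) (@nrm R) (nrm v) by apply: (tends_nrm (v := fun x => x)); tnd.
have tyy : tends (nbhs v) yy (yy v).
  rewrite /yy; apply: tendsD; first exact: tends_cst.
  apply: tendsM; last exact: tends_cst.
  by apply: tends_atan; apply: tendsM => //; apply: tendsV => //; rewrite gt_eqF.
apply: tends_cts.
have aE w : 0 < dt w -> 0 < nrm w -> angular w = pol (nrm w) (eta (nrm w) (yy w)).
  by move=> d0 n0; rewrite {1}(wE w d0) angular_pol.
apply: (tends_near_eq (g := fun w => pol (nrm w) (eta (nrm w) (yy w)))).
  by apply: filterS2 (tends_gt tdt dv) (tends_gt tn r0) => w h1 h2; rewrite aE.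
rewrite aE//; apply: tends_pol => //; exact: tends_eta.
Qed.
End Angular.

Lemma translation_surj (f : R -> R) : continuous f -> (forall y, f (y + 1) = f y + 1) ->
  forall u, exists y, f y = u.
Proof.
move=> cf f1 u.
have fn (n : int) : f (0 + n%:~R) = f 0 + n%:~R.
  have h y : f (y + 1) - (y + 1) = f y - y by rewrite f1; ring.
  have := @periodic_int R R (fun y => f y - y) 1 h 0 n.
  by rewrite mulr1 => e; rewrite -[LHS](subrK (0 + n%:~R)) e; ring.
pose n := Num.floor (u - f 0).
have /andP[n1 n2] := floor_itv (u - f 0); rewrite -/n intrD in n1 n2.
have [] := @IVT R f n%:~R (n + 1)%:~R u.
- by rewrite ler_int lerDl.
- by apply: continuous_subspaceT; exact: cf.
- have := fn n; have := fn (n + 1); rewrite !add0r => -> ->.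
  rewrite intrD; have le : f 0 + n%:~R <= f 0 + (n%:~R + 1) by rewrite lerD2l lerDl.
  by rewrite min_l// max_r//; apply/andP; split; lra.
- by move=> y _ <-; exists y.
Qed.

(* Rotates the boundary circle of the hole by [phi] and fades out to the
   identity at radius 3/8. *)
Section Fade.
Variable phi : R -> R.
Hypotheses (cphi : continuous phi) (phi1 : forall y, phi (y + 1) = phi y + 1).
Hypothesis mphi : forall y z : R, y < z -> phi y < phi z.

(** The affine function [3 - 8 * r] is 1 at radius 1/4 and 0 at radius 3/8. *)
Definition fade r : R := clamp (3 - 8 * r).
Definition eta r y : R := (1 - fade r) * y + fade r * phi y.
Definition collar_map := periodize (angular eta).

Let ceta : continuous (fun x : R * R => eta x.1 x.2).
Proof.
rewrite /eta /fade; cts x; first [exact: clamp_continuous | exact: cphi].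
Qed.

Let eta1 r y : eta r (y + 1) = eta r y + 1.
Proof. by rewrite /eta phi1; ring. Qed.

Let eta_mono r (y z : R) : y < z -> eta r y < eta r z.
Proof.
move=> yz; have := clamp01 (3 - 8 * r); rewrite -/(fade r) /eta => /andP[f0 f1].
have := mphi yz; move: (fade r) (phi y) (phi z) f0 f1 => a b c f0 f1 bc.
have [a0|a0] := eqVneq a 0; first by rewrite a0; lra.
have ap : 0 < a by rewrite lt_neqAle eq_sym a0.
have h1 : a * b < a * c by rewrite ltr_pM2l.
have h2 : (1 - a) * y <= (1 - a) * z by rewrite ler_wpM2l// ?subr_ge0// ltW.
by lra.
Qed.

Let eta_inj r (y z : R) : eta r y = eta r z -> y = z.
Proof.
move=> e; have [h|h|//] := ltgtP y z.
  by have := eta_mono r h; rewrite e ltxx.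
by have := eta_mono r h; rewrite e ltxx.
Qed.

Let eta_far r y : 3 / 8 <= r -> eta r y = y.
Proof. by move=> h; rewrite /eta /fade clamp_le0; [ring|lra]. Qed.

Lemma angular_supported : supported (angular eta).
Proof.
move=> v; rewrite far_nrm => h.
have v0 : 0 < sqn v by rewrite -nrm_gt0; lra.
by rewrite /angular eta_far// pol_ang.
Qed.

Lemma angular_bound v : sqn v < (3 / 8) ^+ 2 -> sqn (angular eta v) < 4^-1.
Proof. by rewrite sqn_angular => h; apply: lt_trans h _; lra. Qed.

Lemma angular_inj v w : 0 < sqn v -> 0 < sqn w -> angular eta v = angular eta w -> v = w.
Proof.
move=> v0 w0 e.
have nE : nrm v = nrm w by rewrite /nrm -(sqn_angular eta v) e sqn_angular.
have [y vE] := pol_surj v0; have [y' wE] := pol_surj w0.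
have r0 : 0 < nrm v by rewrite nrm_gt0.
move: e; rewrite vE wE -nE !(angular_pol eta1)// => /(pol_eq r0)[n].
have -> : eta (nrm v) y' + n%:~R = eta (nrm v) (y' + n%:~R).
  have h x : eta (nrm v) (x + 1) - (x + 1) = eta (nrm v) x - x by rewrite eta1; ring.
  have := @periodic_int R R (fun y => eta (nrm v) y - y) 1 h y' n.
  by rewrite mulr1 => e; rewrite -[RHS](subrK (y' + n%:~R)) e; ring.
by move=> /eta_inj ->; rewrite pol_int.
Qed.

Lemma angular_surj w : 0 < sqn w -> exists2 v, sqn v = sqn w & angular eta v = w.
Proof.
move=> w0; have [u wE] := pol_surj w0.
have r0 : 0 < nrm w by rewrite nrm_gt0.
have [|y ye] := translation_surj (f := eta (nrm w)) _ (eta1 (nrm w)) u.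
  by rewrite /eta; cts y; exact: cphi.
exists (pol (nrm w) y); first by rewrite sqn_pol nrm_sqr.
by rewrite (angular_pol eta1)// ye.
Qed.

Lemma collar_offset p : offset (collar_map p) = angular eta (offset p) /\
  center_of (collar_map p) = center_of p.
Proof. exact: periodize_offset angular_supported angular_bound. Qed.

Lemma collar_dist p : hole_dist (collar_map p) = hole_dist p.
Proof. by rewrite /hole_dist (collar_offset p).1 sqn_angular. Qed.

Lemma collar_holed p : H (collar_map p) <-> H p.
Proof. by split => /holed_planeP h; apply/holed_planeP; move: h; rewrite collar_dist. Qed.

Lemma collar_boundary p : dH (collar_map p) <-> dH p.
Proof. by split => /hole_boundaryP h; apply/hole_boundaryP; move: h; rewrite collar_dist. Qed.

Lemma holed_offset p : H p -> 0 < sqn (offset p).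
Proof. by move=> /holed_planeP h; apply: lt_le_trans h; rewrite exprn_gt0. Qed.

Lemma collar_continuous : {within H, continuous collar_map}.
Proof.
apply: continuous_in_subspaceT => p; rewrite inE => Hp.
apply: (periodize_continuous angular_supported) => _.
by apply: (angular_continuous ceta eta1); exact: holed_offset.
Qed.

Lemma collar_lattice p q : H p -> H q -> lattice (collar_map p - collar_map q) <-> lattice (p - q).
Proof.
move=> Hp Hq; split => l; last first.
  have := periodize_lattice (angular eta) q l; rewrite [q + _]addrC subrK => e.
  by rewrite /collar_map e addrAC subrr add0r.
have e : offset p = offset q.
  apply: angular_inj; [exact: holed_offset..|].
  rewrite -!(collar_offset _).1 -(offset_lattice (collar_map q) l).
  by rewrite addrC subrK.
have [c1 c2] := center_center_of p; have [c3 c4] := center_center_of q.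
rewrite -(center_offset p) -(center_offset q) e opprD addrACA subrr addr0.
split.
  have -> : (center_of p - center_of q).1 = ((center_of p).1 - 2^-1) - ((center_of q).1 - 2^-1)
    by rewrite /=; ring.
  by rewrite rpredB.
have -> : (center_of p - center_of q).2 = ((center_of p).2 - 2^-1) - ((center_of q).2 - 2^-1) by
  rewrite /=; ring.
by rewrite rpredB.
Qed.

Lemma collar_surj q : H q -> exists2 p, H p & collar_map p = q.
Proof.
move=> Hq; have [far|near] := leP ((3 / 8) ^+ 2) (hole_dist q).
  by exists q => //; rewrite /collar_map periodize_far//; exact: angular_supported.
have [v vs vE] := angular_surj (holed_offset Hq).
have v4 : sqn v < 4^-1 by rewrite vs; apply: lt_trans near _; lra.
have cc := center_center_of q.
exists (center_of q + v).
  by apply/holed_planeP; rewrite /hole_dist offset_center// vs; exact/holed_planeP.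
by rewrite /collar_map /periodize offset_center// center_of_center// vE center_offset.
Qed.

Lemma collar_far p : (3 / 8) ^+ 2 <= hole_dist p -> collar_map p = p.
Proof. by move=> h; rewrite /collar_map periodize_far//; exact: angular_supported. Qed.

Lemma collar_circle c y : center c -> collar_map (c + pol 4^-1 y) = c + pol 4^-1 (phi y).
Proof.
move=> cc; have s : sqn (pol 4^-1 y) < 4^-1 by rewrite sqn_pol; lra.
rewrite /collar_map /periodize offset_center// center_of_center// (angular_pol eta1)//.
by congr (_ + pol _ _); rewrite /eta /fade clamp_ge1; [ring|lra].
Qed.
End Fade.
End Collar.

Section NormalForm.
Variables (R : realType) (S : topologicalType) (O : set (R * R -> S)).
Hypotheses (hS : hausdorff_space S) (orO : orientation O).
Implicit Types (p q z : R * R) (e d : int) (h g : R * R -> S) (k : R * R -> R * R).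
Local Notation H := (@holed_plane R).
Local Notation dH := (@hole_boundary R).

(** The halves meet only in [E], and a parameter of a point of [E] is lattice equivalent to a
    boundary parameter, hence is one itself. *)
Lemma separated_handles E M1 M2 h h' : @separates_into_handles R S E M1 M2 ->
  handle_map h M1 E -> handle_map h' M2 E -> handles h h' /\ h @` dH = h' @` dH.
Proof.
move=> [_ cov meet _ _] [ch ih hM hE] [ch' ih' hM' hE'].
have hd : handle h by [].
have hd' : handle h' by [].
split; last by rewrite -hE.
split => // [x|p q Hp Hq e].
  have : [set: S] x by []; rewrite -cov hM hM' => -[[p Hp px]|[p Hp px]]; [left|right]; by exists p.
have : E (h p).
  by rewrite -meet; split; [rewrite hM; exists p|rewrite hM' e; exists q].
move=> /[dup]; rewrite {1}hE hE' => -[p' bp' /(ih _ _ (boundary_holed bp') Hp) l] [q' bq'].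
rewrite e => /(ih' _ _ (boundary_holed bq') Hq) l'.
split; [apply: boundary_congr bp'|apply: boundary_congr bq'].
  by rewrite -opprB; exact: latticeN.
by rewrite -opprB; exact: latticeN.
Qed.

Definition reparam k := [/\ {within H, continuous k},
  forall p, H p -> H (k p) /\ (dH (k p) <-> dH p),
  forall p q, H p -> H q -> lattice (k p - k q) <-> lattice (p - q) &
  forall q, H q -> exists2 p, H p & k p = q].

Lemma handles_reparam h h' k : reparam k -> handles h h' -> handles h (h' \o k).
Proof.
move=> [ck kH kl ks] [[a [ch' ih']] cov meet]; split.
- split => //; split; first by apply: (within_comp (E := H)) ch' => // p /kH[].
  by move=> p q Hp Hq /=; rewrite ih' ?kl//; [have [] := kH _ Hp|have [] := kH _ Hq].
- move=> x; case: (cov x) => -[p Hp px]; [by left; exists p|right].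
  by have [q Hq qp] := ks _ Hp; exists q; rewrite //= qp.
- move=> p q Hp Hq /= e; have [kq bq] := kH _ Hq.
  by have [? /bq ?] := meet _ _ Hp kq e.
Qed.

(** Reverses both the boundary circle and the orientation of a handle while keeping its two axes as
    sets. *)
Definition mirror p : R * R := (p.1, - p.2).

Lemma cell_sqrN (x : R) : cell (- x) ^+ 2 = cell x ^+ 2.
Proof.
have le (y : R) : cell (- y) ^+ 2 <= cell y ^+ 2.
  have -> : cell y ^+ 2 = (- y - 2^-1 - (- Num.floor y - 1)%:~R) ^+ 2.
    rewrite intrB intrN -[1%:~R]/(1 : R) /cell -sqrrN; congr (_ ^+ 2); by field.
  exact: cell_sqr_le.
by apply/eqP; rewrite eq_le le /=; have := le (- x); rewrite opprK.
Qed.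

Lemma hole_dist_mirror p : hole_dist (mirror p) = hole_dist p.
Proof. by rewrite /hole_dist /sqn /= cell_sqrN. Qed.

Lemma mirrorK : involutive mirror.
Proof. by move=> [x y]; rewrite /mirror /= opprK. Qed.

Lemma mirror_boundary p : dH (mirror p) <-> dH p.
Proof. by split => /hole_boundaryP e; apply/hole_boundaryP; move: e; rewrite hole_dist_mirror. Qed.

Lemma mirror_reparam : reparam mirror.
Proof.
have mH p : H p -> H (mirror p).
  by move=> /holed_planeP e; apply/holed_planeP; rewrite hole_dist_mirror.
split.
- by apply: continuous_subspaceT; rewrite /mirror; cts p.
- by move=> p Hp; split; [exact: mH|exact: mirror_boundary].
- move=> p q _ _; rewrite /lattice /=.
  have -> : - p.2 - - q.2 = - (p.2 - q.2) by ring.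
  by rewrite rpredN.
- by move=> q Hq; exists (mirror q); [exact: mH|exact: mirrorK].
Qed.

Lemma mirror_axes h : (h \o mirror) @` [set p | p.2 = 0] = h @` [set p | p.2 = 0] /\
  (h \o mirror) @` [set p | p.1 = 0] = h @` [set p | p.1 = 0].
Proof.
split; apply/seteqP; split => _ [p /= p0 <-]; exists (mirror p); rewrite ?mirrorK//=.
- by rewrite p0 oppr0.
- by rewrite p0 oppr0.
Qed.

(** Equality of sets suffices, because a Dehn twist refers to its curve as a set and ignores the
    direction. *)
Definition same_axes g h := g @` [set p | p.2 = 0] = h @` [set p | p.2 = 0] /\
  g @` [set p | p.1 = 0] = h @` [set p | p.1 = 0].

Definition rim h y : S := h (hole_center R + pol 4^-1 y).

Lemma center_hole_center : center (hole_center R).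
Proof. by split; rewrite /= subrr rpred0. Qed.

Lemma rim_boundary y : dH (hole_center R + pol 4^-1 y).
Proof.
apply/hole_boundaryP; rewrite /hole_dist offset_center ?sqn_pol//.
  exact: center_hole_center.
lra.
Qed.

Lemma boundary_rim h p : handle h -> dH p -> exists2 y, h p = rim h y & offset p = pol 4^-1 y.
Proof.
move=> hd bp; have /hole_boundaryP e := bp.
have o0 : 0 < sqn (offset p) by rewrite -/(hole_dist p) e exprn_gt0.
have [y oE] := pol_surj o0.
have n4 : nrm (offset p) = 4^-1 by apply/eqP; rewrite nrm_eq//; apply/eqP.
rewrite n4 in oE; exists y => //; rewrite /rim.
have l : lattice (center_of p - hole_center R).
  by have [c1 c2] := center_center_of p.
rewrite -(handle_lattice hd (boundary_holed (rim_boundary y)) l); congr h.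
by rewrite addrAC [hole_center _ + _]addrC subrK -oE center_offset.
Qed.

Lemma rim_param h : handle h -> circle_param (rim h).
Proof.
move=> [ch ih]; split.
  move=> y; apply: tends_cts.
  apply: (tends_within ch); first exact: (boundary_holed (rim_boundary y)).
    by apply: tendsD2; [exact: tends_cst|apply: (tends_pol (f := fun=> 4^-1)); tnd;
      rewrite pnatr_eq0].
  by apply: nearW => z; exact: (boundary_holed (rim_boundary z)).
move=> s t; rewrite /rim ih; [|exact: (boundary_holed (rim_boundary _))..].
split => [l|/intrP[n e]]; last first.
  have -> : s = t + n%:~R by rewrite -e addrC subrK.
  rewrite pol_int subrr; exact: lattice0.
have q4 : (0 : R) < 4^-1 by rewrite invr_gt0.
have s4 y : sqn (pol (4^-1 : R) y) < 4^-1 by rewrite sqn_pol; lra.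
have : pol 4^-1 s = pol 4^-1 t.
  have c := center_hole_center.
  rewrite -(offset_center c (s4 s)) -(offset_center c (s4 t)) -(offset_lattice (hole_center R +
    pol 4^-1 t) l).
  by rewrite [in RHS]addrC subrK.
by move=> /(pol_eq q4)[n ->]; rewrite addrAC subrr add0r rpred_int.
Qed.

Lemma range_rim h : handle h -> range (rim h) = h @` dH.
Proof.
move=> hd; apply/seteqP; split => [_ [y _ <-]|_ [p bp <-]].
  by exists (hole_center R + pol 4^-1 y) => //; exact: rim_boundary.
by have [y -> _] := boundary_rim hd bp; exists y.
Qed.

Lemma rim_mirror h y : handle h -> rim (h \o mirror) y = rim h (- y).
Proof.
move=> hd; rewrite /rim /=.
have e : mirror (hole_center R + pol 4^-1 y) = (hole_center R + pol 4^-1 (- y)) + (0, -1).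
  rewrite /mirror /pol mulrN cosN sinN /hole_center; apply: pair_eqP => /=; by field.
rewrite e handle_lattice//; first exact: (boundary_holed (rim_boundary _)).
by split; rewrite /= ?rpred0// rpredN rpred1.
Qed.

(** The boundary circle of the second handle is reparametrised by [phi] in a collar of radius 3/8.
    The axes stay outside the collar and are fixed pointwise. *)
Lemma glue_collar h h' phi : handles h h' -> circle_lift (rim h) (rim h') phi 1 ->
  exists2 g, glued h g & same_axes g h'.
Proof.
move=> hh L; have [[hd hd'] _ _] := hh.
have [cphi hphi dphi] := L.
have mphi := circle_lift_mono (rim_param hd) (rim_param hd') L.
have phi1 y : phi (y + 1) = phi y + 1 by rewrite dphi.
have rp : reparam (collar_map phi).
  split.
  - exact: collar_continuous.
  - by move=> p Hp; split; [apply/collar_holed|exact: collar_boundary].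
  - by move=> p q; exact: collar_lattice.
  - exact: collar_surj.
exists (h' \o collar_map phi).
  split; first exact: handles_reparam.
  move=> p bp; have [y -> oE] := boundary_rim hd bp.
  have -> : p = center_of p + pol 4^-1 y by rewrite -oE center_offset.
  rewrite /= collar_circle//; last exact: center_center_of.
  have l : lattice (center_of p - hole_center R) by have [c1 c2] := center_center_of p.
  rewrite hphi /rim -(handle_lattice hd' (boundary_holed (rim_boundary (phi y))) l); congr h'.
  by rewrite addrAC [hole_center _ + _]addrC subrK.
have axis p : p.2 = 0 \/ p.1 = 0 -> collar_map phi p = p.
  move=> p0; apply: collar_far => //.
  have c0 : (3 / 8) ^+ 2 <= cell (0 : R) ^+ 2 by apply: cell_small; apply/andP; split; lra.
  have := sqr_ge0 (cell p.1); have := sqr_ge0 (cell p.2).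
  by case: p0; rewrite /hole_dist /sqn /= => ->; lra.
split; apply/seteqP; split => _ [p /= p0 <-]; exists p; rewrite //= axis//; by [left|right].
Qed.

(** If the boundary circles run in opposite directions, the second handle is mirrored first; its
    axes survive as sets. *)
Lemma glue_handles h h' : handles h h' -> h @` dH = h' @` dH ->
  exists2 g, glued h g & same_axes g h'.
Proof.
move=> hh e; have [[hd hd'] _ _] := hh.
have c1 := rim_param hd; have c2 := rim_param hd'.
have [|phi [n L]] := circle_lift_exists hS c1 c2; first by rewrite !range_rim// e.
case: (circle_lift_degree c1 c2 L) => n1; rewrite n1 in L; first exact: glue_collar L.
have hm := handles_reparam mirror_reparam hh.
have [cphi hphi dphi] := L.
have [|g gg [a1 a2]] := @glue_collar h (h' \o mirror) (fun y => - phi y) hm.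
  split; first by cts y; exact: cphi.
    by move=> y; rewrite rim_mirror// opprK.
  by move=> y; rewrite dphi opprD -[(-1)%:~R]/(-1 : R) opprK.
have [m1 m2] := mirror_axes h'.
by exists g => //; split; [rewrite a1|rewrite a2].
Qed.

Lemma chart_sign psi q : O psi -> has_sign O psi q 1.
Proof.
move=> Opsi psi' q' Opsi' e.
have r1 : (0 : R) < 1 by [].
have ep := @open_embedding_emb R S psi q 1 (O_emb orO Opsi).
have := co_oriented_degree (O_emb orO Opsi') r1 ep e.
apply.
by have [_ _ co _] := orO; apply: co.
Qed.

(** A chart, of sign 1, factors locally through the annulus, so 1 is a multiple of [d] in the
    integers. *)
Lemma annulus_sign_unit c B d : annulus c B -> has_sign O B (0, 0) d -> d = 1 \/ d = -1.
Proof.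
move=> aB sB; have c0 : 0 < c by case: aB.
have ob : open_band c (0 : R, 0 : R) by rewrite /open_band /= oppr_lt0 c0.
have [rL [rL0 rLB eB]] := annulus_emb aB ob.
have [psi [q [Opsi pq]]] := O_chart orO (B (0, 0)).
have r1 : (0 : R) < 1 by [].
have ep := @open_embedding_emb R S psi q 1 (O_emb orO Opsi).
have [r [k [/andP[r0 rr1] kq [ck ik] kE]]] :=
  local_chart_lift r1 rL0 r1 eB (annulus_open_disc hS aB rLB) ep pq.
have ek : emb_disc psi q r by apply: open_embedding_emb; exact: (O_emb orO Opsi).
have eB' : emb_disc B (k q) rL by rewrite kq.
have sB' : has_sign O B (k q) d by rewrite kq.
have := relative_degree orO r0 rL0 ek (conj ck ik) eB' (fun x dx =>
  (kE x dx).1) (chart_sign (q := q) Opsi) sB'.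
move=> /(@filter_ex _ (0^'+) _)[r' [d' [_ e]]].
have : d \is a GRing.unit by apply/unitrP; exists d'; split; [|rewrite mulrC]; exact: esym.
by rewrite qualifE /= => /orP[/eqP->|/eqP->]; [left|right].
Qed.

Lemma handle_sign_exists h : handle h -> exists d, has_sign O h (0, 0) d.
Proof.
move=> hd; have h0 : 4^-1 ^+ 2 < hole_dist (0 : R, 0 : R).
  by apply: near_axis_dist; apply: cell_small; apply/andP; split => /=; lra.
have [r r0 [er _]] := handle_emb hd h0.
exact: (has_sign_exists orO r0 er).
Qed.

Lemma handle_sign_unit h h' d : handles h h' -> has_sign O h (0, 0) d -> d = 1 \/ d = -1.
Proof.
move=> hh sd; have [[hd _] _ _] := hh.
have o1 : (1 : int) = 1 \/ (1 : int) = -1 by left.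
have h0 : 4^-1 ^+ 2 < hole_dist (0 : R, 0 : R).
  by apply: near_axis_dist; apply: cell_small; apply/andP; split => /=; lra.
have [r r0 [er _]] := handle_emb hd h0.
have aE : across 1 (0 : R, 0 : R) = (0, 0) by rewrite /across /= mulr0 oppr0.
apply: (annulus_sign_unit (axis_annulus hS hh o1)).
rewrite -[d]mul1r; apply: (has_sign_comp orO r0 er _ _ sd); first by rewrite /= aE.
rewrite -{2}aE; apply: degree_at_isometry => r' s; exact: across_circle.
Qed.

Lemma degree_at_near (K K' L : R * R -> S) p q d (r0 : R) : 0 < r0 -> (forall x, disc p r0 x ->
  K x = K' x) ->
  degree_at K L p q d -> degree_at K' L p q d.
Proof.
move=> r00 e D e0 e00; apply: filterS2 (D _ e00) (near_right_lt r00) =>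
  r [g [w gE gd]] /andP[h1 h2].
exists g; split => // s; rewrite -gE -e// disc_circle.
by rewrite ltr_pXn2r// nnegrE ltW.
Qed.
End NormalForm.

(** * Opposite orientations of the two halves *)

Section OppositeSigns.
Variables (R : realType) (S : topologicalType) (O : set (R * R -> S)).
Hypotheses (hS : hausdorff_space S) (orO : orientation O).
Implicit Types (p q v w z : R * R) (e d : int) (h g : R * R -> S).
Local Notation H := (@holed_plane R).
Local Notation dH := (@hole_boundary R).

(** Inversion in the circle of radius 1/4, the boundary of the hole. *)
Definition inversion v := scal (16 * sqn v)^-1 v.

Lemma sqn_inversion v : 0 < sqn v -> sqn (inversion v) = (256 * sqn v)^-1.
Proof. by move=> v0; rewrite sqn_scal; field; rewrite gt_eqF. Qed.

Lemma inversionK v : 0 < sqn v -> inversion (inversion v) = v.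
Proof.
move=> v0; rewrite {1}/inversion sqn_inversion// /inversion scalA -[RHS]scal1; congr scal.
by field; rewrite gt_eqF.
Qed.

Lemma inversion_continuous v : 0 < sqn v -> {for v, continuous inversion}.
Proof.
move=> v0; apply: tends_cts; apply: tends_scal; last by tnd.
apply: tendsV; last by rewrite mulf_neq0 ?pnatr_eq0// gt_eqF.
by apply: tendsM; [exact: tends_cst|rewrite /sqn; tnd].
Qed.

(** The image of a small circle is compared with a circle run backwards by [winds_pert]. The scalar
    product is a positive multiple of [c * (c + r * cos s)], which is positive because [r] is below
    the absolute value of [c]. *)
Lemma inversion_winds (c r : R) : 0 < r < `|c| ->
  winds (inversion (c, 0)) (fun s => inversion (circle_pt (c, 0) r s)) (-1).
Proof.
move=> /andP[r0 rc].
have c0 : c != 0 by rewrite -normr_gt0; apply: lt_trans rc.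
have cc : 0 < c ^+ 2 by rewrite lt_neqAle sqr_ge0 andbT eq_sym sqrf_eq0.
have near s : 0 < c * (c + r * cos s).
  have h : `|r * cos s| <= r.
    by rewrite normrM (gtr0_norm r0) -[leRHS]mulr1 ler_pM2l// ler_norml cos_geN1 cos_le1.
  have h2 : `|c| * `|r * cos s| < `|c| * `|c|.
    by rewrite ltr_pM2l ?normr_gt0//; exact: le_lt_trans rc.
  rewrite mulrDr; have : - (c * (r * cos s)) <= `|c| * `|r * cos s|.
    by rewrite -normrM -normrN ler_norm.
  have -> : c * c = `|c| * `|c| by rewrite -normrM ger0_norm// -expr2 ltW.
  by lra.
have pos s : 0 < sqn (circle_pt (c, 0) r s).
  rewrite /sqn /=; apply: ltr_wpDr; first exact: sqr_ge0.
  rewrite lt_neqAle sqr_ge0 andbT eq_sym sqrf_eq0.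
  by apply/eqP => e; have := near s; rewrite e mulr0 ltxx.
(* The derivative of the inversion at [(c, 0)] is the reflection of the first coordinate scaled by
   [1 / (16 c^2)]; hence this radius and the angle [pi - s] below. *)
have r16 : 0 < r / (16 * c ^+ 2) by rewrite divr_gt0// mulr_gt0.
apply: (winds_pert (winds_isometry (inversion (c, 0)) pi (-1) r16)).
- move=> s; apply: tends_cts.
  apply: (tends_at (h := inversion) (f := fun s => circle_pt (c, 0) r s));
    last exact: inversion_continuous.
  by rewrite /circle_pt; tnd.
- by move=> s; rewrite circle_pt_period1.
- move=> s.
  have -> : (-1)%:~R * s + pi = pi - s :> R by rewrite -[(-1)%:~R]/(-1 : R); ring.
  rewrite {2 4}/circle_pt cosB sinB cospi sinpi.
  have := near s; have := pos s; rewrite /inversion /scal /sqn /circle_pt /=.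
  set a := cos s; set b := sin s; rewrite !add0r => D0 n0.
  have ab : a ^+ 2 + b ^+ 2 = 1 by exact: cos2Dsin2.
  set D := (c + r * a) ^+ 2 + (r * b) ^+ 2 in D0 *.
  have DE : D = c ^+ 2 + 2 * c * r * a + r ^+ 2.
    transitivity (c ^+ 2 + 2 * c * r * a + r ^+ 2 * (a ^+ 2 + b ^+ 2)); first by rewrite /D; ring.
    by rewrite ab mulr1.
  have -> : ((16 * D)^-1 * (c + r * a) - (16 * (c ^+ 2 + 0 ^+ 2))^-1 * c) *
     ((16 * (c ^+ 2 + 0 ^+ 2))^-1 * c + r / (16 * c ^+ 2) * (-1 * a + 0 * b) - (16 * (c ^+ 2 + 0
       ^+ 2))^-1 * c) +
     ((16 * D)^-1 * (r * b) - (16 * (c ^+ 2 + 0 ^+ 2))^-1 * 0) *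
     ((16 * (c ^+ 2 + 0 ^+ 2))^-1 * 0 + r / (16 * c ^+ 2) * (0 * a - -1 * b) - (16 * (c ^+ 2 + 0
       ^+ 2))^-1 * 0)
     = r ^+ 2 * (c * (c + r * a)) / (256 * D * (c ^+ 2) ^+ 2).
    have Dn : D != 0 by rewrite gt_eqF.
    have -> : r ^+ 2 * (c * (c + r * a)) = r * (c ^+ 2 * r * b ^+ 2 - a * c * ((c + r * a) * c -
      D)).
      have -> : b ^+ 2 = 1 - a ^+ 2 by rewrite -ab; ring.
      by rewrite DE; ring.
    by rewrite expr0n addr0; clear DE D0; move: Dn; generalize D => D' Dn; field; rewrite c0 Dn.
  have p256 : 0 < 256 :> R by rewrite ltr0n.
  apply: divr_gt0; first by rewrite mulr_gt0// exprn_gt0.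
  by apply: mulr_gt0; [exact: mulr_gt0|exact: exprn_gt0].
Qed.

Lemma degree_at_local (L : R * R -> S) (f : R * R -> R * R) p d : {for p, continuous f} ->
  (\forall r \near 0^'+, winds (f p) (fun s => f (circle_pt p r s)) d) ->
  degree_at (L \o f) L p (f p) d.
Proof.
move=> cf W e e0.
have [r1 r10 rU] : exists2 r, 0 < r & disc p r `<=` [set x | disc (f p) e (f x)].
  by apply: nbhs_disc; exact: (cf _ (disc_nbhs (f p) e0)).
apply: filterS2 W (near_right_lt r10) => r w /andP[h1 h2].
exists (fun s => f (circle_pt p r s)); split => // s; apply: rU.
by rewrite disc_circle ltr_pXn2r// nnegrE ltW.
Qed.

Section Chart.
Variables (h h' : R * R -> S).
Hypothesis hh : glued h h'.

(* A coordinate system around the boundary circle: the second handle is seen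
   through the inversion, which reverses the orientation. *)
Definition boundary_chart v : S :=
  if 4^-1 ^+ 2 <= sqn v then h (hole_center R + v) else h' (hole_center R + inversion v).

Let outer v : 4^-1 ^+ 2 <= sqn v < 4^-1 ->
  H (hole_center R + v) /\ hole_dist (hole_center R + v) = sqn v.
Proof.
move=> /andP[v1 v2]; have e : hole_dist (hole_center R + v) = sqn v.
  by rewrite /hole_dist offset_center//; exact: center_hole_center.
by split => //; apply/holed_planeP; rewrite e.
Qed.

(** Squared radii about 1/16. The bounds keep both [v], when outside the circle, and its inversion,
    when inside, within radius 1/2, that is, in one cell; the path of [opposite_signs] lies in this
    zone. *)
Definition chart_zone : set (R * R) := [set v | 50^-1 < sqn v < 5^-1].

Let zone_inv v : 50^-1 <= sqn v <= 4^-1 ^+ 2 -> 4^-1 ^+ 2 <= sqn (inversion v) < 4^-1.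
Proof.
move=> /andP[v1 v2]; have v0 : 0 < sqn v by lra.
rewrite sqn_inversion//; set u := sqn v in v0 v1 v2 *.
have : (256 * u)^-1 * u = 256^-1 by field; rewrite gt_eqF.
have : 0 < (256 * u)^-1 by rewrite invr_gt0 pmulr_rgt0// ltr0n.
by move: (_^-1) => x x0 xu; apply/andP; split; nra.
Qed.

Let outer_bounds v : 4^-1 ^+ 2 <= sqn v -> sqn v <= 5^-1 -> 4^-1 ^+ 2 <= sqn v < 4^-1.
Proof. by move=> h1 h2; rewrite h1 /=; lra. Qed.

Lemma boundary_chart_continuous : {within [set v | 50^-1 <= sqn v <= 5^-1],
  continuous boundary_chart}.
Proof.
have [[[[ch _] [ch' _]] _ _] gl] := hh.
have cl (a b : R) : closed [set v : R * R | a <= sqn v <= b].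
  have -> : [set v : R * R | a <= sqn v <= b] = @sqn R @^-1` `[a, b]%classic.
    by apply/seteqP; split => x /=; rewrite in_itv.
  by apply: closed_comp; [move=> x _; exact: sqn_continuous|exact: itv_closed].
have -> : [set v : R * R | 50^-1 <= sqn v <= 5^-1] =
    [set v | 50^-1 <= sqn v <= 4^-1 ^+ 2] `|` [set v | 4^-1 ^+ 2 <= sqn v <= 5^-1].
  apply/seteqP; split => v /=.
    by move=> /andP[h1 h2]; case: (leP (sqn v) (4^-1 ^+ 2)) => hv; [left; rewrite h1|right;
      rewrite h2 ltW].
  by move=> [] /andP[h1 h2]; apply/andP; split; lra.
apply: withinU_continuous; [exact: cl|exact: cl| |].
  apply: (@within_eq _ _ _ (h' \o (fun v => hole_center R + inversion v))).
    move=> v /= /[dup] vz /andP[v1 v2]; rewrite /boundary_chart; case: ifP => // h1.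
    have e : sqn v = 4^-1 ^+ 2 by apply/eqP; rewrite eq_le v2 h1.
    have iE : inversion v = v.
      by rewrite /inversion e -[RHS]scal1; congr scal; field.
    rewrite iE gl//; apply/hole_boundaryP.
    by rewrite (outer (v := v) _).2 ?e ?lexx//=; lra.
  apply: (within_comp (E := H)) ch'; last first.
    by move=> v /= /zone_inv /outer[].
  apply: continuous_in_subspaceT => v; rewrite inE /= => /andP[v1 v2].
  apply: tends_cts; apply: tendsD2; first exact: tends_cst.
  by apply: inversion_continuous; lra.
apply: (@within_eq _ _ _ (h \o (fun v => hole_center R + v))).
  by move=> v /= /andP[v1 v2]; rewrite /boundary_chart v1.
apply: (within_comp (E := H)) ch; last by move=> v /= /andP[v1 v2];
  have [] := outer (outer_bounds v1 v2).
apply: continuous_subspaceT => v; apply: tends_cts; apply: tendsD2; first exact: tends_cst.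
exact: tends_idn.
Qed.

Let holed_inj (f : R * R -> S) v w : handle f -> 4^-1 ^+ 2 <= sqn v < 4^-1 ->
  4^-1 ^+ 2 <= sqn w < 4^-1 ->
  f (hole_center R + v) = f (hole_center R + w) -> v = w.
Proof.
move=> [_ i] hv hw; have [Hv _] := outer hv; have [Hw _] := outer hw.
move=> /(i _ _ Hv Hw) l; have c := center_hole_center R.
have v4 : sqn v < 4^-1 by case/andP: hv. have w4 : sqn w < 4^-1 by case/andP: hw.
rewrite -(offset_center c v4) -(offset_center c w4) -(offset_lattice (hole_center R + w) l).
by rewrite [in RHS]addrC subrK.
Qed.

Lemma boundary_chart_inj v w : chart_zone v -> chart_zone w ->
  boundary_chart v = boundary_chart w -> v = w.
Proof.
have [[[hd hd'] _ meet] gl] := hh.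
have mixed v' w' : chart_zone v' -> chart_zone w' -> 4^-1 ^+ 2 <= sqn v' -> sqn w' < 4^-1 ^+ 2 ->
    h (hole_center R + v') <> h' (hole_center R + inversion w').
  move=> /andP[v1 v2] /andP[w1 w2] hv hw e.
  have [Hv _] := outer (outer_bounds hv (ltW v2)).
  have iz : 4^-1 ^+ 2 <= sqn (inversion w') < 4^-1 by apply: zone_inv; rewrite !ltW.
  have [Hw dw] := outer iz.
  have [_ /hole_boundaryP] := meet _ _ Hv Hw e.
  have w0 : 0 < sqn w' by lra.
  rewrite dw sqn_inversion// => e'.
  have : (256 * sqn w')^-1 * sqn w' = 256^-1 by field; rewrite gt_eqF.
  by rewrite e'; move: (sqn w') hw => x hw; lra.
move=> zv zw; have /andP[v1 v2] := zv; have /andP[w1 w2] := zw.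
rewrite /boundary_chart; case: leP => hv; case: leP => hw e.
- by apply: (holed_inj hd) e; apply: outer_bounds => //; exact: ltW.
- by have := mixed v w zv zw hv hw e.
- by have := mixed w v zw zv hw hv (esym e).
- have v0 : 0 < sqn v by lra. have w0 : 0 < sqn w by lra.
  rewrite -(inversionK v0) -(inversionK w0); congr inversion.
  by apply: (holed_inj hd') e; apply: zone_inv; rewrite !ltW.
Qed.

Lemma boundary_chart_emb v : chart_zone v -> exists2 r, 0 < r & emb_disc boundary_chart v r.
Proof.
move=> zv; have oz : open chart_zone.
  rewrite (_ : chart_zone = @sqn R @^-1` `]50^-1, 5^-1[%classic); last first.
    by apply/seteqP; split => x /=; rewrite in_itv.
  by apply: open_comp; [move=> x _; exact: sqn_continuous|exact: itv_open].
have [r r0 rz] := nbhs_disc (open_nbhs_nbhs (conj oz zv)).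
exists r => //; split => [x /rz zx|x y /rz zx /rz zy]; last exact: boundary_chart_inj.
have cz : {within chart_zone, continuous boundary_chart}.
  apply: continuous_subspaceW boundary_chart_continuous => y /andP[y1 y2] /=.
  by rewrite !ltW.
by move: cz; rewrite continuous_open_subspace// => cz; apply: cz; rewrite inE.
Qed.

(** The sign of [boundary_chart] is constant along a radial path crossing the circle. At the outer
    end the chart is [h] up to a translation, at the inner end it is [h'] after the inversion, of
    degree -1. *)
Lemma opposite_signs d d' : has_sign O h (0, 0) d -> has_sign O h' (0, 0) d' -> d = - d'.
Proof.
have [[[hd hd'] _ _] _] := hh.
(* The radii 2/5 and 5/32 have product 1/16, so [v0] and the inversion of [v1] are the same offset
   and both ends of the path have the parameter [q]. *)
pose q : R * R := (10^-1, 2^-1).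
have toq f e : handle f -> has_sign O f (0, 0) e -> has_sign O f q e.
  move=> hf s0; have := @sign_along _ _ _ orO f (fun t => (clamp t / 10, clamp t / 2)) e hf.
  rewrite clamp_le0// clamp_ge1// !mul0r !mul1r; apply => //.
    by cts t; first [by rewrite pnatr_eq0|exact: clamp_continuous].
  move=> t; have /andP[] := clamp01 t; move: (clamp t) => u u0 u1.
  rewrite /hole_dist /sqn /= /cell.
  have -> : Num.floor (u / 10) = 0 by apply: floor_def; rewrite add0r; apply/andP; split; lra.
  have -> : Num.floor (u / 2) = 0 by apply: floor_def; rewrite add0r; apply/andP; split; lra.
  by rewrite mulr0z; nra.
move=> /(toq _ _ hd) sq /(toq _ _ hd') sq'.
pose v0 : R * R := (- (2 / 5), 0). pose v1 : R * R := (- (5 / 32), 0).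
have q0 : hole_center R + v0 = q by apply: pair_eqP => /=; field.
have q1 : hole_center R + inversion v1 = q.
  by apply: pair_eqP; rewrite /inversion /scal /sqn /=; field.
have qd : 4^-1 ^+ 2 < hole_dist q.
  by rewrite -q0 (outer (v := v0) _).2 /sqn /=; [lra|apply/andP; split; lra].
have [r r0 [er _]] := handle_emb hd qd; have [r' r'0 [er' _]] := handle_emb hd' qd.
have near_chart (f : R * R -> S) v : nbhs v [set x : R * R | boundary_chart x = f x] ->
    exists2 s, 0 < s & forall x, disc v s x -> f x = boundary_chart x.
  by move=> /nbhs_disc[s s0 sU]; exists s => // x /sU /= ->.
have s0 : has_sign O boundary_chart v0 d.
  have n : nbhs v0 [set x : R * R | boundary_chart x = (h \o +%R (hole_center R)) x].
    have t : tends (nbhs v0) (@sqn R) (sqn v0) by exact: sqn_continuous.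
    have hs : 4^-1 ^+ 2 < sqn v0 by rewrite /sqn /=; lra.
    by apply: filterS (tends_gt t hs) => x hx; rewrite /= /boundary_chart ltW.
  have [s s0 sE] := near_chart _ _ n.
  rewrite -[d]mul1r; apply: (has_sign_comp orO r0 er _ _ sq).
    by rewrite -q0 -[LHS](sE v0)//; exact: disc_center.
  apply: (degree_at_near s0 sE); rewrite -q0.
  apply: (degree_at_isometry (a := 0) h) => a b.
  by rewrite mul1r addr0; apply: pair_eqP => /=; rewrite addrA.
have s1 : has_sign O boundary_chart v1 d.
  have := @has_sign_path _ _ _ orO boundary_chart (fun t =>
    (- (2 / 5) + clamp t * (2 / 5 - 5 / 32), 0)) d.
  rewrite clamp_le0// clamp_ge1// mul0r addr0 mul1r.
  have -> : - (2 / 5) + (2 / 5 - 5 / 32) = - (5 / 32) :> R by ring.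
  apply => //; first by cts t; first [by rewrite pnatr_eq0|exact: clamp_continuous].
  move=> t _; apply: boundary_chart_emb; have /andP[] := clamp01 t; move: (clamp t) => u u0 u1.
  by rewrite /chart_zone /sqn /=; apply/andP; split; nra.
suff s1' : has_sign O boundary_chart v1 (-1 * d').
  by rewrite (has_sign_uniq orO s1 s1') mulN1r.
have n : nbhs v1 [set x : R * R | boundary_chart x = (h' \o (fun x =>
  hole_center R + inversion x)) x].
  have t : tends (nbhs v1) (@sqn R) (sqn v1) by exact: sqn_continuous.
  have hs : sqn v1 < 4^-1 ^+ 2 by rewrite /sqn /=; lra.
  by apply: filterS (tends_lt t hs) => x hx; rewrite /= /boundary_chart leNgt hx.
have [s ss sE] := near_chart _ _ n.
apply: (has_sign_comp orO r'0 er' _ _ sq').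
  by rewrite -q1 -[LHS](sE v1)//; exact: disc_center.
apply: (degree_at_near ss sE); rewrite -q1.
have v10 : 0 < sqn v1 by rewrite /sqn /=; lra.
apply: (@degree_at_local h' (fun x => hole_center R + inversion x)).
  by apply: tends_cts; apply: tendsD2; [exact: tends_cst|exact: inversion_continuous].
have b : (0 : R) < 5 / 32 by lra.
apply: filterS (near_right_lt b) => a /andP[a0 a1].
have aN : 0 < a < `|- (5 / 32)| by rewrite normrN gtr0_norm ?a0.
apply: winds_eq (winds_shift (hole_center R + inversion v1) (inversion_winds aN)) _ => u.
by rewrite /v1 [hole_center R + _]addrC addrA subrK addrC.
Qed.
End Chart.

(** Mirroring both halves at once preserves the gluing and the axes and changes both signs, so the
    first sign can be taken to be 1. *)
Theorem normal_form h h' : handles h h' -> h @` dH = h' @` dH ->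
  exists g g', [/\ glued g g', same_axes g h, same_axes g' h',
    has_sign O g (0, 0) 1 & has_sign O g' (0, 0) (-1)].
Proof.
move=> hh e; have [g' gg ax] := glue_handles hS hh e.
have [hg _] := gg; have [[hd hd'] _ _] := hg.
have [d sd] := handle_sign_exists orO hd; have [d' sd'] := handle_sign_exists orO hd'.
have opp := opposite_signs gg sd sd'.
case: (handle_sign_unit hS orO hg sd) => d1.
  exists h, g'; split => //; first by rewrite -d1.
  by have -> : (-1 : int) = d' by rewrite -d1 opp opprK.
have sm f e' : handle f -> has_sign O f (0, 0) e' ->
  has_sign O (f \o mirror (R := R)) (0, 0) (- e').
  move=> hf sf; have f0 : 4^-1 ^+ 2 < hole_dist (0 : R, 0 : R).
    by apply: near_axis_dist; apply: cell_small; apply/andP; split => /=; lra.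
  have [r r0 [er _]] := handle_emb hf f0.
  have mE : mirror (0 : R, 0 : R) = (0, 0) by rewrite /mirror /= oppr0.
  rewrite -mulN1r; apply: (has_sign_comp orO r0 er _ _ sf); first by rewrite /= mE.
  rewrite -{2}mE; apply: (degree_at_isometry (a := 0) f) => r' s.
  by rewrite addr0 -[(-1)%:~R]/(-1 : R) mulN1r /circle_pt cosN sinN; apply: pair_eqP => /=; ring.
have [m1 m2] := mirror_axes h; have [m1' m2'] := mirror_axes g'.
exists (h \o mirror (R := R)), (g' \o mirror (R := R)); split => //.
- split; last by move=> p /mirror_boundary bp; have [_ gl] := gg; exact: gl.
  apply: handles_reparam; first exact: mirror_reparam.
  by apply: handles_sym; apply: handles_reparam (handles_sym hg); exact: mirror_reparam.
- by have [a1 a2] := ax; split; [rewrite m1'|rewrite m2'].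
- by have := sm _ _ hd sd; rewrite d1 opprK.
- by have := sm _ _ hd' sd'; rewrite -opp d1.
Qed.
End OppositeSigns.

(** * Faithfulness *)

Section Faithful.
Variables (R : realType) (S : topologicalType).
Hypotheses (hS : hausdorff_space S).
Implicit Types (p q v w z : R * R) (h : R * R -> S) (M N : 'M[int]_2).
Local Notation H := (@holed_plane R).
Local Notation dH := (@hole_boundary R).

Section Pair.
Variables (h h' : R * R -> S).
Hypothesis hh : glued h h'.

(** Lattice-invariant functions on the two handles that agree on the boundary circle define one
    function on the surface; the compact fundamental domains give its continuity. *)
Lemma handle_function (T : topologicalType) (f f' : R * R -> T) :
  {within H, continuous f} -> {within H, continuous f'} ->
  (forall p q, H p -> H q -> lattice (p - q) -> f p = f q) ->
  (forall p q, H p -> H q -> lattice (p - q) -> f' p = f' q) ->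
  (forall p, dH p -> f p = f' p) ->
  exists chi : S -> T, [/\ continuous chi, forall p, H p -> chi (h p) = f p &
    forall p, H p -> chi (h' p) = f' p].
Proof.
move=> cf cf' fl fl' ff'.
have [[[[ch ih] [ch' ih']] cov meet] gl] := hh.
have [chi chiE] : exists chi : S -> T, forall x, (exists p, [/\ H p, h p = x & chi x = f p]) \/
    (exists p, [/\ H p, h' p = x & chi x = f' p]).
  have [|chi chiP] := @choice S T (fun x t => (exists p, [/\ H p, h p = x & t = f p]) \/
    (exists p, [/\ H p, h' p = x & t = f' p])); last by exists chi.
  move=> x; by case: (cov x) => -[p Hp px]; [exists (f p); left|exists (f' p); right]; exists p.
have e1 p : H p -> chi (h p) = f p.
  move=> Hp; case: (chiE (h p)) => -[q [Hq qp ->]].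
    by apply: fl => //; apply/ih.
  have [bp bq] := meet _ _ Hp Hq (esym qp).
  by rewrite -ff'//; apply: fl => //; apply/ih => //; rewrite gl.
have e2 p : H p -> chi (h' p) = f' p.
  move=> Hp; case: (chiE (h' p)) => -[q [Hq qp ->]].
    have [bq bp] := meet _ _ Hq Hp qp.
    by rewrite ff'//; apply: fl' => //; apply/ih' => //; rewrite -gl.
  by apply: fl' => //; apply/ih'.
exists chi; split => //.
have sub : @domain R `<=` H by move=> p [].
have key (g : R * R -> T) (k : R * R -> S) : {within H, continuous g} -> (forall p, H p ->
  chi (k p) = g p) ->
    forall (t : R) p, domain p ->
    tends (within (fun z : R * R * R => domain z.1) (nbhs (p, t))) (fun z : R * R * R =>
      chi (k z.1)) (chi (k p)).
  move=> cg gE t p /sub Hp; rewrite gE//.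
  have nD : \forall z \near within (fun z : R * R * R => domain z.1) (nbhs (p, t)), H z.1.
    by apply: filterS (near_within_mem (T := (R * R * R)%type) (fun z : R * R * R =>
      domain z.1) (p, t)) => z; exact: sub.
  apply: (tends_near_eq (g := fun z : R * R * R => g z.1)).
    by apply: filterS nD => z Hz; rewrite gE.
  apply: (tends_within cg Hp) => //; apply: tends_fstp; exact: tends_idw.
have cc : continuous (fun x : R * S => chi x.2).
  apply: (@continuous_descend2 _ _ _ _ _ (@domain R) (@domain R) h h' _ hS (@domain_compact R)
    (@domain_compact R)).
  - exact: continuous_subspaceW ch.
  - exact: continuous_subspaceW ch'.
  - rewrite !handle_reduce_image//; apply/seteqP; split => // x _.
    by case: (cov x) => -[p Hp px]; [left|right]; exists p.
  - exact: key cf e1.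
  - exact: key cf' e2.
move=> x; apply: tends_cts.
have t : tends (nbhs x) (fun y : S => (0 : R, y)) (0, x) by tnd.
exact: (tends_at (h := fun x : R * S => chi x.2) t (cc _)).
Qed.

Lemma blow_down_boundary p : dH p -> blow_down p = center_of p.
Proof.
move=> /hole_boundaryP e; rewrite /blow_down /periodize /collapse.
have -> : nrm (offset p) = 4^-1 by apply/eqP; rewrite nrm_eq//; apply/eqP.
rewrite collapse_factor_near; last by apply/andP; split; lra.
have -> : 3 - 3 / 4 / 4^-1 = 0 :> R by field.
by rewrite /scal !mul0r; exact: addr0.
Qed.

(* Collapsing the second handle and one coordinate of the first one maps [S]
   onto a circle; the winding numbers of loops recover the entries of [M]. *)
Lemma isotopy_winding M (co : R * R -> R) (u : R -> R * R) (n0 n : int) (c : R) :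
  M \in unitmx -> continuous co ->
  (forall p z, lattice z -> co (p + z) - co p \is a Num.int) ->
  (forall p, center p -> co p - 2^-1 \is a Num.int) ->
  continuous u -> (forall x, lattice (u (x + 1) - u x)) ->
  (forall x, (3 / 8) ^+ 2 <= hole_dist (u x)) ->
  (forall x, co (u x) = n0%:~R * x) -> (forall x, co (affine M (u x)) = n%:~R * x + c) ->
  isotopic R id (desc h h' (torus_map M)) -> n0 = n.
Proof.
move=> uM cco coz coc cu u1 ufar co0 co1 [F [cF _ F0 F1]].
have [[[hd hd'] cov meet] gl] := hh; have [ch ih] := hd.
have Hu x : H (u x) by apply/holed_planeP; apply: le_trans (ufar x); lra.
have pi2n : 2 * pi != 0 :> R by rewrite gt_eqF// pi2_gt0.
have polE (y : R) : pol 1 y = circle_pt (0, 0) 1 (2 * pi * y).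
  by rewrite /pol /circle_pt /= !add0r.
have polD (a b : R) : a - b \is a Num.int -> pol 1 a = pol 1 b.
  by move=> /intrP[k e]; rewrite -[a](subrK b) e addrC pol_int.
have co_lat (a b : R * R) : lattice (a - b) -> co a - co b \is a Num.int.
  by move=> l; have := coz b (a - b) l; rewrite [b + _]addrC subrK.
have bd_int p : 4^-1 ^+ 2 < hole_dist p -> blow_down (torus_map M p) = affine M (blow_down p).
  move=> ip; rewrite /torus_map (blow_interior (affine_toral R uM) ip).1 blow_upK//.
  by apply: (toral_hole_dist (affine_toral R uM)); exact: blow_down_gt0.
have H0 p : H p -> 0 < hole_dist p.
  by move=> /holed_planeP e; apply: lt_le_trans e; rewrite exprn_gt0.
have f1 : {within H, continuous (fun p => pol 1 (co (blow_down p)))}.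
  apply: continuous_in_subspaceT => p; rewrite inE => Hp; apply: tends_cts.
  apply: (tends_pol (f := fun=> 1)); first exact: tends_cst.
  apply: (tends_at (h := co) (f := @blow_down R)); last exact: cco.
  by apply: tends_nbhs; apply: blow_down_continuous; exact: H0.
(* Hole centres have coordinates 1/2 modulo 1, and the boundary circle collapses to such a centre,
   so the second handle has to go to this point of the circle. *)
have f2 : {within H, continuous (fun=> pol 1 2^-1 : R * R)}.
  by apply: continuous_subspaceT => p; exact: cst_continuous.
have f3 p q : H p -> H q -> lattice (p - q) -> pol 1 (co (blow_down p)) = pol 1 (co (blow_down q)).
  move=> _ _ l; apply: polD; apply: co_lat.
  have -> : p = q + (p - q) by rewrite addrC subrK.
  by rewrite /blow_down periodize_lattice// addrAC subrr add0r.
have f4 p : dH p -> pol 1 (co (blow_down p)) = pol 1 2^-1.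
  by move=> bp; apply: polD; rewrite blow_down_boundary//; apply: coc; exact: center_center_of.
have [chi [cchi chih chih']] := handle_function f1 f2 f3 (fun _ _ _ _ _ => erefl) f4.
have chi0 x : chi x != (0, 0).
  have pol0 y : pol 1 y != (0, 0) :> R * R.
    apply/eqP => e; have := sqn_pol 1 y; rewrite e /sqn /= expr0n addr0 expr1n => /esym/eqP.
    by rewrite oner_eq0.
  by move: x; apply: (handles_ind hh) => p Hp; [rewrite chih|rewrite chih'].
have cv x : {for x, continuous (fun y => h (u y))}.
  apply: tends_cts; apply: (tends_within ch); [exact: Hu|apply: tends_nbhs; exact: cu|].
  by apply: nearW => y; exact: Hu.
pose G (t s : R) := chi (F (t, h (u (s / (2 * pi))))).
have cG : {within [set p : R * R | 0 <= p.1 <= 1], continuous (fun p => G p.1 p.2)}.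
  have cFc : {within `[0, 1] `*` [set: S], continuous (chi \o F)}.
    apply: (within_comp (E := setT)) cF _ _ => //.
    by apply: continuous_subspaceT.
  apply: (within_comp (k := fun p : R * R => (p.1, h (u (p.2 / (2 * pi)))))) _ _ cFc; last first.
    by move=> p /= p01; split => //; rewrite /= in_itv.
  apply: continuous_subspaceT => p; apply: tends_cts; apply: tends_pair; first by tnd.
  apply: (tends_at (h := fun y => h (u y)) (f := fun p : R * R => p.2 / (2 * pi))); last exact: cv.
  by apply: tendsM; [tnd|exact: tends_cst].
have Gper t s : 0 <= t <= 1 -> G t (s + 2 * pi) = G t s.
  move=> _; rewrite /G mulrDl divff//; congr (chi (F (_, _))).
  by apply/ih; [exact: Hu..|exact: u1].
have bdu x : blow_down (u x) = u x.
  by rewrite /blow_down periodize_far//; exact: supported_collapse.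
have ip x : 4^-1 ^+ 2 < hole_dist (u x) by apply: lt_le_trans (ufar x); lra.
have w0 : winds (0, 0) (G 0) n0.
  apply: winds_eq (winds_isometry (0, 0) 0 n0 (@ltr01 R)) _ => s.
  rewrite /G F0 chih// bdu co0 polE; congr circle_pt.
  by rewrite addr0 mulrCA [2 * pi * (s / _)]mulrC divfK.
have dM := torus_map_descends R uM; have [dMH _ _] := dM.
have w1 : winds (0, 0) (G 1) n.
  apply: winds_eq (winds_isometry (0, 0) (2 * pi * c) n (@ltr01 R)) _ => s.
  rewrite /G F1 (desc_left hh dM)// chih; last exact: dMH.
  rewrite bd_int// bdu co1 polE; congr circle_pt.
  move: (2 * pi) pi2n => x xn.
  by field.
exact: winds_uniq (winds_homotopy cG Gper (fun t s _ => chi0 _) w0) w1.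
Qed.

(** The two coordinates along the two axes yield the four entries. The axes avoid the collapsed
    discs, so no correction arises there; [c] is a coordinate of the image of the origin. *)
Lemma isotopic_id_mx M : M \in unitmx -> isotopic R id (desc h h' (torus_map M)) -> M = 1%:M.
Proof.
move=> uM iso.
have far (x y : R) : x = 0 \/ y = 0 -> (3 / 8) ^+ 2 <= hole_dist (x, y).
  have c0 : (3 / 8) ^+ 2 <= cell (0 : R) ^+ 2 by apply: cell_small; apply/andP; split; lra.
  have := sqr_ge0 (cell x); have := sqr_ge0 (cell y).
  by rewrite /hole_dist /sqn /= => h1 h2 [] ->; lra.
have c1 : continuous (@fst R R) by move=> p; exact: cvg_fst.
have c2 : continuous (@snd R R) by move=> p; exact: cvg_snd.
have l1 (p z : R * R) : lattice z -> (p + z).1 - p.1 \is a Num.int.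
  by move=> [z1 _]; rewrite /= addrAC subrr add0r.
have l2 (p z : R * R) : lattice z -> (p + z).2 - p.2 \is a Num.int.
  by move=> [_ z2]; rewrite /= addrAC subrr add0r.
have m1 (p : R * R) : center p -> p.1 - 2^-1 \is a Num.int by case.
have m2 (p : R * R) : center p -> p.2 - 2^-1 \is a Num.int by case.
have u1 : continuous (fun x : R => (x, 0 : R)) by cts x.
have u2 : continuous (fun x : R => (0 : R, x)) by cts x.
have v1 (x : R) : lattice ((x + 1, 0 : R) - (x, 0)).
  by split; rewrite /= ?subrr ?rpred0// addrAC subrr add0r rpred1.
have v2 (x : R) : lattice ((0 : R, x + 1) - (0, x)).
  by split; rewrite /= ?subrr ?rpred0// addrAC subrr add0r rpred1.
have f1 (x : R) : (3 / 8) ^+ 2 <= hole_dist (x, 0 : R) by apply: far; right.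
have f2 (x : R) : (3 / 8) ^+ 2 <= hole_dist (0 : R, x) by apply: far; left.
have e00 : 1 = M 0 0.
  apply: (isotopy_winding (c := (affine M (0, 0)).1) uM c1 l1 m1 u1 v1 f1 _ _ iso) => x /=.
    by rewrite mul1r.
  by ring.
have e10 : 0 = M 1 0.
  apply: (isotopy_winding (c := (affine M (0, 0)).2) uM c2 l2 m2 u1 v1 f1 _ _ iso) => x /=.
    by rewrite mul0r.
  by ring.
have e01 : 0 = M 0 1.
  apply: (isotopy_winding (c := (affine M (0, 0)).1) uM c1 l1 m1 u2 v2 f2 _ _ iso) => x /=.
    by rewrite mul0r.
  by ring.
have e11 : 1 = M 1 1.
  apply: (isotopy_winding (c := (affine M (0, 0)).2) uM c2 l2 m2 u2 v2 f2 _ _ iso) => x /=.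
    by rewrite mul1r.
  by ring.
apply/matrixP => i j; rewrite mxE.
case: i => [[|[|i]] //= hi]; case: j => [[|[|j]] //= hj].
- by rewrite [RHS]/= -[RHS]/(1) e00; congr (M _ _); exact: val_inj.
- by rewrite -[RHS]/(0) e01; congr (M _ _); exact: val_inj.
- by rewrite -[RHS]/(0) e10; congr (M _ _); exact: val_inj.
- by rewrite -[RHS]/(1) e11; congr (M _ _); exact: val_inj.
Qed.
End Pair.
End Faithful.

(** * Generation and assembly *)

Section Generation.
Implicit Types (k : int) (M N : SL2Z).

Lemma det2 (A : 'M[int]_2) : (\det A = A 0 0 * A 1 1 - A 0 1 * A 1 0)%R.
Proof.
rewrite (expand_det_row A 0) !big_ord_recl big_ord0 /cofactor !det_mx11 !mxE.
rewrite /= addr0 expr0 mul1r expr1 mulN1r mulrN.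
by congr (_ * _ - _ * _)%R; congr (A _ _); exact: val_inj.
Qed.

Definition mx2 (a b c d : int) : 'M[int]_2 :=
  \matrix_(i, j) if i == 0 then (if j == 0 then a else b) else (if j == 0 then c else d).

Lemma mx2E (A : 'M[int]_2) : A = mx2 (A 0 0) (A 0 1) (A 1 0) (A 1 1).
Proof.
apply/matrixP => i j; rewrite mxE.
by case: i => [[|[|i]] //= hi]; case: j => [[|[|j]] //= hj]; congr (A _ _); exact: val_inj.
Qed.

Fact elem_upper_det k : \det (mx2 1 k 0 1) == 1%R.
Proof. by rewrite det2 !mxE /= mulr0 mulr1 subr0. Qed.

Fact elem_lower_det k : \det (mx2 1 0 k 1) == 1%R.
Proof. by rewrite det2 !mxE /= mul0r mulr1 subr0. Qed.

Definition elem_upper k : SL2Z := MkSL2Z (elem_upper_det k).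
Definition elem_lower k : SL2Z := MkSL2Z (elem_lower_det k).

Lemma elem_upper_mul k M : val (elem_upper k * M)%g =
  mx2 (M 0 0 + k * M 1 0)%R (M 0 1 + k * M 1 1)%R (M 1 0) (M 1 1).
Proof. by rewrite [LHS]mx2E /= !mulmx2E !mxE /= !mul1r !mul0r !add0r. Qed.

Lemma elem_lower_mul k M : val (elem_lower k * M)%g =
  mx2 (M 0 0) (M 0 1) (M 1 0 + k * M 0 0)%R (M 1 1 + k * M 0 1)%R.
Proof.
by rewrite [LHS]mx2E /= !mulmx2E !mxE /= !mul1r !mul0r !addr0 ![(k * _ + _)%R]addrC.
Qed.

Section Induction.
Variable P : SL2Z -> Prop.
Hypotheses (P1 : P 1%g) (PM : forall M N, P M -> P N -> P (M * N)%g) (PV : forall M, P M ->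
  P M^-1%g).
Hypotheses (PU : P (elem_upper 1)) (PL : P (elem_lower 1)).

(** Stated as an induction principle. The Euclidean algorithm on the first column lowers the sum of
    the absolute values of its entries until one entry vanishes. *)
Lemma SL2Z_generation M : P M.
Proof.
have eU : elem_upper (-1) = (elem_upper 1)^-1%g.
  apply: (mulgI (elem_upper 1)); rewrite mulgV; apply: val_inj.
  by rewrite elem_upper_mul !mxE /= [RHS]mx2E !mxE.
have eL : elem_lower (-1) = (elem_lower 1)^-1%g.
  apply: (mulgI (elem_lower 1)); rewrite mulgV; apply: val_inj.
  by rewrite elem_lower_mul !mxE /= [RHS]mx2E !mxE.
have PU' : P (elem_upper (-1)) by rewrite eU; exact: PV.
have PL' : P (elem_lower (-1)) by rewrite eL; exact: PV.
have stepU e N : e = 1%R \/ e = (-1)%R -> P (elem_upper e * N)%g -> P N.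
  move=> e1 p; have PUe : P (elem_upper (- e)) by case: e1 => ->; rewrite ?opprK.
  have -> : N = (elem_upper (- e) * (elem_upper e * N))%g; last exact: PM.
  rewrite mulgA -[LHS]mul1g; congr (_ * _)%g; apply: val_inj.
  by rewrite elem_upper_mul !mxE /= [LHS]mx2E !mxE /=; congr mx2; ring.
have stepL e N : e = 1%R \/ e = (-1)%R -> P (elem_lower e * N)%g -> P N.
  move=> e1 p; have PLe : P (elem_lower (- e)) by case: e1 => ->; rewrite ?opprK.
  have -> : N = (elem_lower (- e) * (elem_lower e * N))%g; last exact: PM.
  rewrite mulgA -[LHS]mul1g; congr (_ * _)%g; apply: val_inj.
  by rewrite elem_lower_mul !mxE /= [LHS]mx2E !mxE /=; congr mx2; ring.
have det1 N : (N 0 0 * N 1 1 - N 0 1 * N 1 0 = 1)%R by rewrite -det2; exact/eqP/SL2Z_det.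
(* The rotation of order 4. It exchanges the rows up to sign, which treats a vanishing upper left
   entry, and its square is -1, which treats diagonal entries -1. *)
pose W := (elem_upper 1 * (elem_lower (-1) * elem_upper 1))%g.
have PW : P W by apply: PM => //; exact: PM.
have WE : val W = mx2 0 1 (-1) 0.
  rewrite /W elem_upper_mul; have := elem_lower_mul (-1) (elem_upper 1).
  by rewrite /val /= => ->; rewrite !mxE.
have unip b : P (elem_upper b).
  have addU a c : (elem_upper a * elem_upper c)%g = elem_upper (c + a).
    apply: val_inj; rewrite elem_upper_mul !mxE /= !mulr0 mulr1 addr0.
    by congr mx2.
  have nat_case (m : nat) : P (elem_upper m).
    elim: m => [|m IH].
      have -> // : elem_upper 0 = 1%g; by apply: val_inj; rewrite [RHS]mx2E !mxE.
    by rewrite -addn1 PoszD -addU; exact: PM.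
  have [b0|b0] := leP 0%R b; first by have := nat_case `|b|%N; rewrite gez0_abs.
  have -> : elem_upper b = (elem_upper `|b|%N)^-1%g; last exact/PV/nat_case.
  apply: (mulgI (elem_upper `|b|%N)); rewrite mulgV addU.
  have -> : (b + `|b|%N = 0)%R by lia.
  by apply: val_inj; rewrite [LHS]mx2E [RHS]mx2E !mxE.
have neg N : P (W * (W * N))%g -> P N.
  move=> p; have -> : N = (W^-1 * (W^-1 * (W * (W * N))))%g by rewrite !mulKg.
  by apply: PM; [exact: PV|apply: PM => //; exact: PV].
have Wmul N : val (W * N)%g = mx2 (N 1 0) (N 1 1) (- N 0 0)%R (- N 0 1)%R.
  have -> : val (W * N)%g = (val W *m val N)%R by [].
  rewrite WE [LHS]mx2E !mulmx2E !mxE /=; congr mx2; ring.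
have base N : N 1 0 = 0%R -> P N.
  move=> c0; have := det1 N; rewrite c0 mulr0 subr0 => d1.
  have [[a1 b1]|[a1 b1]] : (N 0 0 = 1 /\ N 1 1 = 1 \/ N 0 0 = -1 /\ N 1 1 = -1)%R.
    have : N 0 0 \is a GRing.unit by apply/unitrPr; exists (N 1 1).
    move: d1; rewrite qualifE /= => d1 /orP[/eqP a1|/eqP a1]; rewrite a1 in d1 *; [left|right]; lia.
    have -> : N = elem_upper (N 0 1); last exact: unip.
    by apply: val_inj; rewrite [LHS]mx2E a1 c0 b1.
  apply: neg; have -> : (W * (W * N))%g = elem_upper (- N 0 1)%R; last exact: unip.
  apply: val_inj; rewrite Wmul; have := Wmul N; rewrite /val /= => ->.
  by rewrite !mxE /= c0 a1 b1 opprK oppr0.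
have [n] := ubnP (`|(M 0 0)%R| + `|(M 1 0)%R|)%N; elim: n M => // n IH N hn.
have [c0|c0] := eqVneq (N 1 0) 0%R; first exact: base.
have [a0|a0] := eqVneq (N 0 0) 0%R.
  have -> : N = (W^-1 * (W * N))%g by rewrite mulKg.
  apply: PM; first exact: PV.
  apply: base; have := Wmul N; rewrite /val /= => ->.
  by rewrite !mxE /= a0 oppr0.
have entU e : ((elem_upper e * N)%g : 'M[int]_2) 0 0 = (N 0 0 + e * N 1 0)%R /\
    ((elem_upper e * N)%g : 'M[int]_2) 1 0 = N 1 0.
  by have := elem_upper_mul e N; rewrite /val /= => ->; rewrite !mxE.
have entL e : ((elem_lower e * N)%g : 'M[int]_2) 0 0 = N 0 0 /\
    ((elem_lower e * N)%g : 'M[int]_2) 1 0 = (N 1 0 + e * N 0 0)%R.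
  by have := elem_lower_mul e N; rewrite /val /= => ->; rewrite !mxE.
have [le|le] := leqP `|(N 1 0)%R|%N `|(N 0 0)%R|%N.
  (* The entry of larger absolute value is reduced: the other one is subtracted if the signs agree
     and added if they differ. *)
  have [e e1 he] : exists2 e : int,
    (e = 1 \/ e = -1)%R & (`|(N 0 0 + e * N 1 0)%R| + `|(N 1 0)%R| < n)%N.
    have [s|s] := leP 0%R (N 0 0 * N 1 0)%R; [exists (-1)%R; first by right|exists 1%R;
      first by left]; move: (N 0 0) (N 1 0) a0 c0 hn le s; clear; nia.
  by apply: (stepU e N e1); apply: IH; have [-> ->] := entU e.
have [e e1 he] : exists2 e : int,
  (e = 1 \/ e = -1)%R & (`|(N 0 0)%R| + `|(N 1 0 + e * N 0 0)%R| < n)%N.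
  have [s|s] := leP 0%R (N 0 0 * N 1 0)%R; [exists (-1)%R; first by right|exists 1%R;
    first by left]; move: (N 0 0) (N 1 0) a0 c0 hn le s; clear; nia.
by apply: (stepL e N e1); apply: IH; have [-> ->] := entL e.
Qed.
End Induction.
End Generation.

(** * Matrices represented by mapping classes *)

Section Representation.
Variables (R : realType) (S : topologicalType) (O : set (R * R -> S)).
Hypotheses (cS : compact [set: S]) (hS : hausdorff_space S) (orO : orientation O).
Implicit Types (p q z : R * R) (M N : SL2Z) (x y : Mod O).
Local Notation H := (@holed_plane R).

Lemma swap_descends : descends (swap (R := R)).
Proof.
split=> [p /holed_planeP e|p q _ _ [a b]|p /hole_boundaryP e].
- by apply/holed_planeP; rewrite hole_dist_swap.
- by split.
- by apply/hole_boundaryP; rewrite hole_dist_swap.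
Qed.

Section Pair.
Variables (g g' : R * R -> S).
Hypothesis gg : glued g g'.

Definition torus_homeo M : S -> S := desc g g' (torus_map (R := R) M).

Let dM M := torus_map_descends R (SL2Z_unit M).

Lemma desc_sym k (x : S) : descends k -> desc g' g k x = desc g g' k x.
Proof.
move=> dk; have gs := glued_sym gg; move: x; apply: (handles_ind gg) => p Hp.
  by rewrite (desc_right gs dk Hp) (desc_left gg dk Hp).
by rewrite (desc_left gs dk Hp) (desc_right gg dk Hp).
Qed.

Lemma torus_homeoM M N : torus_homeo (M * N)%g = torus_homeo M \o torus_homeo N.
Proof.
apply/funext => x; rewrite -[RHS](desc_comp gg (dM M) (dM N)).
apply: (eq_desc gg) => [||p Hp]; [exact: dM|exact: descends_comp|].
by rewrite /= -(torus_map_mul (SL2Z_unit M) (SL2Z_unit N) Hp).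
Qed.

Lemma torus_homeo1 : torus_homeo 1%g = id.
Proof. by apply/funext => x; apply: (desc_id gg) => p Hp; exact: torus_map1. Qed.

Lemma torus_homeoK M (x : S) : torus_homeo M^-1%g (torus_homeo M x) = x.
Proof. by rewrite -[LHS]/((torus_homeo M^-1%g \o torus_homeo M) x) -torus_homeoM mulVg
  torus_homeo1. Qed.

Lemma torus_homeoVK M (x : S) : torus_homeo M (torus_homeo M^-1%g x) = x.
Proof. by rewrite -[LHS]/((torus_homeo M \o torus_homeo M^-1%g) x) -torus_homeoM mulgV
  torus_homeo1. Qed.

Lemma torus_homeoP M : homeomorphism (torus_homeo M).
Proof.
have cM N : continuous (torus_homeo N).
  by apply: (desc_continuous hS gg (dM N)); exact: torus_map_continuous (SL2Z_unit N).
split; first exact: cM.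
by exists (torus_homeo M^-1%g); split; [exact: cM|exact: torus_homeoK|exact: torus_homeoVK].
Qed.

Lemma torus_homeo_inj M N : isotopic R (torus_homeo M) (torus_homeo N) -> M = N.
Proof.
move=> /(isotopic_compl (torus_homeoP M^-1%g)); rewrite -!torus_homeoM mulVg torus_homeo1.
move=> /(isotopic_id_mx hS gg (SL2Z_unit _)) e.
have {}e : (M^-1 * N)%g = 1%g by apply: val_inj.
by rewrite -[N]mul1g -(mulgV M) -mulgA e mulg1.
Qed.

(** A relation, since [torus_homeo M] comes without a proof that it preserves the orientation and so
    is no element of [homeo]. It is compatible with the group operations and single-valued in both
    directions. *)
Definition represents x M := isotopic R (repr x) (torus_homeo M).

Lemma represents_class (f : homeo O) M : isotopic R f (torus_homeo M) ->
  represents (isotopy_class f) M.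
Proof. by apply: isotopic_trans_homeomorphism; [exact: homeoP|exact: isotopic_repr]. Qed.

Lemma represents1 : represents 1%g 1%g.
Proof. by apply: represents_class; rewrite torus_homeo1; exact: isotopic_refl. Qed.

Lemma representsM x y M N : represents x M -> represents y N -> represents (x * y)%g (M * N)%g.
Proof.
move=> rx ry; apply: represents_class; rewrite torus_homeoM.
apply: (@isotopic_trans_homeomorphism _ _ _ (repr x \o torus_homeo N)).
- exact: homeomorphism_comp (homeoP _) (torus_homeoP N).
- exact: isotopic_compl (homeoP _) ry.
- exact: isotopic_compr (torus_homeoP N) rx.
Qed.

Lemma representsV x M : represents x M -> represents x^-1%g M^-1%g.
Proof.
move=> rx; apply: represents_class; set f := repr x in rx *.
have := isotopic_compl (homeoP (homeoV f)) (isotopic_compr (torus_homeoP M^-1%g) rx).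
have -> : homeoV f \o (f \o torus_homeo M^-1%g) = torus_homeo M^-1%g.
  by apply/funext => z /=; rewrite homeoK.
have -> : homeoV f \o (torus_homeo M \o torus_homeo M^-1%g) = homeoV f.
  by apply/funext => z /=; rewrite torus_homeoVK.
exact: isotopic_sym.
Qed.

Lemma represents_eq x y M : represents x M -> represents y M -> x = y.
Proof.
move=> rx ry; rewrite -[x]isotopy_class_repr -[y]isotopy_class_repr; apply/isotopy_classP.
by apply: (isotopic_trans_homeomorphism (torus_homeoP M) rx); exact: isotopic_sym.
Qed.

Lemma represents_inj x M N : represents x M -> represents x N -> M = N.
Proof.
move=> rM rN; apply: torus_homeo_inj.
by apply: (isotopic_trans_homeomorphism (homeoP (repr x)) _ rN); exact: isotopic_sym.
Qed.

Lemma lower_swap p : H p ->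
  torus_map (R := R) (elem_lower 1) p = (swap (R := R) \o torus_map upper_mx \o swap (R := R)) p.
Proof.
move=> Hp; have [sH _ _] := swap_descends.
have [uH _ _] := torus_map_descends R upper_mx_unit.
have -> : (elem_lower 1 : 'M[int]_2) = (swap_mx *m (upper_mx *m swap_mx)).
  by apply/matrixP => i j; rewrite !mulmx2E !mxE; case: i j => [[|[|i]] ?] [[|[|j]] ?].
have us : upper_mx *m swap_mx \in unitmx by rewrite unitmx_mul upper_mx_unit swap_mx_unit.
rewrite (torus_map_mul swap_mx_unit us Hp) (torus_map_mul upper_mx_unit swap_mx_unit Hp).
rewrite torus_map_swap; last by rewrite torus_map_swap//; apply: uH; exact: sH.
by rewrite (torus_map_swap Hp).
Qed.
End Pair.

(** Exchanging the coordinates and the order of the handles together restores the pattern of signs,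
    positive first, and transposes the shear. Thus the result on meridians also serves for
    longitudes. *)
Lemma torus_homeo_swap g g' : glued g g' ->
  desc (g' \o swap (R := R)) (g \o swap (R := R)) (torus_map upper_mx) = torus_homeo g g'
    (elem_lower 1).
Proof.
move=> gg; have gs := glued_sym gg.
have du := torus_map_descends R upper_mx_unit.
have ds := descends_comp (descends_comp swap_descends du) swap_descends.
apply/funext => x; rewrite (desc_swap x gs du ds) (desc_sym gg x ds).
apply: (eq_desc gg) => [//||p Hp]; first exact: torus_map_descends (SL2Z_unit _).
by rewrite lower_swap.
Qed.

Lemma swap_axis (g : R * R -> S) : (g \o swap (R := R)) @` [set p | p.2 = 0] = g @` [set p | p.1
  = 0].
Proof.
apply/seteqP; split => _ [p /= p0 <-]; exists (swap p) => //=.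
by rewrite swapK.
Qed.

Section Twists.
Variables (g g' : R * R -> S).
Hypotheses (gg : glued g g') (sg : has_sign O g (0, 0) 1) (sg' : has_sign O g' (0, 0) (-1)).

Lemma represents_meridians t t' : left_dehn_twist (g @` [set p | p.2 = 0]) t ->
  left_dehn_twist (g' @` [set p | p.2 = 0]) t' -> represents g g' (t^-1 * t')%g (elem_upper 1).
Proof.
have [[[hg hg'] _ _] _] := gg.
move=> d d'; have e := twist_difference cS hS orO gg (sign_horizontal orO hg sg)
  (sign_horizontal orO hg' sg') d d' (isotopy_class_repr (t^-1 * t')%g).
rewrite /represents /torus_homeo (_ : (elem_upper 1 : 'M[int]_2) = upper_mx)//.
by apply/matrixP => i j; rewrite !mxE; case: i j => [[|[|i]] ?] [[|[|j]] ?].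
Qed.

(** The exchanged handles put [t'] in the role of the inverted twist; this is why the lower
    elementary matrix belongs to the inverse of [b]. *)
Lemma represents_longitudes t t' : left_dehn_twist (g @` [set p | p.1 = 0]) t ->
  left_dehn_twist (g' @` [set p | p.1 = 0]) t' -> represents g g' (t'^-1 * t)%g (elem_lower 1).
Proof.
have [[[hg hg'] _ _] _] := gg.
have ax (x : R) : 4^-1 ^+ 2 < hole_dist (swap (x, 0 : R)).
  rewrite hole_dist_swap; apply: near_axis_dist; apply: cell_small; apply/andP; split => /=; lra.
rewrite -!swap_axis => d d'.
have s1 (x : R) : has_sign O (g' \o swap (R := R)) (x, 0) 1.
  by rewrite -[1]opprK; apply: (sign_swap orO hg' (ax x)); exact: (sign_vertical orO hg' sg').
have s2 (x : R) : has_sign O (g \o swap (R := R)) (x, 0) (-1).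
  by apply: (sign_swap orO hg (ax x)); exact: (sign_vertical orO hg sg).
have e := twist_difference cS hS orO (glued_swap (glued_sym gg)) s1 s2 d' d
  (isotopy_class_repr (t'^-1 * t)%g).
by rewrite /represents -torus_homeo_swap.
Qed.
End Twists.
End Representation.

Lemma generated_subgroupP (G : groupType) (X : set G) :
  is_subgroup (generated_subgroup X) /\ X `<=` generated_subgroup X.
Proof.
split; last by move=> x Xx A [_]; exact.
split => [A [[]]//|x y hx hy A sA|x hx A sA]; have [[_ AM AV] _] := sA.
  by apply: AM; [exact: hx|exact: hy].
by apply: AV; exact: hx.
Qed.

Theorem theorem2p1 (R : realType) (S : topologicalType)
    (O : set (R * R -> S))
    (closedS : oriented_closed_surface O) (genusS : @genus_two R S)
    (E M1 M2 : set S) (sepE : @separates_into_handles R S E M1 M2)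
    (A1 B1 A2 B2 : set S)
    (curves1 : @handle_curves R S M1 E A1 B1)
    (curves2 : @handle_curves R S M2 E A2 B2)
    (TA1 TA2 TB1 TB2 : Mod O)
    (dehnA1 : left_dehn_twist A1 TA1) (dehnA2 : left_dehn_twist A2 TA2)
    (dehnB1 : left_dehn_twist B1 TB1) (dehnB2 : left_dehn_twist B2 TB2) :
  let a := (TA1^-1 * TA2)%g in
  let b := (TB1^-1 * TB2)%g in
  let T := generated_subgroup [set a; b] in
  subgroup_isomorphic T SL2Z.
Proof.
move=> a b T; have [cS hS _ orO] := closedS.
have [_ _ _ [h [hm1 eA1 eB1]]] := curves1; have [_ _ _ [h' [hm2 eA2 eB2]]] := curves2.
have [hh rims] := separated_handles sepE hm1 hm2.
(* The new parametrisations have the same axes as sets, so the hypotheses on the four Dehn twists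
   can be transported to them. *)
have [g [g' [gg [ag1 ag2] [ag1' ag2'] sg sg']]] := normal_form hS orO hh rims.
rewrite eA1 -ag1 in dehnA1; rewrite eB1 -ag2 in dehnB1.
rewrite eA2 -ag1' in dehnA2; rewrite eB2 -ag2' in dehnB2.
have ra : represents g g' a (elem_upper 1) by exact: (represents_meridians cS hS orO gg sg sg').
have rb : represents g g' b^-1%g (elem_lower 1).
  rewrite /b invgM invgK; exact: (represents_longitudes cS hS orO gg sg sg').
have [[T1 TM TV] Tab] := generated_subgroupP [set a; b].
(* Generation of SL2(Z) is applied to the existence of a class in [T] that represents the matrix;
   uniqueness of that class will make the chosen map multiplicative. *)
have [phi phiP] : exists phi : SL2Z -> Mod O, forall M, T (phi M) /\ represents g g' (phi M) M.
  have [|phi phiP] := @choice SL2Z (Mod O) (fun M x => T x /\ represents g g' x M); last by exists phi.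
  apply: SL2Z_generation.
  - by exists 1%g; split => //; exact: represents1.
  - move=> M N [x [Tx rx]] [y [Ty ry]]; exists (x * y)%g.
    by split; [exact: TM|exact: representsM].
  - by move=> M [x [Tx rx]]; exists x^-1%g; split; [exact: TV|exact: representsV].
  - by exists a; split => //; apply: Tab; left.
  - by exists b^-1%g; split => //; apply: TV; apply: Tab; right.
have phiM : {morph phi : M N / (M * N)%g}.
  move=> M N; have [_ r] := phiP (M * N)%g; have [_ rM] := phiP M; have [_ rN] := phiP N.
  exact: (represents_eq hS gg r (representsM hS gg rM rN)).
pose mphi := isMultiplicative.Build _ _ phi phiM.
pose Phi : {multiplicative SL2Z -> Mod O} := HB.pack phi mphi.
exists Phi; split.
  move=> M N e; have [_ rM] := phiP M; have [_ rN] := phiP N.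
  apply: (represents_inj hS gg rM).
  by rewrite (_ : phi M = phi N).
apply/seteqP; split => [_ [M _ <-]|x Tx]; first by have [] := phiP M.
(* The classes that represent some matrix form a subgroup containing [a] and [b], hence all of [T];
   this gives surjectivity. *)
pose K : set (Mod O) := [set x | exists M, represents g g' x M].
have : K x.
  apply: Tx; split.
    split; first by exists 1%g; exact: represents1.
      by move=> y z [M rM] [N rN]; exists (M * N)%g; exact: representsM.
    by move=> y [M rM]; exists M^-1%g; exact: representsV.
  move=> y [->|->]; first by exists (elem_upper 1).
  by exists (elem_lower 1)^-1%g; rewrite -[b]invgK; exact: representsV.
move=> [M rM]; exists M => //; have [_ r] := phiP M.
exact: (represents_eq hS gg r rM).
Qed.
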